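(* Let $a$ be a Misiurewicz point for the family $\mathbf{f}_c(z)=\sqrt[q]{z^p}+c$ with $(p,q)=(4,2)$. Then $K_a$ and $M_{4,2}$ are asymptotically self-similar about the point $a$, with the same scaling factor, and the same limit model up to multiplication by a nonzero complex constant.
   Context: For $c\in\mathbb{C}$, $\mathbf{f}_c$ (with $(p,q)=(4,2)$) is the multivalued map with $w\in\mathbf{f}_c(z)$ iff $(w-c)^2=z^4$, i.e. $w=z^2+c$ or $w=-z^2+c$. A forward orbit of $z_0$ under $\mathbf{f}_c$ is a sequence $(z_j)_{j\ge0}$ with $z_{j+1}\in\mathbf{f}_c(z_j)$ for all $j$; it is bounded if it is contained in a compact subset of $\mathbb{C}$. The filled Julia set $K_c$ is the set of all $z\in\mathbb{C}$ having at least one bounded forward orbit under $\mathbf{f}_c$. The Multibrot set $M_{4,2}$ is the set of all $c\in\mathbb{C}$ with $0\in K_c$. A parameter $a\in\mathbb{C}$ is a Misiurewicz point if the critical point $0$ has a unique bounded forward orbit under $\mathbf{f}_a$ and this orbit is strictly pre-periodic (eventually periodic but not periodic). For a closed nonempty $A\subset\mathbb{C}$ and $r>0$, let $A_r=(A\cap\overline{\mathbb{D}}_r)\cup\partial\mathbb{D}_r$, where $\mathbb{D}_r=\{|z|<r\}$, and let $T_{-x}A=\{z-x:z\in A\}$. For $\lambda\in\mathbb{C}$ with $|\lambda|>1$, $A$ is asymptotically self-similar about $x\in A$ with scaling factor $\lambda$ and limit model $B$ (a nonempty closed subset of $\mathbb{C}$) if, for some $r>0$, $(\lambda^kT_{-x}A)_r\to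 B_r$ as $k\to\infty$ in the Hausdorff distance. *)

(* Defs.v *)
From HB Require Import structures.
From mathcomp Require Import all_boot all_order all_algebra.
From mathcomp Require Import complex.
From mathcomp Require Import all_classical all_reals all_analysis.

Set Implicit Arguments.
Unset Strict Implicit.
Unset Printing Implicit Defensive.

Import Order.TTheory GRing.Theory Num.Theory.
Import numFieldNormedType.Exports.

Local Open Scope classical_set_scope.
Local Open Scope complex_scope.
Local Open Scope ring_scope.

(* [R[i]] itself carries no topology in MathComp-Analysis; its regular module
   [R[i]^o] does, namely the one induced by the complex modulus. *)
Notation Cx R := (R[i]^o).

(* The modulus with values in [R]; the norm of [R[i]] takes values in [R[i]]. *)
Definition cmod (R : realType) (z : Cx R) : R := complex.Re `|z|.

Definition corr (R : realType) (p q : nat) (c z w : Cx R) : Prop :=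
  (w - c) ^+ q = z ^+ p.

Definition forward_orbit (R : realType) (p q : nat) (c z0 : Cx R)
    (z : nat -> Cx R) : Prop :=
  z 0%N = z0 /\ forall j, corr p q c (z j) (z j.+1).

Definition bounded_orbit (R : realType) (z : nat -> Cx R) : Prop :=
  exists2 D : set (Cx R), compact D & forall j, D (z j).

Definition filled_julia (R : realType) (p q : nat) (c : Cx R) : set (Cx R) :=
  [set z0 | exists2 z, forward_orbit p q c z0 z & bounded_orbit z].

Definition multibrot (R : realType) (p q : nat) : set (Cx R) :=
  [set c | filled_julia p q c 0].

Definition periodic (T : Type) (z : nat -> T) : Prop :=
  exists2 n, (0 < n)%N & forall j, z (j + n)%N = z j.

Definition eventually_periodic (T : Type) (z : nat -> T) : Prop :=
  exists m, periodic (fun j => z (m + j)%N).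

Definition misiurewicz (R : realType) (p q : nat) (a : Cx R) : Prop :=
  exists z : nat -> Cx R,
    [/\ forward_orbit p q a 0 z, bounded_orbit z,
        forall z', forward_orbit p q a 0 z' -> bounded_orbit z' -> z' = z,
        eventually_periodic z & ~ periodic z].

(* Valued in [\bar R], so that no junk value of a supremum or an infimum can
   arise. *)
Definition hausdorff_dist (R : realType) (A B : set (Cx R)) : \bar R :=
  let excess (X Y : set (Cx R)) : \bar R :=
    ereal_sup [set ereal_inf [set (cmod (x - y))%:E | y in Y] | x in X] in
  Order.max (excess A B) (excess B A).

Definition truncation (R : realType) (r : R) (A : set (Cx R)) : set (Cx R) :=
  (A `&` [set z | cmod z <= r]) `|` [set z | cmod z = r].

Definition scale_set (R : realType) (m : Cx R) (A : set (Cx R)) : set (Cx R) :=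
  [set m * z | z in A].

Definition translate_set (R : realType) (x : Cx R) (A : set (Cx R)) :
    set (Cx R) := [set z - x | z in A].

Definition asymptotically_self_similar (R : realType) (A : set (Cx R))
    (x lambda : Cx R) (B : set (Cx R)) : Prop :=
  [/\ closed A, A x, 1 < cmod lambda, closed B & B !=set0] /\
  exists2 r : R, 0 < r &
    hausdorff_dist (truncation r (scale_set (lambda ^+ k) (translate_set x A)))
      (truncation r B) @[k --> \oo] --> 0%E.

(* Main.v *)
(* A Misiurewicz parameter [a] has a critical orbit that lands on a cycle, and the
   uniqueness of its bounded orbit means that every other branch escapes. Hence the points
   of the forward orbits of [a] inside the disc [W] of radius [|a| + 2] form a finite
   set [P], forward invariant in [W].

   Expansion. An analytic disc in [W] that meets [P] at most at its centre lifts under all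
   branches of the inverse, and each lift can be composed with a polynomial close to
   the identity that fixes [P] and the centre and has derivative greater than [1] at the
   centre. Iterating and applying the Schwarz lemma bounds the derivatives of the inverse
   branches; this shows that the cycle is repelling, with multiplier [lambda], and that
   inverse branches contract along bounded orbits that return away from [P]. As a
   consequence the preimages of the cycle are dense in [K_a].

   Similarity. Both sets are of the form [{z | z in K_(a + th (z - a))}], with [th = 0]
   for [K_a] and [th = 1] for the Multibrot set. The orbit of [z = a + zeta / lambda^k]
   reaches the cycle at macroscopic scale at the point [psi (kappa zeta)] in the limit,
   where [psi] linearizes the return map. Upper semicontinuity of [c |-> K_c] gives one half
   of the Hausdorff convergence to [psi (kappa zeta) in K_a]; for the other half, a point of
   [K_a] is approximated by a preimage of the cycle, which persists under perturbation by
   Hurwitz' argument (the minimum modulus principle).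

   Transversality. For [th = 1] the number [kappa] is nonzero: modulo [2] the derivative with
   respect to [c] of every point of the critical orbit is [1], whatever the signs, and
   [1/2] is not an algebraic integer.

   Analytic functions are handled through the local property of having a Taylor
   expansion of order two, which suffices for the maximum principle. *)
Require Import Defs.
From mathcomp Require Import all_boot all_order all_algebra.
From mathcomp Require Import complex.
From mathcomp Require Import all_classical all_reals all_analysis.
From mathcomp Require Import zify ring lra.
Import Order.TTheory GRing.Theory Num.Theory.
Import numFieldNormedType.Exports.
Local Open Scope classical_set_scope.
Local Open Scope ring_scope.

Set Implicit Arguments.
Unset Strict Implicit.
Unset Printing Implicit Defensive.

(** * Modulus, neighbourhoods of a point, and finite Taylor expansions *)

Section Modulus.
Variable R : realType.
Implicit Types (x y z w : R[i]).

(** The classical source of expansion is the hyperbolic metric off the postcritical set. Discs take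
    its place here: a point is measured by the derivative at the centre of a disc through it, and
    branches of the inverse carry discs to discs. The gain of each step is paid for by the half unit
    between the radii [|a| + 3/2], where lifts land, and [|a| + 2]. Discs may be centred on [P], so
    one estimate yields both the repelling cycle and the contraction away from [P].

    The obstacle in passing from orbits to sets is the choice of signs: membership in a filled Julia
    set asks for some bounded choice only. Near the critical orbit the wrong sign leads to an
    escaping point, and escape is open in point and parameter together. A bounded orbit thus has no
    choice until it has left that neighbourhood, which is why boundedness can be read off at the
    macroscopic scale.

    The models for [th = 0] and [th = 1] come from the same [psi] and differ only in the factor
    [kappa]; the constant relating them is the quotient of the two factors. *)

Definition nm z : R := Normc.normc z.

Lemma nm0 : nm 0 = 0. Proof. exact: Normc.normc0. Qed.
Lemma nm1 : nm 1 = 1. Proof. exact: Normc.normc1. Qed.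
Lemma nmM x y : nm (x * y) = nm x * nm y. Proof. exact: Normc.normcM. Qed.
Lemma nmV x : nm x^-1 = (nm x)^-1. Proof. exact: Normc.normcV. Qed.
Lemma nmN x : nm (- x) = nm x. Proof. exact: normcN. Qed.
Lemma nmD x y : nm (x + y) <= nm x + nm y. Proof. exact: le_normcD. Qed.
Lemma nm_ge0 x : 0 <= nm x.
Proof. by case: x => a b; rewrite /nm /= sqrtr_ge0. Qed.
Lemma nm_eq0 x : (nm x == 0) = (x == 0).
Proof.
apply/eqP/eqP => [/Normc.eq0_normc //|->]; exact: nm0.
Qed.
Lemma nm_gt0 x : (0 < nm x) = (x != 0).
Proof. by rewrite lt_def nm_ge0 andbT nm_eq0. Qed.
Lemma nmX x n : nm (x ^+ n) = nm x ^+ n.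
Proof. by elim: n => [|n IH]; rewrite ?expr0 ?nm1 // !exprS nmM IH. Qed.
Lemma nm_div x y : nm (x / y) = nm x / nm y. Proof. by rewrite nmM nmV. Qed.
Lemma nmB x y : nm (x - y) <= nm x + nm y.
Proof. by rewrite -(nmN y) nmD. Qed.
Lemma nm_sym x y : nm (x - y) = nm (y - x).
Proof. by rewrite -nmN opprB. Qed.
Lemma nm_tri y x z : nm (x - z) <= nm (x - y) + nm (y - z).
Proof. by rewrite -[x - z](subrKA y) nmD. Qed.
Lemma nm_subl x y : nm x - nm y <= nm (x - y).
Proof. by rewrite lerBlDr -{1}(subrK y x) nmD. Qed.
Lemma nm_sqr x : nm x ^+ 2 = complex.Re x ^+ 2 + complex.Im x ^+ 2.
Proof.
by case: x => a b; rewrite /nm /= sqr_sqrtr // addr_ge0 ?sqr_ge0.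
Qed.
Lemma nm_real (t : R) : nm t%:C%C = `|t|.
Proof. by rewrite /nm /= expr0n addr0 sqrtr_sqr. Qed.
Lemma nm_nat n : nm n%:R = n%:R.
Proof. by rewrite -(rmorph_nat (real_complex R)) nm_real ger0_norm. Qed.
Lemma nm_le_parts x : nm x <= `|complex.Re x| + `|complex.Im x|.
Proof.
rewrite -ler_sqr ?nnegrE ?addr_ge0 ?nm_ge0 // nm_sqr.
rewrite -(real_normK (num_real (complex.Re x))) -(real_normK (num_real (complex.Im x))).
have := mulr_ge0 (normr_ge0 (complex.Re x)) (normr_ge0 (complex.Im x)); lra.
Qed.
Lemma Re_le_nm x : `|complex.Re x| <= nm x.
Proof.
rewrite -ler_sqr ?nnegrE ?nm_ge0 // nm_sqr real_normK ?num_real //.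
by rewrite lerDl sqr_ge0.
Qed.
Lemma Im_le_nm x : `|complex.Im x| <= nm x.
Proof.
rewrite -ler_sqr ?nnegrE ?nm_ge0 // nm_sqr real_normK ?num_real //.
by rewrite lerDr sqr_ge0.
Qed.
Lemma nm_prod (I : Type) (s : seq I) (P : pred I) (F : I -> R[i]) :
  nm (\prod_(i <- s | P i) F i) = \prod_(i <- s | P i) nm (F i).
Proof. exact: (big_morph nm nmM nm1). Qed.


(** Neighbourhoods in terms of the real modulus keep the analysis on [R[i]] elementary; [nbhs_nr]
    links them to the topology of [Cx R]. *)
Definition nr z (P : R[i] -> Prop) :=
  exists2 d : R, 0 < d & forall w, nm (w - z) < d -> P w.

Lemma nr_and z P Q : nr z P -> nr z Q -> nr z (fun w => P w /\ Q w).
Proof.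
move=> [d d0 hP] [e e0 hQ]; exists (Num.min d e); first by rewrite lt_min d0.
by move=> w; rewrite lt_min => /andP[/hP ? /hQ ?].
Qed.
Lemma nr_imp z (P Q : R[i] -> Prop) : (forall w, P w -> Q w) -> nr z P -> nr z Q.
Proof. by move=> h [d d0 hP]; exists d => // w /hP /h. Qed.
Lemma nr_self z P : nr z P -> P z.
Proof. by move=> [d d0]; apply; rewrite subrr nm0. Qed.
Lemma nr_all z (P : R[i] -> Prop) : (forall w, P w) -> nr z P.
Proof. by move=> h; exists 1. Qed.
Lemma nr_seq (T : eqType) (s : seq T) z (P : T -> R[i] -> Prop) :
  (forall t, t \in s -> nr z (P t)) -> nr z (fun w => forall t, t \in s -> P t w).
Proof.
elim: s => [|t s IH] h; first exact: nr_all.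
have h1 := h t (mem_head _ _).
have h2 : nr z (fun w => forall u, u \in s -> P u w).
  by apply: IH => y ys; apply: h; rewrite in_cons ys orbT.
apply: nr_imp (nr_and h1 h2) => w [? hs] y.
by rewrite in_cons => /orP[/eqP ->//|]; apply: hs.
Qed.

Definition cont (f : R[i] -> R[i]) z :=
  forall e : R, 0 < e -> nr z (fun w => nm (f w - f z) < e).

Lemma cont_near f g z : nr z (fun w => f w = g w) -> cont f z -> cont g z.
Proof.
move=> h hf e e0; apply: nr_imp (nr_and h (hf e e0)) => w [<-].
by rewrite (nr_self h).
Qed.
Lemma cont_cst (k : R[i]) z : cont (fun=> k) z.
Proof. by move=> e e0; apply: nr_all => w; rewrite subrr nm0. Qed.
Lemma cont_id z : cont id z.
Proof. by move=> e e0; exists e. Qed.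
Lemma contD f g z : cont f z -> cont g z -> cont (fun w => f w + g w) z.
Proof.
move=> hf hg e e0; have e2 : 0 < e / 2 by lra.
apply: nr_imp (nr_and (hf _ e2) (hg _ e2)) => w [h1 h2].
have -> : f w + g w - (f z + g z) = (f w - f z) + (g w - g z) by ring.
by apply: le_lt_trans (nmD _ _) _; lra.
Qed.
Lemma contM f g z : cont f z -> cont g z -> cont (fun w => f w * g w) z.
Proof.
move=> hf hg e e0; set A := nm (f z) + nm (g z) + 1.
have A0 : 0 < A by have := nm_ge0 (f z); have := nm_ge0 (g z); rewrite /A; lra.
have h0 : 0 < Num.min 1 (e / (2 * A)).
  by rewrite lt_min ltr01 divr_gt0 // mulr_gt0.
apply: nr_imp (nr_and (hf _ h0) (hg _ h0)) => w [].
rewrite !lt_min => /andP[h1 h2] /andP[h3 h4].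
have -> : f w * g w - f z * g z =
   (f w - f z) * (g w - g z) + (f z * (g w - g z) + (f w - f z) * g z) by ring.
apply: le_lt_trans (nmD _ _) _; apply: le_lt_trans (lerD (lexx _) (nmD _ _)) _.
rewrite !nmM; move: h1 h2 h3 h4; rewrite !ltr_pdivlMr ?mulr_gt0 //.
have := nm_ge0 (f w - f z); have := nm_ge0 (g w - g z).
have := nm_ge0 (f z); have := nm_ge0 (g z).
clear h0; rewrite /A in A0 *.
move: (nm (f w - f z)) (nm (g w - g z)) (nm (f z)) (nm (g z)) A0.
by move=> a b c d A0 *; nra.
Qed.
Lemma cont_neq0 f z : cont f z -> f z != 0 -> nr z (fun w => f w != 0).
Proof.
move=> hf h; have := hf (nm (f z)); rewrite nm_gt0 => /(_ h).
apply: nr_imp => w; apply: contraTneq => ->.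
by rewrite sub0r nmN ltxx.
Qed.
Lemma contV f z : f z != 0 -> cont f z -> cont (fun w => (f w)^-1) z.
Proof.
move=> f0 hf e e0; have n0 : 0 < nm (f z) by rewrite nm_gt0.
have h2 : 0 < nm (f z) / 2 by lra.
have h3 : 0 < e * (nm (f z) ^+ 2 / 2) by rewrite mulr_gt0 // divr_gt0 ?exprn_gt0.
apply: nr_imp (nr_and (cont_neq0 hf f0) (nr_and (hf _ h2) (hf _ h3))).
move=> w [w0 [hw1 hw2]].
have -> : (f w)^-1 - (f z)^-1 = (f z - f w) / (f w * f z).
  by field; rewrite w0 f0.
rewrite nm_div nm_sym nmM ltr_pdivrMr ?mulr_gt0 ?nm_gt0 //.
apply: lt_le_trans hw2 _; rewrite ler_pM2l //.
have : nm (f z) - nm (f w) <= nm (f w - f z) by rewrite nm_sym nm_subl.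
by nra.
Qed.
Lemma cont_comp f g z : cont g z -> cont f (g z) -> cont (fun w => f (g w)) z.
Proof.
by move=> hg hf e /hf [d d0 hd]; apply: nr_imp (hg d d0) => w /hd.
Qed.

(** The difference quotient at [z] has order one less, so order 2 means
    [f w = f z + (w - z) g z + (w - z)^2 k w] near [z] with [k] continuous at [z]. The condition
    concerns the single point [z], and it passes through products, inverses, compositions and
    continuous square roots. *)
Fixpoint taylor n (f : R[i] -> R[i]) z : Prop :=
  if n is k.+1 then
    exists2 g, nr z (fun w => f w = f z + (w - z) * g w) & taylor k g z
  else cont f z.

Lemma taylor_near n f g z : nr z (fun w => f w = g w) -> taylor n f z -> taylor n g z.
Proof.
case: n => [|n] h; first exact: cont_near.
move=> [k hk tk]; exists k => //; apply: nr_imp (nr_and h hk) => w [<- ->].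
by rewrite (nr_self h).
Qed.
Lemma taylorS n f z : taylor n.+1 f z -> taylor n f z.
Proof.
elim: n f => [|n IH] f [g hg tg]; last by exists g => //; apply: IH.
apply: cont_near (_ : cont (fun w => f z + (w - z) * g w) z).
  by apply: nr_imp hg => w ->.
apply: contD; first exact: cont_cst.
by apply: contM => //; apply: contD; [exact: cont_id|exact: cont_cst].
Qed.
Lemma taylor_cont n f z : taylor n f z -> cont f z.
Proof. by elim: n => [//|n IH] /taylorS. Qed.
Lemma taylor_cst n (k : R[i]) z : taylor n (fun=> k) z.
Proof.
elim: n k => [|n IH] k; first exact: cont_cst.
by exists (fun=> 0) => //; apply: nr_all => w; ring.
Qed.
Lemma taylor_id n z : taylor n id z.
Proof.
case: n => [|n]; first exact: cont_id.
by exists (fun=> 1); [apply: nr_all => w; ring|exact: taylor_cst].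
Qed.
Lemma taylorD n f g z : taylor n f z -> taylor n g z -> taylor n (fun w => f w + g w) z.
Proof.
elim: n f g => [|n IH] f g; first exact: contD.
move=> [f1 hf tf] [g1 hg tg]; exists (fun w => f1 w + g1 w); last exact: IH.
by apply: nr_imp (nr_and hf hg) => w [-> ->]; ring.
Qed.
Lemma taylorM n f g z : taylor n f z -> taylor n g z -> taylor n (fun w => f w * g w) z.
Proof.
elim: n f g => [|n IH] f g; first exact: contM.
move=> [f1 hf tf] hg0; have tg' := taylorS hg0; move: hg0 => [g1 hg tg].
exists (fun w => f1 w * g w + f z * g1 w).
  apply: nr_imp (nr_and hf hg) => w [-> hw].
  by rewrite mulrDl {1}hw; ring.
by apply: taylorD; apply: IH => //; exact: taylor_cst.
Qed.
Lemma taylorV n f z : f z != 0 -> taylor n f z -> taylor n (fun w => (f w)^-1) z.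
Proof.
elim: n f => [|n IH] f f0; first exact: contV.
move=> tf; have tf' := taylorS tf; have cf := taylor_cont tf; move: tf => [f1 hf tf].
exists (fun w => - (f z)^-1 * (f1 w * (f w)^-1)).
  apply: nr_imp (nr_and (cont_neq0 cf f0) hf) => w [w0 hw].
  have hw' : (w - z) * f1 w = f w - f z by rewrite hw; ring.
  apply: (mulIf w0); rewrite mulVf // mulrDl mulrCA !mulrA.
  rewrite [X in _ + X](_ : _ = - (f z)^-1 * ((w - z) * f1 w) * ((f w)^-1 * f w)); last by ring.
  by rewrite mulVf // mulr1 hw'; field.
apply: taylorM; first exact: taylor_cst.
by apply: taylorM => //; apply: IH.
Qed.
Lemma taylor_comp n f g z : taylor n g z -> taylor n f (g z) -> taylor n (fun w => f (g w)) z.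
Proof.
elim: n f g => [|n IH] f g; first exact: cont_comp.
move=> tg; have tg' := taylorS tg; have cg := taylor_cont tg; move: tg => [g1 hg tg].
move=> [f1 [d d0 hf] tf]; exists (fun w => g1 w * f1 (g w)).
  apply: nr_imp (nr_and hg (cg d d0)) => w [hw /hf ->].
  by rewrite [X in (X - _) * _]hw; ring.
by apply: taylorM => //; apply: IH.
Qed.
(** By [(s w - s z)(s w + s z) = f w - f z], the quotient of [s] is that of [f] divided by
    [s w + s z]; continuity of [s] starts a bootstrap that gains one order at a time. *)
Lemma taylor_sqrt n f s z : cont s z -> nr z (fun w => s w ^+ 2 = f w) ->
  f z != 0 -> taylor n f z -> taylor n s z.
Proof.
move=> cs hs f0; have s0 : s z != 0.
  by move: f0; rewrite -(nr_self hs) expf_eq0.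
have h2 : nr z (fun w => s w + s z != 0).
  apply: cont_neq0; last by rewrite -mulr2n mulrn_eq0.
  by apply: contD => //; apply: cont_cst.
elim: n f hs f0 => [//|n IH] f hs f0 tf.
have ts : taylor n s z by apply: IH hs f0 _; exact: taylorS.
move: tf => [g hg tg]; exists (fun w => g w * (s w + s z)^-1).
  apply: nr_imp (nr_and h2 (nr_and hs hg)) => w [w0 [e1 e2]].
  have e3 : (w - z) * g w = (s w - s z) * (s w + s z).
    by rewrite -subr_sqr e1 (nr_self hs) e2; ring.
  by rewrite mulrA e3 mulfK //; ring.
apply: taylorM => //; apply: taylorV; first by rewrite -mulr2n mulrn_eq0.
by apply: taylorD => //; exact: taylor_cst.
Qed.
Lemma taylor_prod n (I : Type) (r : seq I) (P : pred I) (F : I -> R[i] -> R[i]) z :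
  (forall i, taylor n (F i) z) -> taylor n (fun w => \prod_(i <- r | P i) F i w) z.
Proof.
move=> h; elim: r => [|i r IH].
  apply: taylor_near (taylor_cst n 1 z); apply: nr_all => w; by rewrite big_nil.
case Pi : (P i).
  apply: taylor_near (taylorM (h i) IH); apply: nr_all => w; by rewrite big_cons Pi.
apply: taylor_near IH; apply: nr_all => w; by rewrite big_cons Pi.
Qed.

(** Derivative in the form of Caratheodory: the value at [z] of a continuous difference quotient. *)
Definition hasder f z (d : R[i]) :=
  exists g, [/\ nr z (fun w => f w = f z + (w - z) * g w), cont g z & g z = d].

Lemma hasder_near f g z d : nr z (fun w => f w = g w) -> hasder f z d -> hasder g z d.
Proof.
move=> h [k [hk ck kd]]; exists k; split => //; apply: nr_imp (nr_and h hk) => w [<- ->].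
by rewrite (nr_self h).
Qed.
Lemma hasder_cont f z d : hasder f z d -> cont f z.
Proof. by move=> [g [h cg _]]; apply: (@taylorS 0); exists g. Qed.
Lemma hasder_comp f g z d e : hasder g z d -> hasder f (g z) e ->
  hasder (fun w => f (g w)) z (e * d).
Proof.
move=> hg0; have cg := hasder_cont hg0; move: hg0 => [g1 [hg cg1 <-]].
move=> [f1 [[r r0 hf] cf <-]]; exists (fun w => f1 (g w) * g1 w); split => //.
  apply: nr_imp (nr_and hg (cg r r0)) => w [hw /hf ->].
  by rewrite [X in (X - _) * _]hw; ring.
by apply: contM => //; apply: cont_comp.
Qed.
Lemma hasder_affine (k y z : R[i]) : hasder (fun w => y + k * w) z k.
Proof.
exists (fun=> k); split => //; last exact: cont_cst.
by apply: nr_all => w; ring.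
Qed.
Lemma hasder_sqrt f s z d : cont s z -> nr z (fun w => s w ^+ 2 = f w) ->
  f z != 0 -> hasder f z d -> hasder s z (d / (2 * s z)).
Proof.
move=> cs hs f0 [g [hg tg <-]]; have s0 : s z != 0.
  by move: f0; rewrite -(nr_self hs) expf_eq0.
have c2 : cont (fun w => s w + s z) z by apply: contD => //; apply: cont_cst.
have s2 : s z + s z != 0 by rewrite -mulr2n mulrn_eq0.
exists (fun w => g w * (s w + s z)^-1); split; last by rewrite mulr_natl mulr2n.
  apply: nr_imp (nr_and (cont_neq0 c2 s2) (nr_and hs hg)) => w [w0 [e1 e2]].
  have e3 : (w - z) * g w = (s w - s z) * (s w + s z).
    by rewrite -subr_sqr e1 (nr_self hs) e2; ring.
  by rewrite mulrA e3 mulfK //; ring.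
by apply: contM => //; exact: contV.
Qed.

End Modulus.

(** * Compactness of the disc, the maximum principle and its consequences *)

Section MaximumPrinciple.
Variable R : realType.
Implicit Types (x y z w : R[i]).

(** Uniformity over closed discs is always drawn from this form of compactness. It is transferred
    from the square [[-r, r]^2] in [R * R], whose points outside the disc have neighbourhoods where
    the claim is void. *)
Lemma disc_cover (r : R) (P : nat -> R[i] -> Prop) :
  (forall x, nm x <= r -> exists2 d : R, 0 < d &
     exists N, forall n y, (N <= n)%N -> nm (y - x) < d -> P n y) ->
  exists N, forall n y, (N <= n)%N -> nm y <= r -> P n y.
Proof.
move=> h.
pose box : set (R * R)%type := `[- r, r] `*` `[- r, r].
have cbox : compact box by apply: compact_setX; exact: segment_compact.
have /compact_near_coveringP cov := cbox.
pose Q n (p : R * R) := nm (Complex p.1 p.2) <= r -> P n (Complex p.1 p.2).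
have [|N _ hN] := cov nat \oo Q _.
  move=> [a b] _; set x := Complex a b.
  have [d d0 [N hd]] : exists2 d : R, 0 < d & exists N, forall n y, (N <= n)%N ->
      nm (y - x) < d -> nm y <= r -> P n y.
    have [xr|xr] := leP (nm x) r.
      by have [d d0 [N hN]] := h x xr; exists d => //; exists N => n y hn hy _; exact: hN.
    exists (nm x - r); first lra.
    exists 0%N => n y _ hy yr; exfalso.
    have := nm_subl x y; rewrite nm_sym; lra.
  exists (ball (a, b) (d / 2), [set n | (N <= n)%N]) => /=.
    split; first by apply: nbhsx_ballx; lra.
    by exists N.
  move=> [[u v] n] /= [[]]; rewrite /ball /= => hu hv hn.
  apply: hd => //.
  apply: le_lt_trans (nm_le_parts _) _ => /=.
  by rewrite distrC (distrC v); lra.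
exists N => n y hn yr.
have := hN n hn (complex.Re y, complex.Im y).
rewrite /Q /= -[Complex _ _]/(Complex _ _); case: y yr => a b yr /=; apply => //.
split => /=; rewrite in_itv /= -ler_norml.
  exact: le_trans (Re_le_nm (Complex a b)) yr.
exact: le_trans (Im_le_nm (Complex a b)) yr.
Qed.

Lemma small_inv (e : R) : 0 < e -> exists N, forall n, (N <= n)%N -> n.+1%:R^-1 < e.
Proof.
move=> e0; have := archi_boundP (ltW (_ : 0 < e^-1)); rewrite invr_gt0 => /(_ e0).
set N := Num.bound _ => hN; exists N => n hn.
rewrite -[e]invrK ltf_pV2 ?posrE ?invr_gt0 ?ltr0n //.
by apply: lt_le_trans hN _; rewrite ler_nat leqW.
Qed.

Lemma pow_unbounded (x y : R) : 1 < x -> exists N, y < x ^+ N.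
Proof.
move=> x1.
have bern n : 1 + n%:R * (x - 1) <= x ^+ n.
  elim: n => [|n IH]; first by rewrite mul0r expr0 addr0.
  rewrite exprS -natr1; have n0 : 0 <= n%:R :> R by exact: ler0n.
  have : 0 <= x * (x ^+ n - (1 + n%:R * (x - 1))) by rewrite mulr_ge0 ?subr_ge0 //; lra.
  have : 0 <= n%:R * (x - 1) ^+ 2 by rewrite mulr_ge0 ?sqr_ge0.
  nra.
have y0 : 0 <= `|y| / (x - 1) by apply: divr_ge0 => //; lra.
have := archi_boundP y0; set N := Num.bound _ => hN; exists N.
apply: lt_le_trans (bern N); move: hN; rewrite ltr_pdivrMr; last lra.
by have := ler_norm y; lra.
Qed.

(** [disc_cover] is used twice: to bound [f], and then, if the supremum were not attained, to bound
    [f] by the supremum minus some [1 / (M + 1)]. *)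
Lemma compact_max (A : R[i] -> Prop) (f : R[i] -> R) (r : R) (x0 : R[i]) :
  A x0 -> (forall x, A x -> nm x <= r) ->
  (forall x, ~ A x -> nr x (fun w => ~ A w)) ->
  (forall x, A x -> forall e : R, 0 < e -> nr x (fun w => `|f w - f x| < e)) ->
  exists2 x, A x & forall y, A y -> f y <= f x.
Proof.
move=> A0 Ar cA cf.
pose E := [set t | exists2 x, A x & f x = t].
have [N hN] : exists N, forall n y, (N <= n)%N -> nm y <= r -> (A y -> f y <= n%:R).
  apply: (@disc_cover r (fun n y => A y -> f y <= n%:R)) => x _.
  have [Ax|Ax] := EM (A x); last first.
    by have [d d0 hd] := cA x Ax; exists d => //; exists 0%N => n y _ /hd.
  have [d d0 hd] := cf x Ax 1 ltr01; exists d => //.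
  have := archi_boundP (normr_ge0 (`|f x| + 1)); set N := Num.bound _ => hN.
  exists N => n y hn /hd hy _.
  have hNn : N%:R <= n%:R :> R by rewrite ler_nat.
  move: hN; rewrite ger0_norm ?addr_ge0 // => hN.
  have := ler_norm (f y - f x); have := ler_norm (f x); lra.
have supE : has_sup E.
  split; first by exists (f x0), x0.
  by exists N%:R => _ [x Ax <-]; apply: (hN N) => //; exact: Ar.
apply: contrapT => nex.
have lts x : A x -> f x < sup E.
  move=> Ax; rewrite lt_neqAle; apply/andP; split; last first.
    by apply: sup_upper_bound => //; exists x.
  apply/eqP => fx; apply: nex; exists x => // y Ay.
  by rewrite fx; apply: sup_upper_bound => //; exists y.
have [M hM] : exists M, forall n y, (M <= n)%N -> nm y <= r ->
    (A y -> f y <= sup E - n.+1%:R^-1).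
  apply: (@disc_cover r (fun n y => A y -> f y <= sup E - n.+1%:R^-1)) => x _.
  have [Ax|Ax] := EM (A x); last first.
    by have [d d0 hd] := cA x Ax; exists d => //; exists 0%N => n y _ /hd.
  have e0 : 0 < (sup E - f x) / 2 by have := lts x Ax; lra.
  have [d d0 hd] := cf x Ax _ e0; exists d => //.
  have [M hM] := small_inv e0; exists M => n y hn /hd hy _.
  move: (n.+1%:R^-1) (hM n hn) => u hu; have := ler_norm (f y - f x); lra.
have MI : 0 < M.+1%:R^-1 :> R by rewrite invr_gt0 ltr0n.
have [t [x Ax <-]] := sup_adherent MI supE.
by move: (M.+1%:R^-1) MI (hM M x (leqnn _) (Ar x Ax) Ax) => u u0 hu hx; lra.
Qed.

Lemma nm_cont f z (e : R) : cont f z -> 0 < e -> nr z (fun w => `|nm (f w) - nm (f z)| < e).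
Proof.
move=> cf e0; apply: nr_imp (cf e e0) => w; apply: le_lt_trans.
have h1 := nm_subl (f w) (f z); have h2 := nm_subl (f z) (f w).
by rewrite ler_norml -[nm (f w - _)]nm_sym; rewrite nm_sym in h1; apply/andP; split; lra.
Qed.

Definition dotc z w := complex.Re z * complex.Re w + complex.Im z * complex.Im w.

Lemma nmD_ge z w : nm z ^+ 2 + 2 * dotc z w <= nm (z + w) ^+ 2.
Proof.
case: z => a b; case: w => c d; rewrite !nm_sqr /dotc /=.
by have := sqr_ge0 c; have := sqr_ge0 d; nra.
Qed.
Lemma dotcD z x y : dotc z (x + y) = dotc z x + dotc z y.
Proof. by case: x => a b; case: y => c d; rewrite /dotc /=; ring. Qed.
Lemma dotc_ge z w : - (2 * (nm z * nm w)) <= dotc z w.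
Proof.
have h (x y x' y' : R) : `|x| <= x' -> `|y| <= y' -> - (x' * y') <= x * y.
  move=> hx hy; have := ler_norm (- (x * y)); rewrite normrN normrM.
  by have := ler_pM (normr_ge0 x) (normr_ge0 y) hx hy; lra.
have := h _ _ _ _ (Re_le_nm z) (Re_le_nm w).
have := h _ _ _ _ (Im_le_nm z) (Im_le_nm w).
by rewrite /dotc; lra.
Qed.

(* Summing over the four points [z + i^k h] kills the terms of degree one and two
   of the Taylor expansion of [f], so that [|f|^2 + e |.|^2] is strictly
   subharmonic to second order. *)
Lemma no_local_max f z (e d : R) : taylor 2 f z -> 0 < e -> 0 < d ->
  exists2 w, nm (w - z) < d &
    nm (f z) ^+ 2 + e * nm z ^+ 2 < nm (f w) ^+ 2 + e * nm w ^+ 2.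
Proof.
move=> [g hg [k hk ck]] e0 d0; apply: contrapT => nex.
have le w : nm (w - z) < d ->
    nm (f w) ^+ 2 + e * nm w ^+ 2 <= nm (f z) ^+ 2 + e * nm z ^+ 2.
  by move=> hw; rewrite leNgt; apply/negP => hlt; apply: nex; exists w.
pose A := nm (f z); have A0 : 0 <= A := nm_ge0 _.
(* With this tolerance the remainders cost at most [2 e h^2] in the sum over the four points,
   against a gain of [4 e h^2] from the term [e |.|^2]. *)
have et0 : 0 < e / (8 * (A + 1)) by apply: divr_gt0 => //; lra.
have [r r0 hr] := nr_and (nr_and hg hk) (ck _ et0).
pose h := Num.min d r / 2.
have h0 : 0 < h by rewrite /h divr_gt0 // lt_min d0.
have hd : h < d.
  have : Num.min d r <= d by rewrite ge_min lexx.
  by rewrite /h; lra.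
have hr' : h < r.
  have : Num.min d r <= r by rewrite ge_min lexx orbT.
  by rewrite /h; lra.
have main v : nm v = h -> 
    2 * (dotc (f z) (v * g z) + dotc (f z) (v ^+ 2 * k (z + v)))
      + e * (nm (z + v) ^+ 2 - nm z ^+ 2) <= 0
    /\ nm (k (z + v) - k z) < e / (8 * (A + 1)).
  move=> hv; have E : z + v - z = v by ring.
  have [] := hr (z + v); first by rewrite E hv.
  move=> [e1 e2] e3; split => //.
  have := le (z + v); rewrite E hv => /(_ hd).
  have -> : f (z + v) = f z + (v * g z + v ^+ 2 * k (z + v)) by rewrite e1 e2 E; ring.
  have := nmD_ge (f z) (v * g z + v ^+ 2 * k (z + v)).
  by rewrite dotcD; lra.
pose v1 : R[i] := Complex h 0; pose v2 : R[i] := Complex 0 h.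
pose v3 : R[i] := Complex (- h) 0; pose v4 : R[i] := Complex 0 (- h).
have n1 : nm v1 = h by rewrite nm_real gtr0_norm.
have n2 : nm v2 = h by rewrite /nm /= expr0n add0r sqrtr_sqr gtr0_norm.
have n3 : nm v3 = h by rewrite (nm_real (- h)) normrN gtr0_norm.
have n4 : nm v4 = h by rewrite /nm /= expr0n add0r sqrtr_sqr normrN gtr0_norm.
have [m1 k1] := main v1 n1; have [m2 k2] := main v2 n2.
have [m3 k3] := main v3 n3; have [m4 k4] := main v4 n4.
(* The squares [v^2] alternate between [h^2] and [- h^2], so the value [k z] cancels and only these
   differences remain. *)
pose K := (k (z + v1) - k z) + (- (k (z + v2) - k z) +
   ((k (z + v3) - k z) + - (k (z + v4) - k z))).
have nK : nm K <= 4 * (e / (8 * (A + 1))).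
  apply: le_trans (nmD _ _) _; apply: le_trans (lerD (lexx _) (nmD _ _)) _.
  apply: le_trans (lerD (lexx _) (lerD (lexx _) (nmD _ _))) _.
  rewrite !nmN; lra.
have s1 : dotc (f z) (v1 * g z) + dotc (f z) (v2 * g z) + dotc (f z) (v3 * g z)
   + dotc (f z) (v4 * g z) = 0.
  rewrite -!dotcD -!mulrDl (_ : v1 + v2 + v3 + v4 = 0).
    by rewrite mul0r /dotc /= !mulr0 addr0.
  by apply/eqP; rewrite eq_complex /=; apply/andP; split; apply/eqP; ring.
have sq v : v \in [:: v1; v3] -> v ^+ 2 = (h ^+ 2)%:C%C.
  rewrite !inE => /orP[] /eqP ->; apply/eqP; rewrite eq_complex /=;
  by apply/andP; split; apply/eqP; ring.
have sq' v : v \in [:: v2; v4] -> v ^+ 2 = - (h ^+ 2)%:C%C.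
  rewrite !inE => /orP[] /eqP ->; apply/eqP; rewrite eq_complex /=;
  by apply/andP; split; apply/eqP; ring.
have s2 : dotc (f z) (v1 ^+ 2 * k (z + v1)) + dotc (f z) (v2 ^+ 2 * k (z + v2))
  + dotc (f z) (v3 ^+ 2 * k (z + v3)) + dotc (f z) (v4 ^+ 2 * k (z + v4))
  = dotc (f z) ((h ^+ 2)%:C%C * K).
  rewrite -!dotcD (sq v1) ?(sq v3) ?(sq' v2) ?(sq' v4) ?inE ?eqxx ?orbT //.
  by apply: congr1; rewrite /K; ring.
have s3 : nm (z + v1) ^+ 2 + nm (z + v2) ^+ 2 + nm (z + v3) ^+ 2 + nm (z + v4) ^+ 2
  = 4 * nm z ^+ 2 + 4 * h ^+ 2.
  rewrite !nm_sqr; case: (z) => a b /=; ring.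
have lo := dotc_ge (f z) ((h ^+ 2)%:C%C * K).
rewrite nmM nm_real ger0_norm ?sqr_ge0 // -/A in lo.
have : A * (h ^+ 2 * nm K) <= h ^+ 2 * (e / 2).
  rewrite mulrCA; apply: ler_wpM2l; first exact: sqr_ge0.
  apply: le_trans (ler_wpM2l A0 nK) _.
  rewrite [leLHS](_ : _ = (A / (A + 1)) * (e / 2)); last by field; lra.
  apply: ler_piMl; first lra.
  by rewrite ler_pdivrMr; lra.
have : 0 < h ^+ 2 * e by rewrite mulr_gt0 ?exprn_gt0.
nra.
Qed.

(** The perturbed function [|f|^2 + e |.|^2] has no interior maximum, and [e] tends to 0. Expansions
    are required only off the zeros of [f], since a maximum at a zero is harmless; this admits
    quotients that are merely continuous at the origin. *)
Lemma max_principle f (r M : R) : 0 < r -> 0 <= M ->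
  (forall z, nm z <= r -> cont f z) ->
  (forall z, nm z < r -> f z != 0 -> taylor 2 f z) ->
  (forall z, nm z = r -> nm (f z) <= M) ->
  forall z, nm z <= r -> nm (f z) <= M.
Proof.
move=> r0 M0 cf tf hM.
have key e : 0 < e -> forall z, nm z <= r -> nm (f z) ^+ 2 <= M ^+ 2 + e * r ^+ 2.
  move=> e0.
  have [||||x xr xmax] := @compact_max (fun z => nm z <= r)
     (fun z => nm (f z) ^+ 2 + e * nm z ^+ 2) r 0.
  - by rewrite nm0 ltW.
  - by [].
  - move=> x /negP; rewrite -ltNge => hx.
    have := nm_cont (cont_id x) (_ : 0 < nm x - r); rewrite subr_gt0 => /(_ hx).
    apply: nr_imp => w; rewrite ltr_norml => /andP[h _]; apply/negP.
    by rewrite -ltNge; rewrite /= in h; lra.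
  - move=> x xr d d0.
    have cg : cont (fun w => (nm (f w))%:C%C * (nm (f w))%:C%C
       + e%:C%C * ((nm w)%:C%C * (nm w)%:C%C)) x.
      have c1 : cont (fun w => (nm (f w))%:C%C) x.
        move=> t t0; apply: nr_imp (nm_cont (cf x xr) t0) => w.
        by rewrite -rmorphB nm_real.
      have c2 : cont (fun w => (nm w)%:C%C) x.
        move=> t t0; apply: nr_imp (nm_cont (cont_id x) t0) => w.
        by rewrite -rmorphB nm_real.
      apply: contD; first exact: contM.
      by apply: contM; [exact: cont_cst|exact: contM].
    apply: nr_imp (cg d d0) => w.
    by rewrite -!rmorphM -!rmorphD -rmorphB nm_real -!expr2.
  move=> z zr; have := xmax z zr.
  have z2 : 0 <= e * nm z ^+ 2 by rewrite mulr_ge0 ?sqr_ge0 // ltW.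
  have x2 : e * nm x ^+ 2 <= e * r ^+ 2.
    by rewrite ler_pM2l // ler_sqr ?nnegrE ?nm_ge0 // ltW.
  suff : nm (f x) ^+ 2 <= M ^+ 2 by lra.
  rewrite ler_sqr ?nnegrE ?nm_ge0 //.
  have [xr'|xr'] := eqVneq (nm x) r; first exact: hM.
  have {}xr' : nm x < r by rewrite lt_neqAle xr'.
  have [->|fx] := eqVneq (f x) 0; first by rewrite nm0.
  have [|w hw lt] := no_local_max (tf x xr' fx) e0 (_ : 0 < r - nm x).
    by rewrite subr_gt0.
  have := xmax w; have := nm_subl w x => h1 h2.
  have := h2 (_ : nm w <= r); have -> : nm w <= r by lra.
  by move=> /(_ isT); lra.
move=> z zr; rewrite -ler_sqr ?nnegrE ?nm_ge0 //.
rewrite leNgt; apply/negP => lt.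
have r2 : 0 < r ^+ 2 by rewrite exprn_gt0.
(* This value of [e] makes [e r^2] half of the excess [|f z|^2 - M^2]. *)
have := key ((nm (f z) ^+ 2 - M ^+ 2) / (2 * r ^+ 2)) _ z zr.
rewrite divr_gt0 ?subr_gt0 ?mulr_gt0 // => /(_ isT).
rewrite [X in _ + X](_ : _ = (nm (f z) ^+ 2 - M ^+ 2) / 2); last by field; lra.
lra.
Qed.

(** Without a zero, [1 / f] would violate the maximum principle at the centre. *)
Lemma min_modulus f z0 (r m : R) : 0 < r ->
  (forall z, nm (z - z0) <= r -> taylor 2 f z) ->
  (forall z, nm (z - z0) = r -> m <= nm (f z)) -> nm (f z0) < m ->
  exists2 z, nm (z - z0) <= r & f z = 0.
Proof.
move=> r0 tf hm lt; apply: contrapT => nex.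
have m0 : 0 < m by apply: le_lt_trans lt; exact: nm_ge0.
have f0 z : nm z <= r -> f (z0 + z) != 0.
  by move=> zr; apply/eqP => fz; apply: nex; exists (z0 + z) => //; rewrite addrC addKr.
have E z : z0 + z - z0 = z by ring.
have tg z : nm z <= r -> taylor 2 (fun w => (f (z0 + w))^-1) z.
  move=> zr; apply: taylorV; first exact: f0.
  apply: taylor_comp; last by apply: tf; rewrite E.
  by apply: taylorD; [exact: taylor_cst|exact: taylor_id].
have := @max_principle (fun w => (f (z0 + w))^-1) r m^-1 r0 _ _ _ _ 0.
rewrite invr_ge0 (ltW m0) nm0 (ltW r0) addr0 nmV => /(_ isT) h.
have {h}: (nm (f z0))^-1 <= m^-1.
  apply: h => //.
  - by move=> z zr; exact: taylor_cont (tg z zr).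
  - by move=> z zr _; apply: tg; exact: ltW.
  - move=> z zr; rewrite nmV lef_pV2 ?posrE ?nm_gt0 ?f0 ?zr //.
    by apply: hm; rewrite E.
have := f0 0; rewrite nm0 addr0 => /(_ (ltW r0)) h.
by rewrite lef_pV2 ?posrE ?nm_gt0 //; lra.
Qed.

(* The maximum principle applied to [f^(n+2) / z^(n+1)], which is continuous at [0],
   for large [n]. *)
Lemma schwarz_der f (M : R) d :
  (forall z, nm z <= 1 -> taylor 2 f z) -> f 0 = 0 ->
  (forall z, nm z <= 1 -> nm (f z) <= M) -> hasder f 0 d -> nm d <= M.
Proof.
move=> tf f0 hM [g [hg cg <-]].
have M0 : 0 <= M by apply: le_trans (hM 0 _); rewrite ?nm0 // nm_ge0.
rewrite leNgt; apply/negP => lt.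
have bd n z : nm z <= 1 -> z != 0 -> nm (f z) ^+ n.+2 <= M ^+ n.+2 * nm z ^+ n.+1.
  move=> z1 z0.
  have : nm (f z ^+ n.+2 / z ^+ n.+1) <= M ^+ n.+2.
    have tF w : nm w <= 1 -> w != 0 -> taylor 2 (fun w => f w ^+ n.+2 / w ^+ n.+1) w.
      move=> w1 w0.
      have tX m (h : R[i] -> R[i]) : taylor 2 h w -> taylor 2 (fun w => h w ^+ m) w.
        move=> th; elim: m => [|m IH].
          by apply: taylor_near (taylor_cst 2 1 w); apply: nr_all => u; rewrite expr0.
        apply: taylor_near (taylorM th IH); by apply: nr_all => u; rewrite exprS.
      apply: taylorM; first by apply: tX; exact: tf.
      apply: taylorV; first by rewrite expf_neq0.
      by apply: tX; exact: taylor_id.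
    apply: (@max_principle (fun w => f w ^+ n.+2 / w ^+ n.+1) 1) => //.
    - exact: exprn_ge0.
    - move=> w w1; have [->|w0] := eqVneq w 0; last exact: taylor_cont (tF w w1 w0).
      apply: (@cont_near _ (fun w => w * g w ^+ n.+2)).
        apply: nr_imp hg => u ->; rewrite f0 subr0 add0r.
        have [->|u0] := eqVneq u 0; first by rewrite !mul0r expr0n mul0r.
        rewrite exprMn (exprS u n.+1); move: (u ^+ n.+1) (expf_neq0 n.+1 u0) => p p0.
        by rewrite mulrAC mulfK.
      apply: contM; first exact: cont_id.
      elim: (n.+2) => [|m IH].
        by apply: cont_near (cont_cst 1 0); apply: nr_all => u; rewrite expr0.
      by apply: cont_near (contM cg IH); apply: nr_all => u; rewrite exprS.
    - move=> w w1 fw; apply: tF; first exact: ltW.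
      by apply: contraNneq fw => ->; rewrite f0 expr0n mul0r.
    - move=> w w1; rewrite nm_div !nmX w1 expr1n divr1.
      by apply: lerXn2r; rewrite ?nnegrE ?nm_ge0 //; apply: hM; rewrite w1.
  by rewrite nm_div !nmX ler_pdivrMr // exprn_gt0 // nm_gt0.
have e0 : 0 < (nm (g 0) - M) / 2 by lra.
have [r r0 hr] := nr_and hg (nm_cont cg e0).
pose t : R := Num.min 1 (r / 2).
have t0 : 0 < t by rewrite lt_min ltr01 divr_gt0.
have t1 : t <= 1 by rewrite ge_min lexx.
have tr : t < r.
  have : t <= r / 2 by rewrite ge_min lexx orbT.
  lra.
have nt : nm t%:C%C = t by rewrite nm_real gtr0_norm.
have tn0 : t%:C%C != 0 by rewrite -nm_gt0 nt.
have [] := hr t%:C%C; first by rewrite subr0 nt.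
rewrite f0 add0r subr0 => ft; rewrite ltr_norml => /andP[gt _].
(* [c] lies strictly between [M] and the modulus of the derivative; [|f t| >= c t] at one small [t]
   contradicts [bd] for large [n]. *)
pose c := (nm (g 0) + M) / 2.
have hc : c * t <= nm (f t%:C%C).
  by rewrite ft nmM nt mulrC ler_pM2l // /c; lra.
have c0 : 0 < c by rewrite /c; have := nm_ge0 (g 0); lra.
have Mc : M < c by rewrite /c; lra.
(* The general argument divides by [M]; for [M = 0] the case [n = 0] of [bd] already gives
   [f t = 0]. *)
have [M00|M00] := eqVneq M 0.
  have := bd 0%N t%:C%C; rewrite nt => /(_ t1 tn0); rewrite M00 expr0n mul0r => h.
  have : (c * t) ^+ 2 <= nm (f t%:C%C) ^+ 2.
    by apply: lerXn2r; rewrite ?nnegrE ?nm_ge0 // mulr_ge0 ?ltW.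
  have : 0 < (c * t) ^+ 2 by apply: exprn_gt0; exact: mulr_gt0.
  lra.
have Mp : 0 < M by rewrite lt_def M00.
have cM : 1 < c / M by rewrite ltr_pdivlMr ?mul1r.
have [n hn] := pow_unbounded t^-1 cM.
have := bd n t%:C%C; rewrite nt => /(_ t1 tn0) h.
have h2 : (c * t) ^+ n.+2 <= M ^+ n.+2 * t ^+ n.+1.
  apply: le_trans h; apply: lerXn2r; rewrite ?nnegrE ?nm_ge0 //.
  by rewrite mulr_ge0 ?ltW.
move: h2; rewrite exprMn (exprSr t n.+1) mulrA mulrAC ler_pM2r ?exprn_gt0 //.
rewrite -ler_pdivlMr // -ler_pdivrMl ?exprn_gt0 // => h2.
have : (c / M) ^+ n.+2 <= t^-1.
  by rewrite expr_div_n mulrC.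
have : (c / M) ^+ n <= (c / M) ^+ n.+2.
  apply: ler_weXn2l; last by rewrite ltnW.
  by rewrite ler_pdivlMr ?mul1r // ltW.
lra.
Qed.

End MaximumPrinciple.

(** * Analytic square roots on the unit disc *)

Section SquareRoot.
Variable R : realType.
Implicit Types (x y z w : R[i]).

(* The square root of [x] with positive real part when [0 < Re x]. *)
Definition psqrt x : R[i] := let r := sqrtc x in if 0 < complex.Re r then r else - r.

Lemma psqrtK x : psqrt x ^+ 2 = x.
Proof. by rewrite /psqrt; case: ifP => _; rewrite ?sqrrN sqr_sqrtc. Qed.

Lemma Re_psqrt x : 0 < complex.Re x -> 0 < complex.Re (psqrt x).
Proof.
move=> hx; rewrite /psqrt; case: ifPn => //; rewrite -leNgt => hr.
have := sqr_sqrtc x; case: (sqrtc x) hr => a b /= ha e.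
have {e} : complex.Re x = a * a - b * b by rewrite -e.
rewrite oppr_gt0 lt_neqAle ha andbT => e.
apply/eqP => a0; move: e; rewrite a0 mul0r sub0r => e.
by have := sqr_ge0 b; rewrite expr2; lra.
Qed.

Lemma psqrt1 : psqrt 1 = 1.
Proof.
have := psqrtK 1 => /eqP; rewrite sqrf_eq1 => /orP[/eqP //|/eqP h].
have h1 : 0 < complex.Re (1 : R[i]) by exact: ltr01.
have e : complex.Re (-1 : R[i]) = -1 by [].
by have := Re_psqrt h1; rewrite h e oppr_gt0 ltr10.
Qed.

(** [w - x] is the product of the difference and the sum of the two roots, and the sum has real part
    larger than that of [psqrt x]. *)
Lemma psqrt_cont x : 0 < complex.Re x -> cont psqrt x.
Proof.
move=> hx e e0; have hr := Re_psqrt hx.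
exists (Num.min (complex.Re x) (e * complex.Re (psqrt x))).
  by rewrite lt_min hx mulr_gt0.
move=> w; rewrite lt_min => /andP[h1 h2].
have hw : 0 < complex.Re w.
  have := Re_le_nm (w - x); case: (w) h1 => a b; case: (x) => c d /= h1.
  by rewrite ler_norml => /andP[]; lra.
have hs := Re_psqrt hw.
have h : nm (w - x) = nm (psqrt w - psqrt x) * nm (psqrt w + psqrt x).
  by rewrite -nmM -subr_sqr !psqrtK.
have h3 : complex.Re (psqrt x) < nm (psqrt w + psqrt x).
  apply: lt_le_trans (Re_le_nm _); apply: lt_le_trans (ler_norm _).
  by case: (psqrt w) (psqrt x) hs => a b [c d] /=; lra.
have h4 := lt_trans hr h3.
rewrite -(ltr_pM2r h4) -h; apply: lt_le_trans h2 _.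
by rewrite ler_pM2l // ltW.
Qed.

(* On the closed unit disc [f ((k+1)z/N) / f (kz/N)] is within distance [1] of [1]
   for [N] large, so it has a square root given by the principal branch; the square
   root of [f] is the product of these. *)
Lemma sqrt_lift n f y :
  (forall z, nm z <= 1 -> taylor n f z) -> (forall z, nm z <= 1 -> f z != 0) ->
  y ^+ 2 = f 0 ->
  exists s, [/\ forall z, nm z <= 1 -> taylor n s z, s 0 = y &
    forall z, nm z <= 1 -> nr z (fun w => s w ^+ 2 = f w)].
Proof.
move=> tf f0 yf.
have [N hN] : exists N, forall m z, (N <= m)%N -> nm z <= 1 -> forall w,
    nm (w - z) <= m.+1%:R^-1 -> nm (f w - f z) < nm (f z).
  apply: (@disc_cover R 1 (fun m z => forall w, nm (w - z) <= m.+1%:R^-1 ->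
    nm (f w - f z) < nm (f z))) => x x1.
  have e0 : 0 < nm (f x) / 4 by rewrite divr_gt0 // nm_gt0 f0.
  have [d d0 hd] := taylor_cont (tf x x1) e0.
  have d2 : 0 < d / 2 by lra.
  exists (d / 2) => //; have [N hN] := small_inv d2; exists N => m z /hN hm hz w hw.
  have h1 : nm (f w - f x) < nm (f x) / 4.
    by apply: hd; have := le_lt_trans hw hm; have := nm_tri z w x; lra.
  have h2 : nm (f z - f x) < nm (f x) / 4 by apply: hd; lra.
  have h3 := nm_tri (f x) (f w) (f z); rewrite [nm (f x - f z)]nm_sym in h3.
  by have := nm_subl (f x) (f z); rewrite [nm (f x - f z)]nm_sym; lra.
pose t k : R[i] := (k%:R / N.+1%:R : R)%:C%C.
have tS k : nm (t k.+1 - t k) = N.+1%:R^-1.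
  by rewrite /t -rmorphB nm_real -mulrBl -natr1 [k%:R + 1]addrC addrK mul1r ger0_norm.
have t1 k z : (k <= N.+1)%N -> nm z <= 1 -> nm (t k * z) <= 1.
  move=> hk z1; rewrite nmM nm_real ger0_norm ?divr_ge0 //.
  apply: mulr_ile1 => //; rewrite ?divr_ge0 ?nm_ge0 //.
  by rewrite ler_pdivrMr ?ltr0n // mul1r ler_nat.
pose rho k z := f (t k.+1 * z) / f (t k * z).
have tt k z : (k <= N.+1)%N -> nm z <= 1 -> taylor n (fun w => f (t k * w)) z.
  move=> hk z1; apply: (@taylor_comp _ n f (fun w => t k * w)).
    by apply: taylorM; [exact: taylor_cst|exact: taylor_id].
  by apply: tf; exact: t1.
have rho_taylor k z : (k < N.+1)%N -> nm z <= 1 -> taylor n (rho k) z.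
  move=> hk z1; apply: taylorM; first exact: tt.
  apply: taylorV; first by apply: f0; apply: t1 => //; exact: ltnW.
  by apply: tt => //; exact: ltnW.
have rho_Re k z : (k < N.+1)%N -> nm z <= 1 -> 0 < complex.Re (rho k z).
  move=> hk z1.
  have fk : f (t k * z) != 0 by apply: f0; apply: t1 => //; exact: ltnW.
  have : nm (rho k z - 1) < 1.
    have -> : rho k z - 1 = (f (t k.+1 * z) - f (t k * z)) / f (t k * z).
      by rewrite /rho; field.
    rewrite nm_div ltr_pdivrMr ?nm_gt0 // mul1r.
    apply: (hN N) => //; first by apply: t1 => //; exact: ltnW.
    rewrite -mulrBl nmM tS; apply: ler_piMr => //.
  move=> h; have := le_lt_trans (Re_le_nm _) h.
  by case: (rho k z) => a b /=; rewrite ltr_norml => /andP[]; lra.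
pose s z := y * \prod_(0 <= k < N.+1) psqrt (rho k z).
(* The product telescopes. The hypothesis is nonvanishing at the division points instead of
   [|z| <= 1], because the identity is needed on full neighbourhoods of boundary points. *)
have s_sq z : (forall k, k \in iota 0 N.+2 -> f (t k * z) != 0) -> s z ^+ 2 = f z.
  move=> hz; rewrite /s exprMn yf -prodrXl.
  under eq_bigr do rewrite psqrtK.
  have tel M : (M <= N.+1)%N -> f 0 * \prod_(0 <= k < M) rho k z = f (t M * z).
    elim: M => [|M IH] hM.
      by rewrite big_geq // mulr1 /t mul0r mul0r.
    rewrite big_nat_recr //= mulrA IH ?(ltnW hM) // /rho mulrCA mulfV ?mulr1 //.
    by apply: hz; rewrite mem_iota /= add0n ltnS ltnW.
  by rewrite tel // /t mulfV ?mul1r // pnatr_eq0.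
have s_near z : nm z <= 1 -> nr z (fun w => s w ^+ 2 = f w).
  move=> z1; have := @nr_seq _ _ (iota 0 N.+2) z (fun k w => f (t k * w) != 0).
  move=> /(_ _) h; apply: nr_imp (h _) => [w|k]; first exact: s_sq.
  rewrite mem_iota /= add0n ltnS => hk.
  by apply: (cont_neq0 (taylor_cont (tt k z hk z1))); apply: f0; exact: t1.
exists s; split => //.
  move=> z z1; apply: taylorM; first exact: taylor_cst.
  have tp k : (k < N.+1)%N -> taylor n (fun w => psqrt (rho k w)) z.
    move=> hk; apply: (@taylor_sqrt _ n (rho k)).
    - apply: cont_comp; first exact: taylor_cont (rho_taylor k z hk z1).
      by apply: psqrt_cont; exact: rho_Re.
    - by apply: nr_all => w; rewrite psqrtK.
    - by apply/eqP => h; have := rho_Re k z hk z1; rewrite h ltxx.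
    - exact: rho_taylor.
  elim: {-2}(N.+1) (leqnn N.+1) => [|M IH] hM.
    by apply: taylor_near (taylor_cst n 1 z); apply: nr_all => w; rewrite big_geq.
  apply: taylor_near (taylorM (IH (ltnW hM)) (tp M hM)).
  by apply: nr_all => w; rewrite big_nat_recr.
rewrite /s big1_seq ?mulr1 // => k _.
by rewrite /rho !mulr0 mulfV ?psqrt1 // f0 // nm0.
Qed.

End SquareRoot.

(** * Expansion: pulling discs back by branches of the inverse *)

Section Expansion.
Variable R : realType.
Implicit Types (x y z w : R[i]).
Variables (a : R[i]) (P : seq R[i]).
Let R0 : R := nm a + 2.
Hypothesis aP : a \in P.
Hypothesis Pinv : forall e z, e ^+ 2 = 1 -> z \in P -> nm (e * z ^+ 2 + a) <= R0 ->
  e * z ^+ 2 + a \in P.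

(** Every factor is at least 1, so [A] bounds all partial products of distances [|w - q|] with
    [|w| <= R0]. The normalisation of [tau] then keeps the correction in [pull_back], where
    [|w - y| <= 2 R0], at most [1 / 2]. *)
Let A : R := \prod_(q <- P) (R0 + nm q + 1).
Let tau : R := (4 * (R0 + 1) * A)^-1.

Definition apart y : R := \prod_(q <- P | q != y) nm (y - q).

(** Derivative at its fixed point [y] of the polynomial that corrects lifts centred at [y]: the gain
    of one pull-back. *)
Definition growth y : R := 1 + tau * apart y.

Definition disc_map y (phi : R[i] -> R[i]) :=
  [/\ forall z, nm z <= 1 -> taylor 2 phi z, phi 0 = y,
      forall z, nm z <= 1 -> nm (phi z) <= R0 &
      forall z, nm z <= 1 -> phi z \in P -> z = 0].

Lemma R0_ge2 : 2 <= R0. Proof. by have := nm_ge0 a; rewrite /R0; lra. Qed.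

Lemma factor_ge1 q : 1 <= R0 + nm q + 1.
Proof. by have := nm_ge0 q; have := R0_ge2; lra. Qed.

Lemma prod_factor_ge1 (s : seq R[i]) : 1 <= \prod_(q <- s) (R0 + nm q + 1).
Proof.
elim: s => [|q s IH]; rewrite ?big_nil // big_cons.
by rewrite mulr_ege1 // factor_ge1.
Qed.

Lemma prod_le_factor (s : seq R[i]) (Q : pred R[i]) w : nm w <= R0 ->
  \prod_(q <- s | Q q) nm (w - q) <= \prod_(q <- s) (R0 + nm q + 1).
Proof.
move=> hw; elim: s => [|q s IH]; rewrite ?big_nil // !big_cons.
have p0 : 0 <= \prod_(j <- s | Q j) nm (w - j).
  by apply: prodr_ge0 => r _; exact: nm_ge0.
have f1 := factor_ge1 q; case: ifP => _.
  by apply: ler_pM => //; [exact: nm_ge0|have := nmB w q; lra].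
by apply: le_trans IH _; apply: ler_peMl => //; have := prod_factor_ge1 s; lra.
Qed.

Lemma A_gt0 : 0 < A.
Proof.
by apply: prodr_gt0 => q _; have := nm_ge0 q; have := R0_ge2; lra.
Qed.

Lemma tau_gt0 : 0 < tau.
Proof.
rewrite invr_gt0 !mulr_gt0 //; last exact: A_gt0.
by have := R0_ge2; lra.
Qed.

Lemma apart_ge0 y : 0 <= apart y.
Proof. by apply: prodr_ge0 => q _; exact: nm_ge0. Qed.

Lemma apart_gt0 y : 0 < apart y.
Proof. by apply: prodr_gt0 => q qy; rewrite nm_gt0 subr_eq0 eq_sym. Qed.

Lemma growth_ge1 y : 1 <= growth y.
Proof. by rewrite /growth lerDl mulr_ge0 ?apart_ge0 // ltW // tau_gt0. Qed.

Lemma growth_gt1 y : 1 < growth y.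
Proof. by rewrite /growth ltrDl mulr_gt0 ?apart_gt0 // tau_gt0. Qed.

Lemma tau_small (u p : R) : 0 <= u <= 2 * R0 -> 0 <= p <= A -> tau * (u * p) <= 1 / 2.
Proof.
move=> /andP[u0 u1] /andP[p0 p1]; have r2 := R0_ge2; have A0 := A_gt0.
rewrite /tau ler_pdivrMl ?mulr_gt0 //; last lra.
apply: le_trans (ler_pM u0 p0 u1 p1) _.
by have := mulr_gt0 A0 (_ : 0 < R0 + 1); nra.
Qed.

(* Pulling a disc back by a branch of the inverse lands in a smaller disc, which
   leaves room to compose with a polynomial close to the identity that fixes [P]
   and the centre and has derivative [> 1] at the centre. *)
Lemma pull_back e y phi d : e ^+ 2 = 1 -> disc_map (e * y ^+ 2 + a) phi ->
  e * y ^+ 2 + a != a -> hasder phi 0 d ->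
  exists phi' d', [/\ disc_map y phi', hasder phi' 0 d' &
    nm d' = nm d * (growth y / (2 * nm y))].
Proof.
move=> e2 [tphi phi0 bphi Pphi] ya hd.
have ee : e * e = 1 by rewrite -expr2.
have e1 : nm e = 1.
  have := nmX e 2; rewrite e2 nm1 => /esym/eqP.
  by rewrite sqrf_eq1 => /orP[] /eqP //; have := nm_ge0 e; lra.
have y0 : y != 0 by apply: contraNneq ya => ->; rewrite expr0n mulr0 add0r.
have [|||s [ts s0 sq]] := @sqrt_lift R 2 (fun z => e * (phi z - a)) y.
- move=> z z1; apply: taylorM; first exact: taylor_cst.
  by apply: taylorD; [exact: tphi|exact: taylor_cst].
(* The critical value [a] belongs to [P], so [phi] could take it only at the centre, where its value
   is not [a]. *)
- move=> z z1; apply/eqP => h; move: ya; rewrite -phi0.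
  have h2 : phi z = a.
    apply/eqP; rewrite -subr_eq0; apply/eqP.
    by rewrite -[LHS]mul1r -ee -mulrA h mulr0.
  have z0 : z = 0 by apply: Pphi => //; rewrite h2.
  by rewrite -h2 z0 eqxx.
- by rewrite phi0; transitivity (e * e * y ^+ 2); [rewrite ee mul1r|ring].
have phis z : nm z <= 1 -> phi z = e * s z ^+ 2 + a.
  by move=> z1; rewrite (nr_self (sq z z1)) mulrA ee; ring.
(* From [|s|^2 <= 2 |a| + 2]; the remaining [1 / 2] is the room that [E] may use. *)
have sb z : nm z <= 1 -> nm (s z) <= nm a + 3 / 2.
  move=> z1; rewrite -ler_sqr ?nnegrE ?nm_ge0 //; last by have := nm_ge0 a; lra.
  rewrite -nmX (nr_self (sq z z1)) nmM e1 mul1r.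
  apply: le_trans (nmB _ _) _; have := bphi z z1; rewrite /R0.
  by have := nm_ge0 a; nra.
have sR z : nm z <= 1 -> nm (s z) <= R0 by move=> /sb; rewrite /R0; lra.
have sP z : nm z <= 1 -> s z \in P -> z = 0.
  move=> z1 h; apply: Pphi => //; rewrite phis //; apply: Pinv => //.
  by rewrite -phis //; exact: bphi.
pose Pi w := \prod_(q <- P | q != y) (w - q).
have Piy : nm (Pi y) = apart y by rewrite /Pi nm_prod.
have Piy0 : Pi y != 0 by rewrite -nm_gt0 Piy apart_gt0.
(* The argument of [k] makes the derivative of [E] at [y] the real number [growth y]; its modulus is
   [tau]. *)
pose k : R[i] := (tau * nm (Pi y))%:C%C / Pi y.
have nk : nm k = tau.
  rewrite nm_div nm_real ger0_norm; last by rewrite mulr_ge0 ?nm_ge0 // ltW // tau_gt0.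
  by rewrite mulfK // gt_eqF // nm_gt0.
have yR : nm y <= R0 by rewrite -s0; apply: sR; rewrite nm0.
pose E w := w + k * ((w - y) * Pi w).
have tPi n w : taylor n Pi w.
  apply: taylor_prod => q; apply: taylorD; [exact: taylor_id|exact: taylor_cst].
have tE n w : taylor n E w.
  apply: taylorD; first exact: taylor_id.
  apply: taylorM; first exact: taylor_cst.
  by apply: taylorM => //; apply: taylorD; [exact: taylor_id|exact: taylor_cst].
have wy w : nm w <= R0 -> 0 <= nm (w - y) <= 2 * R0.
  by move=> hw; rewrite nm_ge0 /=; have := nmB w y; lra.
have not_m1 u : nm u <= 1 / 2 -> 1 + u != 0.
  move=> hu; rewrite -nm_gt0; have := nm_subl 1 (- u); rewrite nm1 nmN opprK; lra.
(* For [q] equal to [y] or in [P] the correction is divisible by [w - q], so when [E w = q] the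
   difference [E w - q] is [w - q] times a factor within [1 / 2] of 1. *)
have EP w : nm w <= R0 -> E w \in P -> w = E w.
  move=> hw; set q := E w => qP; have [qy|qy] := eqVneq q y.
    have : (w - y) * (1 + k * Pi w) = 0.
      have : E w - y = 0 by rewrite -/q qy subrr.
      by move=> h; rewrite -[RHS]h /E; ring.
    move/eqP; rewrite mulf_eq0 subr_eq0 => /orP[/eqP wy'|/eqP h]; first by rewrite wy' qy.
    have : 1 + k * Pi w != 0.
      apply: not_m1; rewrite nmM nk nm_prod -[X in _ * X]mul1r.
      apply: tau_small; first by have := R0_ge2; lra.
      by rewrite prod_le_factor // andbT; apply: prodr_ge0 => r _; exact: nm_ge0.
    by rewrite h eqxx.
  have [P2 hP2] : exists Q : pred R[i], Pi w = (w - q) * \prod_(r <- rem q P | Q r) (w - r).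
    exists (fun r => r != y); rewrite /Pi (perm_big _ (perm_to_rem qP)) /=.
    by rewrite big_cons qy.
  have : (w - q) * (1 + k * ((w - y) * \prod_(r <- rem q P | P2 r) (w - r))) = 0.
    have : E w - q = 0 by rewrite subrr.
    by move=> h; rewrite -[RHS]h /E hP2; ring.
  move/eqP; rewrite mulf_eq0 subr_eq0 => /orP[/eqP ->//|/eqP h].
  have : 1 + k * ((w - y) * \prod_(r <- rem q P | P2 r) (w - r)) != 0.
    apply: not_m1; rewrite nmM nk nmM nm_prod.
    apply: tau_small; first exact: wy.
    apply/andP; split; first by apply: prodr_ge0 => r _; exact: nm_ge0.
    apply: le_trans (prod_le_factor _ _ hw) _.
    rewrite /A [leRHS](perm_big _ (perm_to_rem qP)) /= big_cons.
    apply: ler_peMl; last exact: factor_ge1.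
    by have := prod_factor_ge1 (rem q P); lra.
  by rewrite h eqxx.
have EK w : nm w <= R0 -> nm (E w) <= nm w + 1 / 2.
  move=> hw; apply: le_trans (nmD _ _) _; rewrite lerD2l nmM nk nmM nm_prod.
  apply: tau_small; first exact: wy.
  by rewrite prod_le_factor // andbT; apply: prodr_ge0 => r _; exact: nm_ge0.
have dE : hasder E y (growth y)%:C%C.
  exists (fun w => 1 + k * Pi w); split.
  - by apply: nr_all => w; rewrite /E; ring.
  - apply: (@taylor_cont _ 0); apply: taylorD; first exact: taylor_cst.
    by apply: taylorM => //; exact: taylor_cst.
  - by rewrite /k mulfVK // /growth -Piy rmorphD rmorph1.
have ds : hasder s 0 (e * d / (2 * s 0)).
  have h0 : nm (0 : R[i]) <= 1 by rewrite nm0.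
  apply: (@hasder_sqrt _ (fun z => e * (phi z - a))).
  - exact: taylor_cont (ts 0 h0).
  - exact: sq.
  - by rewrite -(nr_self (sq 0 h0)) s0 expf_neq0.
  - apply: hasder_near (hasder_comp hd (hasder_affine e (- (e * a)) _)).
    by apply: nr_all => w; ring.
exists (fun z => E (s z)), ((growth y)%:C%C * (e * d / (2 * s 0))); split.
- split.
  + by move=> z z1; apply: taylor_comp => //; exact: ts.
  + by rewrite s0 /E; ring.
  + move=> z z1; apply: le_trans (EK _ (sR z z1)) _.
    by have := sb z z1; rewrite /R0; lra.
  + by move=> z z1 h; apply: sP => //; rewrite (EP (s z)) ?sR.
- by apply: hasder_comp => //; rewrite s0.
- rewrite s0 nmM nm_real nm_div nmM e1 mul1r nmM nm_nat ger0_norm.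
    by rewrite mulrCA mulrA.
  by have := growth_ge1 y; lra.
Qed.

(** [N] pull-backs of the disc about [y N] give a disc about [y 0], whose derivative the Schwarz
    lemma bounds. Read the other way, the modulus of the derivative along the orbit, the product of
    the [2 |y i|], is at least [s / (2 R0)] times the product of the [growth (y i)]. *)
Lemma expansion (N : nat) (y e : nat -> R[i]) (s : R) : 0 < s ->
  (forall i, (i < N)%N -> [/\ e i ^+ 2 = 1, y i.+1 = e i * y i ^+ 2 + a & y i.+1 != a]) ->
  (forall w, nm (w - y N) <= s -> nm w <= R0 /\ (w \in P -> w = y N)) ->
  s * \prod_(0 <= i < N) (growth (y i) / (2 * nm (y i))) <= 2 * R0.
Proof.
move=> s0 hy hs.
have key j : (j <= N)%N -> exists phi d, [/\ disc_map (y (N - j)%N) phi, hasder phi 0 d &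
    nm d = s * \prod_(N - j <= i < N) (growth (y i) / (2 * nm (y i)))].
  elim: j => [|j IH] hj.
    rewrite subn0; exists (fun w => y N + s%:C%C * w), s%:C%C; split.
    - split.
      + move=> z _; apply: taylorD; first exact: taylor_cst.
        by apply: taylorM; [exact: taylor_cst|exact: taylor_id].
      + by rewrite mulr0 addr0.
      + move=> z z1; have [] // := hs (y N + s%:C%C * z).
        by rewrite addrC addKr nmM nm_real gtr0_norm //; apply: ler_piMr => //; lra.
      + move=> z z1 h.
        have hb : nm (y N + s%:C%C * z - y N) <= s.
          by rewrite addrC addKr nmM nm_real gtr0_norm //; apply: ler_piMr => //; lra.
        have [_] := hs _ hb; move=> /(_ h) /eqP; rewrite -subr_eq0 addrC addKr mulf_eq0 => /orP[|/eqP//].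
        by rewrite -nm_eq0 nm_real normr_eq0 (gt_eqF s0).
    - exact: hasder_affine.
    - by rewrite big_geq // mulr1 nm_real gtr0_norm.
  have [phi [d [h1 h2 h3]]] := IH (ltnW hj).
  have hN : (N - j.+1 < N)%N by rewrite ltn_subLR // addSn ltnS leq_addl.
  have E : (N - j)%N = (N - j.+1).+1 by rewrite subnSK.
  have [e2 ey ya] := hy _ hN; rewrite E ey in h1; rewrite ey in ya.
  have [phi' [d' [h1' h2' h3']]] := pull_back e2 h1 ya h2.
  exists phi', d'; split => //.
  by rewrite h3' h3 (big_ltn hN) -E -mulrA; congr (_ * _); rewrite mulrC.
have [phi [d [[t1 t2 t3 t4] h2]]] := key N (leqnn _).
rewrite subnn => <-; rewrite subnn in t2.
have hz : nm (y 0%N) <= R0 by rewrite -t2; apply: t3; rewrite nm0.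
apply: (@schwarz_der _ (fun z => phi z - y 0%N)).
- by move=> z z1; apply: taylorD; [exact: t1|exact: taylor_cst].
- by rewrite t2 subrr.
- by move=> z z1; apply: le_trans (nmB _ _) _; have := t3 z z1; lra.
- have := hasder_comp h2 (hasder_affine 1 (- y 0%N) _); rewrite mul1r.
  by apply: hasder_near; apply: nr_all => w; ring.
Qed.

End Expansion.

(** * The topology of the plane in terms of the real modulus *)

Section Topology.
Variable R : realType.

Lemma nbhs_nr (z : Cx R) (A : set (Cx R)) : nbhs z A <-> nr (z : R[i]) A.
Proof.
have E (d : R) (w : Cx R) : ball z d%:C%C w = (nm ((w : R[i]) - z) < d) :> Prop.
  rewrite /ball /= -ltcR.
  have -> : `|z - w| = (nm ((w : R[i]) - z))%:C%C by rewrite nm_sym.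
  by [].
split.
  move/nbhs_ballP => [e /= e0 hA]; exists (complex.Re e).
    by move: e0; rewrite ltcE /= => /andP[].
  move=> w hw; apply: hA.
  (* Radii of balls are complex numbers; a positive one is real. *)
  have -> : e = (complex.Re e)%:C%C.
    by move: e0; rewrite ltcE /= => /andP[/eqP h _]; case: e h hw => u v /= ->.
  by rewrite E.
move=> [d d0 hA]; apply/nbhs_ballP; exists d%:C%C => /=; first by rewrite ltcR.
by move=> w; rewrite E; apply: hA.
Qed.

Lemma closed_nr (A : set (Cx R)) : (forall z : R[i], ~ A z -> nr z (fun w => ~ A w)) -> closed A.
Proof.
move=> h z hz; apply: contrapT => /h /nbhs_nr hn.
by have [w [? ?]] := hz _ hn.
Qed.

Lemma nr_closed (A : set (Cx R)) (z : R[i]) : closed A -> ~ A z -> nr z (fun w => ~ A w).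
Proof.
move=> cA hz; apply/nbhs_nr.
have : open (~` A) by rewrite openC.
by rewrite openE => /(_ z hz).
Qed.

Lemma compact_nm_bounded (D : set (Cx R)) : compact D ->
  exists M : R, forall z : R[i], D z -> nm z <= M.
Proof.
move=> /compact_near_coveringP cov.
have [|N _ hN] := cov nat \oo (fun n (z : Cx R) => nm (z : R[i]) <= n%:R) _.
  move=> x Dx; have := archi_boundP (nm_ge0 (x : R[i])); set N := Num.bound _ => hN.
  exists ([set w : Cx R | nm ((w : R[i]) - x) < 1], [set n | (N.+1 <= n)%N]) => /=.
    by split; [apply/nbhs_nr; exists 1|exists N.+1].
  move=> [w n] /= [h1 h2]; have := nm_subl (w : R[i]) x.
  have : N.+1%:R <= n%:R :> R by rewrite ler_nat.
  by rewrite -natr1; lra.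
by exists N%:R => z Dz; apply: hN => //=; exact: leqnn.
Qed.

Lemma compact_disc (M : R) : exists2 D : set (Cx R), compact D &
  forall z : R[i], nm z <= M -> D z.
Proof.
pose f (p : R * R) : Cx R := Complex p.1 p.2.
exists (f @` (`[- M, M] `*` `[- M, M])); last first.
  move=> [u v] h; exists (u, v) => //; split => /=; rewrite in_itv /= -ler_norml.
    exact: le_trans (Re_le_nm (Complex u v)) h.
  exact: le_trans (Im_le_nm (Complex u v)) h.
apply: continuous_compact; last by apply: compact_setX; exact: segment_compact.
apply: continuous_subspaceT => -[u v] A /nbhs_nr [d d0 hd].
exists ([set w | `|w - u| < d / 2], [set w | `|w - v| < d / 2]) => /=.
  by split; apply/nbhs_ballP; exists (d / 2) => /=; rewrite ?divr_gt0 // => w;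
    rewrite /ball /= distrC.
move=> [w1 w2] /= [h1 h2]; apply: hd.
by apply: le_lt_trans (nm_le_parts _) _ => /=; lra.
Qed.

End Topology.

(** * Orbits as sign sequences, escape, and survival for finitely many steps *)

Section Orbits.
Variable R : realType.
Implicit Types (c x y z w : R[i]) (e : nat -> R[i]).

Fixpoint orb e c z j : R[i] :=
  if j is k.+1 then e k * orb e c z k ^+ 2 + c else z.

Definition signs e := forall j, e j ^+ 2 = 1.

(* The filled Julia set of the correspondence, in terms of sign sequences: an orbit
   is bounded exactly when it never leaves the disc of radius [|c| + 2]. *)
Definition bdd_start c z :=
  exists2 e, signs e & forall j, nm (orb e c z j) <= nm c + 2.

Lemma signE (s : R[i]) : s ^+ 2 = 1 -> s = 1 \/ s = -1.
Proof. by move=> /eqP; rewrite sqrf_eq1 => /orP[] /eqP ->; [left|right]. Qed.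

Lemma nm_sign (s : R[i]) : s ^+ 2 = 1 -> nm s = 1.
Proof. by case/signE => ->; rewrite ?nmN nm1. Qed.

Lemma orbD e c z i j : orb e c z (i + j) = orb (fun k => e (i + k)%N) c (orb e c z i) j.
Proof. by elim: j => [|j IH]; rewrite ?addn0 // addnS /= IH. Qed.

Lemma orb_cons e c z j :
  orb e c z j.+1 = orb (fun k => e k.+1) c (e 0%N * z ^+ 2 + c) j.
Proof. by rewrite -add1n orbD. Qed.

Lemma orb_ext e e' c z j : (forall k, (k < j)%N -> e k = e' k) -> orb e c z j = orb e' c z j.
Proof.
elim: j => [//|j IH] h /=; rewrite IH => [|k hk]; last by apply: h; rewrite ltnW.
by rewrite h.
Qed.

Lemma escape c z s : s ^+ 2 = 1 -> nm c + 2 < nm z -> 2 * nm z <= nm (s * z ^+ 2 + c).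
Proof.
move=> /nm_sign s1 hz; have := nm_subl (s * z ^+ 2) (- c).
by rewrite opprK nmN nmM nmX s1 mul1r; have := nm_ge0 c; nra.
Qed.

Lemma escape_orb e c z j : signs e -> nm c + 2 < nm z -> nm z + j%:R <= nm (orb e c z j).
Proof.
move=> se hz; elim: j => [|j IH]; first by rewrite addr0.
have j0 : 0 <= j%:R :> R by exact: ler0n.
have h : nm c + 2 < nm (orb e c z j) by lra.
have := escape (se j) h; rewrite -natr1 /=; have := nm_ge0 c; lra.
Qed.

(** Any bound improves to the escape radius, beyond which an orbit grows without limit. *)
Lemma orb_bound e c z (M : R) : signs e -> (forall j, nm (orb e c z j) <= M) ->
  forall j, nm (orb e c z j) <= nm c + 2.
Proof.
move=> se hM j; rewrite leNgt; apply/negP => hj.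
have M0 : 0 <= M by apply: le_trans (hM 0%N); exact: nm_ge0.
have := archi_boundP M0; set N := Num.bound _ => hN.
have := hM (j + N)%N; rewrite orbD.
have := @escape_orb (fun k => e (j + k)%N) c _ N (fun k => se _) hj.
have := nm_ge0 (orb e c z j); lra.
Qed.

Lemma bdd_step c z : bdd_start c z <-> exists2 s, s ^+ 2 = 1 & bdd_start c (s * z ^+ 2 + c).
Proof.
split=> [[e se he]|[s s2 [e se he]]].
  exists (e 0%N) => //; exists (fun k => e k.+1) => [k|j]; first exact: se.
  by rewrite -orb_cons.
exists (fun k => if k is l.+1 then e l else s); first by case.
case=> [|j]; last by rewrite orb_cons.
rewrite /= leNgt; apply/negP => hz.
by have := escape s2 hz; have := he 0%N => /=; have := nm_ge0 c; lra.
Qed.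

Lemma bdd_orb e c z j : signs e -> bdd_start c (orb e c z j) -> bdd_start c z.
Proof.
move=> se; elim: j => [//|j IH] h; apply: IH; apply/bdd_step; by exists (e j).
Qed.

(** The next point gives [|z|^2 <= 2 |c| + 2]. The distance [1 / 2] to the escape radius is the room
    for discs about points of the filled Julia set. *)
Lemma bdd_nm c z : bdd_start c z -> nm z <= nm c + 3 / 2.
Proof.
move=> /bdd_step[s s2 [e _ /(_ 0%N) /= h]].
rewrite -ler_sqr ?nnegrE ?nm_ge0 //; last by have := nm_ge0 c; lra.
have := nmB (s * z ^+ 2 + c) c; rewrite addrK nmM nmX (nm_sign s2) mul1r.
by have := nm_ge0 c; nra.
Qed.

(** Boundedness up to depth [N] of the tree of orbits; its failure is an open condition. *)
Fixpoint survive N c z : Prop :=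
  nm z <= nm c + 2 /\
  if N is k.+1 then survive k c (1 * z ^+ 2 + c) \/ survive k c (-1 * z ^+ 2 + c) else True.

Lemma surviveS N c z : survive N.+1 c z -> survive N c z.
Proof.
elim: N z => [|N IH] z; first by case.
by move=> [? [h|h]]; split => //; [left|right]; exact: IH.
Qed.

(* Koenig's lemma for the binary tree of orbits. *)
Lemma bdd_survive c z : bdd_start c z <-> forall N, survive N c z.
Proof.
split=> [h N|h].
  elim: N z h => [|N IH] z hz.
    by split => //; case: hz => e _ /(_ 0%N).
  split; first by case: hz => e _ /(_ 0%N).
  have [s /signE[] -> /IH] := (bdd_step _ _).1 hz; by [left|right].
have mono N M w : (N <= M)%N -> survive M c w -> survive N c w.
  by move=> /subnK <-; elim: (M - N)%N => [//|k IH]; rewrite addSn => /surviveS /IH.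
have next w : (forall N, survive N c w) ->
    exists s : R[i], s ^+ 2 = 1 /\ forall N, survive N c (s * w ^+ 2 + c).
  move=> hw; apply: contrapT => nex.
  have h1 : exists N, ~ survive N c (1 * w ^+ 2 + c).
    apply: contrapT => /forallNP h1; apply: nex; exists 1; split; first by rewrite expr1n.
    by move=> N; apply: contrapT; exact: h1.
  have h2 : exists N, ~ survive N c (-1 * w ^+ 2 + c).
    apply: contrapT => /forallNP h2; apply: nex; exists (-1).
    by split; [rewrite sqrrN expr1n|move=> N; apply: contrapT; exact: h2].
  case: h1 => N1 h1; case: h2 => N2 h2.
  have [_ [g|g]] := hw (maxn N1 N2).+1.
    by apply: h1; apply: mono g; exact: leq_maxl.
  by apply: h2; apply: mono g; exact: leq_maxr.
have [s hs] : {s : R[i] -> R[i] & forall w, (forall N, survive N c w) ->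
    s w ^+ 2 = 1 /\ forall N, survive N c (s w * w ^+ 2 + c)}.
  apply: (@choice _ _ (fun w s => (forall N, survive N c w) ->
    s ^+ 2 = 1 /\ forall N, survive N c (s * w ^+ 2 + c))) => w.
  have [hw|hw] := EM (forall N, survive N c w); last by exists 0 => /hw.
  by have [s hs] := next w hw; exists s.
pose z_ j := iter j (fun w => s w * w ^+ 2 + c) z.
have hz j : forall N, survive N c (z_ j).
  by elim: j => [//|j IH]; have [] := hs _ IH.
exists (fun j => s (z_ j)) => [j|j]; first by have [] := hs _ (hz j).
have -> : orb (fun j => s (z_ j)) c z j = z_ j.
  by elim: j => [//|j IH] /=; rewrite IH.
by case: (hz j 0%N).
Qed.

(** Failure of boundedness is witnessed at a finite depth, by finitely many strict inequalities.
    Openness in both variables jointly gives the closedness of the Multibrot set and the upper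
    semicontinuity of the filled Julia sets. *)
Lemma bdd_open c z : ~ bdd_start c z -> exists2 d : R, 0 < d &
  forall c' z', nm (c' - c) < d -> nm (z' - z) < d -> ~ bdd_start c' z'.
Proof.
move=> h; have [N hN] : exists N, ~ survive N c z.
  by apply: contrapT => /forallNP hn; apply: h; apply/bdd_survive => N; apply: contrapT.
suff [d d0 hd] : exists2 d : R, 0 < d &
    forall c' z', nm (c' - c) < d -> nm (z' - z) < d -> ~ survive N c' z'.
  by exists d => // c' z' h1 h2 /bdd_survive /(_ N); exact: hd.
have big x : ~ (nm x <= nm c + 2) -> exists2 d : R, 0 < d &
    forall c' z', nm (c' - c) < d -> nm (z' - x) < d -> ~ (nm z' <= nm c' + 2).
  move/negP; rewrite -ltNge => hx; exists ((nm x - nm c - 2) / 2); first lra.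
  move=> c' z' h1 h2 /=; have := nm_subl x z'; rewrite nm_sym.
  have := nm_subl c' c; lra.
have step (s : R[i]) x (d : R) : s ^+ 2 = 1 -> 0 < d -> exists2 d' : R, 0 < d' &
    forall c' z', nm (c' - c) < d' -> nm (z' - x) < d' ->
      nm (s * z' ^+ 2 + c' - (s * x ^+ 2 + c)) < d.
  move=> s2 d0; have d2 : 0 < d / 2 by lra.
  have [r r0 hr] := contM (cont_id x) (cont_id x) d2.
  exists (Num.min r (d / 2)); first by rewrite lt_min r0.
  move=> c' z'; rewrite !lt_min => /andP[_ h1] /andP[/hr h2 _].
  have -> : s * z' ^+ 2 + c' - (s * x ^+ 2 + c) = s * (z' * z' - x * x) + (c' - c) by ring.
  by apply: le_lt_trans (nmD _ _) _; rewrite nmM (nm_sign s2) mul1r; lra.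
elim: N z {h} hN => [|N IH] x hx.
  have [|d d0 hd] := big x; first by move=> h; apply: hx.
  by exists d => // c' z' h1 h2 [h _]; exact: hd h.
have [hb|hb] := EM (nm x <= nm c + 2); last first.
  have [d d0 hd] := big x hb.
  by exists d => // c' z' h1 h2 [h _]; exact: hd h.
have [|d1 d10 hd1] := IH (1 * x ^+ 2 + c); first by move=> h; apply: hx; split => //; left.
have [|d2 d20 hd2] := IH (-1 * x ^+ 2 + c); first by move=> h; apply: hx; split => //; right.
have s1 : 1 ^+ 2 = 1 :> R[i] by rewrite expr1n.
have sN1 : (-1) ^+ 2 = 1 :> R[i] by rewrite sqrrN expr1n.
have [d3 d30 hd3] := step 1 x d1 s1 d10.
have [d4 d40 hd4] := step (-1) x d2 sN1 d20.
exists (Num.min (Num.min d1 d2) (Num.min d3 d4)); first by rewrite !lt_min d10 d20 d30.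
move=> c' z'; rewrite !lt_min => /andP[/andP[a1 a2] /andP[a3 a4]].
move=> /andP[/andP[b1 b2] /andP[b3 b4]] [_ [h|h]].
  by apply: hd1 h => //; exact: hd3.
by apply: hd2 h => //; exact: hd4.
Qed.

Lemma bdd_open_start c z : ~ bdd_start c z -> nr z (fun w => ~ bdd_start c w).
Proof.
by move=> /bdd_open[d d0 hd]; exists d => // w hw; apply: hd; rewrite ?subrr ?nm0.
Qed.

(** The orbit tree of an escaping point has finite depth inside the disc. The first points outside
    it are kept as leaves, since their images are outside again. *)
Lemma reach_finite c x : ~ bdd_start c x -> exists L : seq R[i], [/\ x \in L,
  forall z s, z \in L -> s ^+ 2 = 1 -> nm (s * z ^+ 2 + c) <= nm c + 2 ->
    s * z ^+ 2 + c \in L &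
  forall z, z \in L -> ~ bdd_start c z].
Proof.
move=> h; have [N hN] : exists N, ~ survive N c x.
  by apply: contrapT => /forallNP hn; apply: h; apply/bdd_survive => N; apply: contrapT.
have out z : ~ (nm z <= nm c + 2) -> exists L : seq R[i], [/\ z \in L,
    forall z s, z \in L -> s ^+ 2 = 1 -> nm (s * z ^+ 2 + c) <= nm c + 2 ->
      s * z ^+ 2 + c \in L &
    forall z, z \in L -> ~ bdd_start c z].
  move=> hz; exists [:: z]; split; first by rewrite mem_head.
    move=> w s; rewrite inE => /eqP -> s2; move/negP: hz; rewrite -ltNge => hz.
    by have := escape s2 hz; have := nm_ge0 c; lra.
  move=> w; rewrite inE => /eqP -> /bdd_nm hw; apply: hz; lra.
elim: N x h hN => [|N IH] x h hN.
  by apply: out => hx; apply: hN.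
have [hb|hb] := EM (nm x <= nm c + 2); last exact: out.
have s1 : 1 ^+ 2 = 1 :> R[i] by rewrite expr1n.
have sN1 : (-1) ^+ 2 = 1 :> R[i] by rewrite sqrrN expr1n.
have [|?|L1 [x1 i1 k1]] := IH (1 * x ^+ 2 + c).
- by move=> h1; apply: h; apply/bdd_step; exists 1.
- by apply: hN; split => //; left.
have [|?|L2 [x2 i2 k2]] := IH (-1 * x ^+ 2 + c).
- by move=> h1; apply: h; apply/bdd_step; exists (-1).
- by apply: hN; split => //; right.
exists (x :: L1 ++ L2); split; first by rewrite mem_head.
- move=> z s; rewrite inE mem_cat => /or3P[/eqP ->|z1|z2] s2 hs.
  + case: (signE s2) hs => -> _; rewrite inE mem_cat ?x1 ?x2 ?orbT //.
  + by rewrite inE mem_cat i1 ?orbT.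
  + by rewrite inE mem_cat i2 ?orbT.
- by move=> z; rewrite inE mem_cat => /or3P[/eqP ->|/k1|/k2].
Qed.

Lemma reach_finite_seq c (T S : seq R[i]) :
  (forall t s, t \in S -> s ^+ 2 = 1 -> s * t ^+ 2 + c \in T \/
     ~ bdd_start c (s * t ^+ 2 + c)) ->
  exists L : seq R[i], [/\ forall t s, t \in S -> s ^+ 2 = 1 ->
      s * t ^+ 2 + c \in T ++ L,
    forall z s, z \in L -> s ^+ 2 = 1 -> nm (s * z ^+ 2 + c) <= nm c + 2 ->
      s * z ^+ 2 + c \in L &
    forall z, z \in L -> ~ bdd_start c z].
Proof.
elim: S => [|t S IH] h; first by exists [::].
have [|L [h1 h2 h3]] := IH.
  by move=> u s uS; apply: h; rewrite inE uS orbT.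
have one (s : R[i]) : s ^+ 2 = 1 -> exists L : seq R[i],
   [/\ s * t ^+ 2 + c \in T ++ L,
    forall z s, z \in L -> s ^+ 2 = 1 -> nm (s * z ^+ 2 + c) <= nm c + 2 ->
      s * z ^+ 2 + c \in L &
    forall z, z \in L -> ~ bdd_start c z].
  move=> s2; have [hT|hK] := h t s (mem_head _ _) s2.
    by exists [::]; split => //; rewrite mem_cat hT.
  have [L' [a1 a2 a3]] := reach_finite hK; exists L'; split => //.
  by rewrite mem_cat a1 orbT.
have [|L1 [a1 a2 a3]] := one 1; first by rewrite expr1n.
have [|L2 [b1 b2 b3]] := one (-1); first by rewrite sqrrN expr1n.
exists (L ++ L1 ++ L2); split.
- move=> u s; rewrite inE => /orP[/eqP ->|uS] s2.
    case: (signE s2) => ->; [move: a1|move: b1];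
    by rewrite !mem_cat => /orP[] ->; rewrite ?orbT.
  by have := h1 u s uS s2; rewrite !mem_cat => /orP[] ->; rewrite ?orbT.
- move=> z s; rewrite !mem_cat => /or3P[zL|zL|zL] s2 hs.
  + by rewrite h2.
  + by rewrite a2 ?orbT.
  + by rewrite b2 ?orbT.
- by move=> z; rewrite !mem_cat => /or3P[/h3|/a3|/b3].
Qed.

End Orbits.

(** * From the correspondence to sign sequences; combinatorics of a Misiurewicz parameter *)

Section Bridge.
Variable R : realType.
Implicit Types (c x y z w : R[i]) (e : nat -> R[i]).

Lemma corrP c z w : corr 4 2 (c : Cx R) z w <-> exists2 s, s ^+ 2 = 1 & w = s * z ^+ 2 + c.
Proof.
split=> [h|[s s2 ->]].
  have {}h : (w - c) ^+ 2 = (z ^+ 2) ^+ 2 by rewrite -exprM; exact: h.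
  move/eqP: h; rewrite eqf_sqr => /orP[] /eqP h.
    by exists 1; rewrite ?expr1n // mul1r -h subrK.
  by exists (-1); rewrite ?sqrrN ?expr1n // mulN1r -h subrK.
have h : (s * z ^+ 2 + c - c) ^+ 2 = z ^+ 4.
  by rewrite addrK exprMn s2 mul1r -exprM.
exact: h.
Qed.

Lemma forward_orbit_signs c z0 (z : nat -> Cx R) : forward_orbit 4 2 (c : Cx R) z0 z ->
  exists2 e, signs e & forall j, z j = orb e c z0 j.
Proof.
move=> [h0 h]; have [e he] : {e : nat -> R[i] & forall j, e j ^+ 2 = 1 /\
    z j.+1 = e j * (z j : R[i]) ^+ 2 + c :> R[i]}.
  apply: (@choice _ _ (fun j (s : R[i]) => s ^+ 2 = 1 /\
    z j.+1 = s * (z j : R[i]) ^+ 2 + c :> R[i])) => j.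
  by have /corrP[s s2 hs] := h j; exists s.
exists e => [j|j]; first by have [] := he j.
by elim: j => [//|j IH] /=; have [_ ->] := he j; rewrite IH.
Qed.

Lemma orb_forward_orbit e c z0 : signs e ->
  forward_orbit 4 2 (c : Cx R) (z0 : Cx R) (orb e c z0 : nat -> Cx R).
Proof. by move=> se; split => // j; apply/corrP; exists (e j). Qed.

Lemma bounded_orbit_nm (z : nat -> Cx R) : bounded_orbit z <->
  exists M : R, forall j, nm (z j : R[i]) <= M.
Proof.
split=> [[D /compact_nm_bounded[M hM] hD]|[M hM]].
  by exists M => j; apply: hM.
by have [D cD hD] := compact_disc M; exists D => // j; apply: hD.
Qed.

Lemma filled_juliaP c z : filled_julia 4 2 (c : Cx R) (z : Cx R) <-> bdd_start c z.
Proof.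
split=> [[y /forward_orbit_signs[e se ye] /bounded_orbit_nm[M hM]]|[e se he]].
  by exists e => //; apply: (orb_bound se (M := M)) => j; rewrite -ye.
exists (orb e c z : nat -> Cx R); first exact: orb_forward_orbit.
by apply/bounded_orbit_nm; exists (nm c + 2).
Qed.

Lemma bdd_critical c : bdd_start c 0 <-> bdd_start c c.
Proof.
split=> [/bdd_step[s _]|h]; first by rewrite expr0n mulr0 add0r.
by apply/bdd_step; exists 1; rewrite ?expr1n // expr0n mulr0 add0r.
Qed.

Lemma closed_filled_julia c : closed (filled_julia 4 2 (c : Cx R)).
Proof.
apply: closed_nr => z hz.
have /bdd_open_start h : ~ bdd_start c z by move=> /filled_juliaP.
by apply: nr_imp h => w hw /filled_juliaP.
Qed.

Lemma closed_multibrot : closed (@multibrot R 4 2).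
Proof.
apply: closed_nr => c hc.
have /bdd_open[d d0 hd] : ~ bdd_start c c.
  by move=> /bdd_critical /filled_juliaP.
exists d => // w hw /filled_juliaP /bdd_critical; exact: hd.
Qed.

(* The critical orbit of a Misiurewicz parameter, indexed from the critical value [a]. *)
Lemma misiurewicz_orbit a : misiurewicz 4 2 (a : Cx R) ->
  exists (b e : nat -> R[i]) (m n : nat),
    [/\ signs e, b 0%N = a, forall j, b j.+1 = e j * b j ^+ 2 + a,
        forall j, bdd_start a (b j) &
    [/\ forall j, b j != 0, forall j, ~ bdd_start a (- e j * b j ^+ 2 + a),
        (0 < n)%N, forall j, b (m.+1 + j + n)%N = b (m.+1 + j)%N &
        b (m + n)%N != b m]].
Proof.
move=> [z [fz /bounded_orbit_nm bz uz pz npz]].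
have z0 : z 0%N = 0 by case: fz.
have [e se ze] := forward_orbit_signs fz.
have zS j : z j.+1 = e j * (z j : R[i]) ^+ 2 + a :> R[i] by rewrite !ze.
have kz j : bdd_start a (z j).
  case: bz => M hM; exists (fun k => e (j + k)%N) => [k|]; first exact: se.
  apply: (orb_bound (M := M)) => [k|k]; first exact: se.
  by rewrite ze -orbD -ze.
(* After a return to 0 the shifted sequence is a bounded orbit of 0, equal to [z] by uniqueness, and
   [z] would be periodic. *)
have zn0 j : (z j.+1 : R[i]) != 0.
  apply/eqP => zj; apply: npz; exists j.+1 => // k.
  have : (fun k => z (k + j.+1)%N) = z.
    apply: uz; last by apply/bounded_orbit_nm; case: bz => M hM; exists M => i; exact: hM.
    split; first exact: zj.
    by move=> i; rewrite addSn; case: fz.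
  by move=> h; rewrite -[in RHS]h.
(* Changing one sign and continuing along a bounded orbit gives a bounded orbit of 0. It must be
   [z], so both signs have the same image, which forces [z j.+1 = 0]. *)
have other j : ~ bdd_start a (- e j.+1 * (z j.+1 : R[i]) ^+ 2 + a).
  move=> [f sf hf].
  pose g k := if (k < j.+1)%N then e k else if (k == j.+1)%N then - e j.+1 else f (k - j.+2)%N.
  have sg : signs g.
    by move=> k; rewrite /g; case: ifP => _ //; case: ifP => _ //; rewrite sqrrN.
  have gj : orb g a 0 j.+1 = z j.+1.
    by rewrite ze; apply: orb_ext => k hk; rewrite /g hk.
  have gS : orb g a 0 j.+2 = - e j.+1 * (z j.+1 : R[i]) ^+ 2 + a.
    by rewrite [LHS]/= -/(orb g a 0 j.+1) gj /g ltnn eqxx.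
  have gz : (orb g a 0 : nat -> Cx R) = z.
    apply: uz; first exact: orb_forward_orbit.
    apply/bounded_orbit_nm.
    have key k : nm (orb g a 0 (j.+2 + k)) <= nm a + 2.
      rewrite orbD gS (_ : orb _ _ _ _ = orb f a (- e j.+1 * (z j.+1 : R[i]) ^+ 2 + a) k) //.
      apply: orb_ext => i _; rewrite /g ltnNge (leq_trans _ (leq_addr _ _)) //=.
      by rewrite gtn_eqF ?addKn // ltn_addr.
    have kg : bdd_start a (orb g a 0 j.+2).
      exists (fun k => g (j.+2 + k)%N) => [k|k]; first exact: sg.
      by rewrite -orbD.
    case: bz => M hM; exists (Num.max M (nm a + 2)) => i; rewrite le_max.
    have [hi|hi] := ltnP i j.+2; last by rewrite -(subnKC hi) key orbT.
    rewrite (_ : orb g a 0 i = z i) ?hM //.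
    rewrite ze; apply: orb_ext => k hk.
    by rewrite /g (leq_trans hk).
  have h1 : (z j.+2 : R[i]) = - e j.+1 * (z j.+1 : R[i]) ^+ 2 + a.
    by transitivity (orb g a 0 j.+2 : R[i]); [rewrite gz|exact: gS].
  have : e j.+1 * (z j.+1 : R[i]) ^+ 2 = 0.
    move: h1; rewrite zS => /addIr h1.
    have : 2 * (e j.+1 * (z j.+1 : R[i]) ^+ 2) = 0.
      by rewrite mulr_natl mulr2n {1}h1 mulNr addNr.
    by move/eqP; rewrite mulf_eq0 pnatr_eq0 /= => /eqP.
  move/eqP; rewrite mulf_eq0 expf_eq0 /= (negbTE (zn0 j)) orbF => /eqP e0.
  by have := se j.+1; rewrite e0 expr0n => /esym/eqP; rewrite oner_eq0.
pose p k := `[< exists2 n, (0 < n)%N & forall j, z (k + j + n)%N = z (k + j)%N >].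
have exp : exists k, p k.
  case: pz => k [n n0 hn]; exists k; apply/asboolP; exists n => // j.
  by rewrite -addnA hn.
case: (ex_minnP exp) => k /asboolP[n n0 hn] kmin.
have zn k' : (z (k' + n)%N = z k') -> (forall j, z (k'.+1 + j + n)%N = z (k'.+1 + j)%N) ->
   p k'.
  move=> h1 h2; apply/asboolP; exists n => // -[|j]; first by rewrite addn0.
  by rewrite addnS -addSn h2.
(* The least preperiod is at least 2: 0 does not recur, and a return to [z 1 = a] comes from a
   return to 0. So it remains positive after reindexing from [a]. *)
case: k hn kmin => [|[|m]] hn kmin.
- have := hn 0%N; rewrite z0 => h; case: n n0 h {hn zn} => // n _ h.
  by have := zn0 n; rewrite [z n.+1]h eqxx.
- have := hn 0%N; rewrite addn0 add1n !zS z0 expr0n mulr0 add0r.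
  move/eqP; rewrite -subr_eq0 addrK mulf_eq0 expf_eq0 /=.
  case: n n0 hn {zn} => // n _ _; rewrite (negbTE (zn0 n)) orbF => /eqP e0.
  by have := se n.+1; rewrite e0 expr0n => /esym/eqP; rewrite oner_eq0.
exists (fun j => z j.+1), (fun j => e j.+1), m, n; split.
- by move=> j; exact: se.
- by rewrite zS z0 expr0n mulr0 add0r.
- by move=> j; rewrite zS.
- by move=> j.
split => //.
apply/eqP => h; have := kmin m.+1; rewrite zn //.
  by move=> /(_ isT); rewrite ltnn.
Qed.

End Bridge.

(** * Common radii, the mean value inequality, and arcs that avoid a finite set *)

Section Auxiliary.
Variable R : realType.
Implicit Types (x y z w : R[i]).

Lemma common_radius (N : nat) (Q : nat -> R -> Prop) :
  (forall j (d d' : R), d' <= d -> Q j d -> Q j d') ->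
  (forall j, (j < N)%N -> exists2 d : R, 0 < d & Q j d) ->
  exists2 d : R, 0 < d & forall j, (j < N)%N -> Q j d.
Proof.
move=> mono; elim: N => [|N IH] h; first by exists 1.
have [|d d0 hd] := IH; first by move=> j hj; apply: h; rewrite ltnW.
have [d' d'0 hd'] := h N (ltnSn N).
exists (Num.min d d'); first by rewrite lt_min d0.
move=> j; rewrite ltnS leq_eqVlt => /orP[/eqP ->|hj].
  by apply: mono hd'; rewrite ge_min lexx orbT.
by apply: mono (hd j hj); rewrite ge_min lexx.
Qed.

Lemma isolated_seq (P : seq R[i]) y : exists2 s : R, 0 < s &
  forall w, nm (w - y) <= s -> w \in P -> w = y.
Proof.
have [|d d0 hd] := @nr_seq _ _ P y (fun q w => q != y -> w != q).
  move=> q _; have [->|qy] := eqVneq q y; first exact: nr_all.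
  have : nr y (fun w => w - q != 0).
    apply: cont_neq0; last by rewrite subr_eq0 eq_sym.
    by apply: contD; [exact: cont_id|exact: cont_cst].
  by apply: nr_imp => w; rewrite subr_eq0.
exists (d / 2); first lra.
move=> w hw wP; apply/eqP; apply: contraT => wy.
have hw' : nm (w - y) < d by lra.
by have := hd w hw' w wP wy; rewrite eqxx.
Qed.

(** Continuous induction along the segment: for any slope [M' > M], the supremum of the parameters
    where the bound holds is attained and equals 1. Then [M'] tends to [M]. *)
Lemma mean_value (F : R[i] -> R[i]) (M : R) z : 0 <= M ->
  (forall t : R, 0 <= t <= 1 -> exists2 d, hasder F (t%:C%C * z) d & nm d <= M) ->
  nm (F z - F 0) <= M * nm z.
Proof.
move=> M0 hF.
have key (M' : R) : M < M' -> nm (F z - F 0) <= M' * nm z.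
  move=> MM'.
  have loc (t : R) : 0 <= t <= 1 -> exists2 r : R, 0 < r & forall t' : R, `|t' - t| < r ->
      nm (F (t'%:C%C * z) - F (t%:C%C * z)) <= M' * nm z * `|t' - t|.
    move=> ht; have [d [g [hg cg gd]] dM] := hF t ht.
    have e0 : 0 < M' - M by lra.
    have [r r0 hr] := nr_and hg (cg _ e0).
    have z1 : 0 < nm z + 1 by have := nm_ge0 z; lra.
    exists (r / (nm z + 1)); first exact: divr_gt0.
    move=> t'; rewrite ltr_pdivlMr // => ht'.
    have E : t'%:C%C * z - t%:C%C * z = (t' - t)%:C%C * z by rewrite rmorphB mulrBl.
    have [] := hr (t'%:C%C * z).
      rewrite E nmM nm_real; apply: le_lt_trans ht'.
      by apply: ler_wpM2l => //; lra.
    move=> -> hgt; rewrite addrAC subrr add0r E !nmM nm_real.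
    rewrite [leRHS](_ : _ = nm z * (`|t' - t| * M')); last by ring.
    rewrite [leLHS](_ : _ = nm z * (`|t' - t| * nm (g (t'%:C%C * z)))); last by ring.
    apply: ler_wpM2l; first exact: nm_ge0.
    apply: ler_wpM2l => //.
    by have := nm_subl (g (t'%:C%C * z)) (g (t%:C%C * z)); rewrite gd in hgt *; lra.
  pose S := [set t : R | 0 <= t <= 1 /\ nm (F (t%:C%C * z) - F 0) <= M' * nm z * t].
  have S0 : S 0.
    by rewrite /S /= lexx ler01 mul0r subrr nm0 mulr0.
  have supS : has_sup S by split; [exists 0|exists 1 => t [/andP[]]].
  have s01 : 0 <= sup S <= 1.
    rewrite sup_upper_bound //=; apply: ge_sup; first by exists 0.
    by move=> t [/andP[]].
  have [r r0 hr] := loc _ s01.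
  have sS : S (sup S).
    split => //; have [t St ht] := sup_adherent r0 supS.
    have ts : t <= sup S by apply: sup_upper_bound.
    have := hr t; rewrite distrC ger0_norm ?subr_ge0 //.
    have -> : sup S - t < r by lra.
    move=> /(_ isT) h1; case: St => _ h2.
    apply: le_trans (nm_tri (F (t%:C%C * z)) _ _) _; rewrite nm_sym in h1; nra.
  have s1 : sup S = 1.
    apply/eqP; rewrite eq_le; case/andP: (s01) => s0 ->; rewrite leNgt /=; apply/negP => lt.
    pose t := Num.min 1 (sup S + r / 2).
    have t1 : t <= 1 by rewrite ge_min lexx.
    have ts : sup S < t by rewrite lt_min lt; lra.
    have tr : t - sup S < r.
      have : t <= sup S + r / 2 by rewrite ge_min lexx orbT.
      lra.
    have St : S t.
      split; first by rewrite t1 andbT; lra.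
      have a1 : `|t - sup S| = t - sup S by rewrite ger0_norm // subr_ge0 ltW.
      have := hr t; rewrite a1 => /(_ tr) h1.
      case: sS => _ h2; apply: le_trans (nm_tri (F ((sup S)%:C%C * z)) _ _) _; nra.
    by have := sup_upper_bound supS St; lra.
  by case: sS => _; rewrite s1 rmorph1 mul1r mulr1.
rewrite leNgt; apply/negP => lt.
have [z0|z0] := eqVneq (nm z) 0.
  by have := key (M + 1); rewrite ltrDl ltr01 => /(_ isT); rewrite z0 !mulr0 in lt *; lra.
have zp : 0 < nm z by rewrite lt_def z0 nm_ge0.
have := key ((M + nm (F z - F 0) / nm z) / 2).
have h : M < nm (F z - F 0) / nm z by rewrite ltr_pdivlMr.
have -> : M < (M + nm (F z - F 0) / nm z) / 2 by lra.
move=> /(_ isT); rewrite mulrAC mulrDl mulfVK //; lra.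
Qed.

Lemma avoid_seq (l : seq R) (t0 : R) : 0 < t0 -> exists t, 0 < t <= t0 /\ t \notin l.
Proof.
move=> h0; have [t [ht hl]] : exists t, 0 < t <= t0 /\ forall x : R, x \in l -> 0 < x -> t < x.
  elim: l => [|x l [t [/andP[t1 t2] hl]]]; first by exists t0; rewrite h0 lexx.
  have [x0|x0] := ltP 0 x; last first.
    exists t; rewrite t1 t2; split => // u; rewrite inE => /orP[/eqP ->|/hl //].
    by move=> h; have := lt_le_trans h x0; rewrite ltxx.
  exists (Num.min t (x / 2)); split.
    by rewrite lt_min t1 divr_gt0 //= ge_min t2.
  move=> u; rewrite inE => /orP[/eqP -> _|/hl h /h h'].
    have : Num.min t (x / 2) <= x / 2 by rewrite ge_min lexx orbT.
    lra.
  have : Num.min t (x / 2) <= t by rewrite ge_min lexx.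
  lra.
exists t; split => //; apply/negP => /hl; case/andP: ht => h1 _ /(_ h1).
by rewrite ltxx.
Qed.

Lemma clamp_lip (p q : R) :
  `|Num.max 0 (Num.min 1 p) - Num.max 0 (Num.min 1 q)| <= `|p - q|.
Proof.
wlog pq : p q / p <= q.
  by case/orP: (le_total p q) => h wl; [|rewrite distrC [leRHS]distrC]; exact: wl.
have mono : Num.max 0 (Num.min 1 p) <= Num.max 0 (Num.min 1 q).
  by apply: le_max2 => //; apply: le_min2.
rewrite distrC [leRHS]distrC !ger0_norm ?subr_ge0 //.
have [h1|h1] := leP 1 p; have [h2|h2] := leP 1 q; rewrite ?(max_idPr ler01) //;
  have [h3|h3] := leP 0 p; have [h4|h4] := leP 0 q; lra.
Qed.

(* A parabolic arc from [x] to [u]: every point of [P] lies on at most one arc of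
   this family, so a generic arc misses [P]. *)
Lemma avoiding_arc (P : seq R[i]) (r r' : R) x u : x \notin P -> u \notin P ->
  nm x <= r -> nm u <= r -> r < r' ->
  exists (g : R -> R[i]) (s L : R), [/\ 0 < s, g 0 = x, g 1 = u,
    forall t w, 0 <= t <= 1 -> nm (w - g t) <= 2 * s -> nm w <= r' /\ w \notin P &
    0 < L /\ forall t t', 0 <= t <= 1 -> 0 <= t' <= 1 ->
      nm (g t - g t') <= L * `|t - t'|].
Proof.
move=> xP uP xr ur rr'.
have r0 : 0 <= r by apply: le_trans xr; exact: nm_ge0.
(* In the coordinate with [x] at 0 and [u] at 1 the arc is [t + i k t (1 - t)]; [bad q] is the only
   [k] for which it can pass through [q] between its end points. *)
pose bad q := let v := (q - x) / (u - x) in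
  complex.Im v / (complex.Re v * (1 - complex.Re v)).
(* As [|u - x| <= 2 r], the arc deviates from the chord by at most half of [r' - r]. *)
pose t0 : R := Num.min 1 ((r' - r) / (4 * (r + 1))).
have t00 : 0 < t0.
  by rewrite lt_min ltr01 divr_gt0 ?mulr_gt0 // ?subr_gt0 //; lra.
have [k [/andP[k0 k1] kbad]] := avoid_seq [seq bad q | q <- P] t00.
have kr : k * (4 * (r + 1)) <= r' - r.
  rewrite -ler_pdivlMr ?mulr_gt0 //; last lra.
  by apply: le_trans k1 _; rewrite ge_min lexx orbT.
have k1' : k <= 1 by apply: le_trans k1 _; rewrite ge_min lexx.
pose g (t : R) := x + Complex t (k * (t * (1 - t))) * (u - x).
have ux : nm (u - x) <= 2 * r by apply: le_trans (nmB _ _) _; lra.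
have gP t q : 0 <= t <= 1 -> q \in P -> g t != q.
  move=> ht qP; apply/eqP => gq.
  have [e|ne] := eqVneq u x.
    by move: gq xP; rewrite /g e subrr mulr0 addr0 => ->; rewrite qP.
  have hv : (q - x) / (u - x) = Complex t (k * (t * (1 - t))).
    rewrite -gq /g addrAC subrr add0r mulfK // subr_eq0 //.
  have [t0'|t0'] := eqVneq t 0.
    move: gq xP; rewrite /g t0' mul0r mulr0 (_ : Complex 0 0 = 0) // mul0r addr0 => ->.
    by rewrite qP.
  have [t1'|t1'] := eqVneq t 1.
    move: gq uP; rewrite /g t1' subrr !mulr0 (_ : Complex 1 0 = 1) // mul1r.
    by rewrite addrC subrK => ->; rewrite qP.
  move/negP: kbad; apply; apply/mapP; exists q => //.
  rewrite /bad hv /= mulfK // mulf_neq0 // subr_eq0 eq_sym //.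
have gr t : 0 <= t <= 1 -> nm (g t) <= (r + r') / 2.
  move=> /andP[h0 h1].
  have -> : g t = ((1 - t)%:C%C * x + t%:C%C * u) + (Complex 0 1 * (k * (t * (1 - t)))%:C%C) * (u - x).
    rewrite /g (_ : Complex t _ = t%:C%C + Complex 0 1 * (k * (t * (1 - t)))%:C%C).
      by rewrite rmorphB rmorph1; ring.
    by apply/eqP; rewrite eq_complex /=; apply/andP; split; apply/eqP; ring.
  apply: le_trans (nmD _ _) _; apply: le_trans (lerD (nmD _ _) (lexx _)) _.
  rewrite !nmM !nm_real (ger0_norm h0) !ger0_norm; last 2 first.
  - by rewrite mulr_ge0 // ?mulr_ge0 //; lra.
  - lra.
  have -> : nm (Complex 0 1 : R[i]) = 1.
    by rewrite /nm /= expr0n expr1n add0r sqrtr1.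
  have h2 : t * (1 - t) <= 1 by nra.
  have h3 : 0 <= t * (1 - t) by rewrite mulr_ge0 //; lra.
  have h4 : k * (t * (1 - t)) <= k by apply: ler_piMr => //; lra.
  have h5 : 0 <= k * (t * (1 - t)) by rewrite mulr_ge0 //; lra.
  rewrite mul1r; have := ler_pM h5 (nm_ge0 (u - x)) h4 ux.
  have := ler_wpM2l h0 ur; have h6 : 0 <= 1 - t by lra.
  have := ler_wpM2l h6 xr; nra.
pose L := 2 * (2 * r) + 1.
have gL t t' : 0 <= t <= 1 -> 0 <= t' <= 1 -> nm (g t - g t') <= L * `|t - t'|.
  move=> /andP[h0 h1] /andP[h0' h1'].
  have -> : g t - g t' = Complex 1 (k * (1 - t - t')) * (t - t')%:C%C * (u - x).
    rewrite /g opprD addrACA subrr add0r -mulrBl; congr (_ * _).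
    by apply/eqP; rewrite eq_complex /=; apply/andP; split; apply/eqP; ring.
  rewrite !nmM nm_real.
  have h2 : nm (Complex 1 (k * (1 - t - t')) : R[i]) <= 2.
    apply: le_trans (nm_le_parts _) _; rewrite /= normr1 normrM (gtr0_norm k0).
    have h3 : `|1 - t - t'| <= 1 by rewrite ler_norml; apply/andP; split; lra.
    have := ler_pM (ltW k0) (normr_ge0 _) k1' h3; lra.
  have := ler_pM (nm_ge0 _) (nm_ge0 _) h2 ux.
  by have := normr_ge0 (t - t'); rewrite /L; nra.
(* Clamping the real part extends the arc to the plane, so that [disc_cover] provides the
   compactness of [[0, 1]]. *)
pose cl (y : R[i]) : R := Num.max 0 (Num.min 1 (complex.Re y)).
have cl01 y : 0 <= cl y <= 1.
  by rewrite /cl le_max lexx ge_max ler01 ge_min lexx.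
have clL y y' : `|cl y - cl y'| <= nm (y - y').
  apply: le_trans (_ : `|complex.Re y - complex.Re y'| <= _); last first.
    by apply: le_trans (Re_le_nm (y - y')); case: y y' => ? ? [? ?].
  exact: clamp_lip.
have [N hN] : exists N, forall n y, (N <= n)%N -> nm y <= 1 ->
    forall q, q \in P -> n.+1%:R^-1 <= nm (g (cl y) - q).
  apply: (@disc_cover R 1 (fun n y => forall q, q \in P -> n.+1%:R^-1 <= nm (g (cl y) - q))).
  move=> y _.
  have : forall q, q \in P -> nr y (fun w => nm (g (cl y) - q) / 2 <= nm (g (cl w) - q)).
    move=> q qP; have q0 : 0 < nm (g (cl y) - q).
      by rewrite nm_gt0 subr_eq0 gP.
    have L0 : 0 < L by rewrite /L; lra.
    exists (nm (g (cl y) - q) / (2 * L)); first by rewrite divr_gt0 // mulr_gt0.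
    move=> w hw; have := nm_tri (g (cl w)) (g (cl y)) q.
    have h1 := gL _ _ (cl01 y) (cl01 w).
    have h2 := clL y w; rewrite nm_sym in h2.
    have h3 : L * nm (w - y) <= nm (g (cl y) - q) / 2.
      rewrite -ler_pdivlMl //; apply: le_trans (ltW hw) _.
      by rewrite le_eqVlt; apply/orP; left; apply/eqP; field; lra.
    have := ler_wpM2l (ltW L0) h2; lra.
  move=> /nr_seq [d d0 hd]; exists d => //.
  have [M [M0 hM]] : exists M : R, 0 < M /\ forall q, q \in P -> M <= nm (g (cl y) - q).
    have : forall q, q \in P -> 0 < nm (g (cl y) - q).
      by move=> q qP; rewrite nm_gt0 subr_eq0 gP.
    elim: (P) => [|q Q IH] h; first by exists 1.
    have [|M [M0 hM]] := IH; first by move=> q' hq'; apply: h; rewrite inE hq' orbT.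
    exists (Num.min M (nm (g (cl y) - q))); split.
      by rewrite lt_min M0 h // mem_head.
    move=> q'; rewrite inE => /orP[/eqP ->|/hM]; first by rewrite ge_min lexx orbT.
    by apply: le_trans; rewrite ge_min lexx.
  have M2 : 0 < M / 2 by lra.
  have [N hN] := small_inv M2; exists N => n w /hN hn hw q qP.
  have := hd w hw q qP; have := hM q qP.
  by move: (n.+1%:R^-1) hn => v; lra.
have v0 : 0 < N.+1%:R^-1 :> R by rewrite invr_gt0 ltr0n.
pose v : R := N.+1%:R^-1.
exists g, (Num.min (v / 4) ((r' - r) / 8)), L; split.
- by rewrite lt_min !divr_gt0 ?subr_gt0.
- by rewrite /g mul0r mulr0 (_ : Complex 0 0 = 0) // mul0r addr0.
- by rewrite /g subrr !mulr0 (_ : Complex 1 0 = 1) // mul1r addrC subrK.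
- move=> t w ht hw; split.
    have := gr t ht; have := nm_subl w (g t).
    have : Num.min (v / 4) ((r' - r) / 8) <= (r' - r) / 8 by rewrite ge_min lexx orbT.
    lra.
  apply/negP => wP; have := hN N t%:C%C (leqnn _) _ w wP.
  rewrite nm_real; case/andP: (ht) => h0 h1; rewrite ger0_norm // => /(_ h1).
  have -> : cl t%:C%C = t by rewrite /cl /= (min_idPr h1) (max_idPr h0).
  rewrite -/v nm_sym.
  have : Num.min (v / 4) ((r' - r) / 8) <= v / 4 by rewrite ge_min lexx.
  have : 0 < v by []. lra.
- by split => //; rewrite /L; lra.
Qed.

End Auxiliary.

(* [b] is the bounded orbit of the critical value [a], with signs [e], preperiod [m]
   and period [n]. *)
Record critical_orbit (R : realType) (a : R[i]) (b e : nat -> R[i]) (m n : nat) : Prop :=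
  CriticalOrbit {
    co_signs : signs e;
    co_start : b 0%N = a;
    co_step : forall j, b j.+1 = e j * b j ^+ 2 + a;
    co_bdd : forall j, bdd_start a (b j);
    co_neq0 : forall j, b j != 0;
    co_other : forall j, ~ bdd_start a (- e j * b j ^+ 2 + a);
    co_period_gt0 : (0 < n)%N;
    co_preperiod_gt0 : (0 < m)%N;
    co_periodic : forall j, b (m + j + n)%N = b (m + j)%N;
    co_preperiodic : b (m.-1 + n)%N != b m.-1 }.

(** * The critical orbit, the postcritical set and the repelling cycle *)

Section CriticalOrbit.
Variable R : realType.
Implicit Types (c x y z w : R[i]).
Variables (a : R[i]) (b e : nat -> R[i]) (m n : nat).
Hypothesis H : critical_orbit a b e m n.
Let se := co_signs H.
Let b0 := co_start H.
Let bS := co_step H.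
Let bK := co_bdd H.
Let bn0 := co_neq0 H.
Let other := co_other H.
Let n0 := co_period_gt0 H.
Let per := co_periodic H.

(** Derivative at [b m] of the return map along the cycle. *)
Definition multiplier : R[i] := \prod_(0 <= i < n) (2 * e (m + i)%N * b (m + i)%N).

(** With opposite signs at equal points, the bounded successor of one would be the escaping branch
    of the other. *)
Lemma b_next i j : b i = b j -> e i = e j /\ b i.+1 = b j.+1.
Proof.
move=> h; suff he : e i = e j by split => //; rewrite !bS he h.
case: (signE (se i)) (signE (se j)) => hi [] hj; rewrite ?hi ?hj //; exfalso.
- apply: (@other j); rewrite hj opprK mul1r -h.
  by have := bK i.+1; rewrite bS hi mul1r.
- apply: (@other j); rewrite hj -h -hi.
  by have := bK i.+1; rewrite bS.
Qed.

Lemma b_shift i j k : b i = b j -> b (i + k)%N = b (j + k)%N /\ e (i + k)%N = e (j + k)%N.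
Proof.
move=> h; elim: k => [|k [hb he]]; first by rewrite !addn0; have [] := b_next h.
rewrite !addnS; have [_ h'] := b_next hb; split=> //.
by have [] := b_next h'.
Qed.

Lemma b_periodic j l : b (m + j + l * n)%N = b (m + j)%N /\ e (m + j + l * n)%N = e (m + j)%N.
Proof.
elim: l => [|l [hb he]]; first by rewrite mul0n addn0.
have h : b (m + j + l * n + n)%N = b (m + j + l * n)%N by rewrite -(addnA m j) per.
by rewrite mulSn [(n + _)%N]addnC addnA h hb; have [-> _] := b_next h.
Qed.

Lemma b_reduce j : exists2 i, (i < m + n)%N & b j = b i /\ e j = e i.
Proof.
have [hj|hj] := ltnP j (m + n); first by exists j.
exists (m + (j - m) %% n)%N; first by rewrite ltn_add2l ltn_mod.
have mj : (m <= j)%N by apply: leq_trans hj; exact: leq_addr.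
have := b_periodic ((j - m) %% n) ((j - m) %/ n).
have -> // : (m + (j - m) %% n + (j - m) %/ n * n = j)%N.
by rewrite -addnA [X in (m + X)%N]addnC -divn_eq subnKC.
Qed.

Lemma orb_b i k : orb (fun l => e (i + l)%N) a (b i) k = b (i + k)%N.
Proof. by elim: k => [|k IH]; rewrite ?addn0 // addnS bS -IH. Qed.

Lemma b_ne_a j : b j.+1 != a.
Proof.
rewrite bS -subr_eq0 addrK mulf_neq0 ?expf_neq0 //.
by apply/eqP => h; have := se j; rewrite h expr0n => /esym/eqP; rewrite oner_eq0.
Qed.

Lemma sign_eq (s t : R[i]) : s ^+ 2 = 1 -> t ^+ 2 = 1 -> s <> t -> s = - t.
Proof. by move=> /signE[] -> /signE[] -> //; rewrite ?opprK. Qed.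

Lemma postcritical_set : exists P : seq R[i], [/\ a \in P,
  forall s z, s ^+ 2 = 1 -> z \in P -> nm (s * z ^+ 2 + a) <= nm a + 2 ->
    s * z ^+ 2 + a \in P &
  forall z, z \in P -> bdd_start a z -> exists j, z = b j].
Proof.
pose T := [seq b j | j <- iota 0 (m + n)].
have bT j : b j \in T.
  have [i hi [-> _]] := b_reduce j.
  by apply/mapP; exists i => //; rewrite mem_iota.
have [|L [h1 h2 h3]] := @reach_finite_seq R a T T.
  move=> t s /mapP[j _ ->] s2; have [->|se'] := EM (s = e j).
    by left; rewrite -bS bT.
  by right; rewrite (sign_eq s2 (se j) se'); exact: other.
exists (T ++ L); split.
- by rewrite mem_cat -b0 bT.
- move=> s z s2; rewrite mem_cat => /orP[zT|zL] hz; first exact: h1.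
  by rewrite mem_cat h2 ?orbT.
- move=> z; rewrite mem_cat => /orP[/mapP[j _ ->] _|/h3//].
  by exists j.
Qed.

(** Going [k] times round the cycle, [expansion] bounds [r Q^k] uniformly in [k], where [Q] is the
    product of [growth / (2 |b|)] over one period. So [Q <= 1], and the modulus of the multiplier is
    at least the product of the [growth]. *)
Lemma multiplier_gt1 : 1 < nm multiplier.
Proof.
have [P [aP Pinv P3]] := postcritical_set.
have [s s0 hs] := isolated_seq P (b m).
have hb : nm (b m) <= nm a + 3 / 2 by exact: bdd_nm.
pose r := Num.min s (1 / 2).
have r0 : 0 < r by rewrite lt_min s0; lra.
have hr w : nm (w - b m) <= r -> nm w <= nm a + 2 /\ (w \in P -> w = b m).
  move=> hw; split; last by apply: hs; apply: le_trans hw _; rewrite ge_min lexx.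
  have : r <= 1 / 2 by rewrite ge_min lexx orbT.
  by have := nm_subl w (b m); lra.
pose F i := growth a P (b (m + i)%N) / (2 * nm (b (m + i)%N)).
have F0 i : 0 < F i.
  have := growth_gt1 a P (b (m + i)%N) => h.
  by rewrite divr_gt0 ?mulr_gt0 ?nm_gt0 //; lra.
pose Q := \prod_(0 <= i < n) F i.
have prodk k : \prod_(0 <= i < k * n) F i = Q ^+ k.
  elim: k => [|k IH]; first by rewrite mul0n big_geq.
  rewrite mulSnr (big_cat_nat (n := (k * n)%N)) ?leq_addr //= IH exprSr; congr (_ * _).
  rewrite -{1}[(k * n)%N]add0n big_addn addKn; apply: eq_bigr => i _.
  have [h _] := b_periodic i k.
  by rewrite /F addnA h.
have bound k : r * Q ^+ k <= 2 * (nm a + 2).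
  rewrite -prodk; apply: (@expansion _ _ _ aP Pinv _ (fun i => b (m + i)%N) (fun i => e (m + i)%N)) => //.
  - by move=> i _; rewrite addnS; split; [exact: se|exact: bS|exact: b_ne_a].
  - have [h _] := b_periodic 0 k; rewrite !addn0 in h.
    by move=> w; rewrite h; exact: hr.
have Q1 : Q <= 1.
  rewrite leNgt; apply/negP => Q1.
  have [k hk] := pow_unbounded (2 * (nm a + 2) / r) Q1.
  by have := bound k; rewrite mulrC -ler_pdivlMr // leNgt hk.
have G1 : 1 < \prod_(0 <= i < n) growth a P (b (m + i)%N).
  have : forall k, 1 <= \prod_(0 <= i < k) growth a P (b (m + i)%N).
    elim=> [|k IH]; first by rewrite big_geq.
    by rewrite big_nat_recr //= mulr_ege1 // growth_ge1.
  case: (n) n0 => // k _ /(_ k) h; rewrite big_nat_recr //=.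
  have := growth_gt1 a P (b (m + k)%N); nra.
have lam : nm multiplier = \prod_(0 <= i < n) (2 * nm (b (m + i)%N)).
  rewrite /multiplier nm_prod; apply: eq_bigr => i _.
  by rewrite !nmM nm_nat (nm_sign (se _)) mulr1.
apply: lt_le_trans G1 _; move: Q1.
rewrite lam /Q /F big_split /= prodfV ler_pdivrMr ?mul1r //.
by apply: prodr_gt0 => i _; rewrite mulr_gt0 ?nm_gt0.
Qed.

(** Periodicity leaves finitely many points to treat. This radius forces bounded orbits near the
    critical one to take the same signs, also for nearby parameters. *)
Lemma other_open : exists2 eta : R, 0 < eta & forall j x c,
  nm (x - b j) < eta -> nm (c - a) < eta -> ~ bdd_start c (- e j * x ^+ 2 + c).
Proof.
have [||eta eta0 heta] := @common_radius R (m + n) (fun j eta => forall x c,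
   nm (x - b j) < eta -> nm (c - a) < eta -> ~ bdd_start c (- e j * x ^+ 2 + c)).
- by move=> j d d' dd' h x c h1 h2; apply: h; exact: lt_le_trans dd'.
- move=> j _; have [d d0 hd] := bdd_open (@other j).
  have d2 : 0 < d / 2 by lra.
  have [r r0 hr] := contM (cont_id (b j)) (cont_id (b j)) d2.
  exists (Num.min r (d / 2)); first by rewrite lt_min r0.
  move=> x c; rewrite !lt_min => /andP[/hr h1 _] /andP[_ h2]; apply: hd; first lra.
  have -> : - e j * x ^+ 2 + c - (- e j * b j ^+ 2 + a) =
    - e j * (x * x - b j * b j) + (c - a) by ring.
  apply: le_lt_trans (nmD _ _) _; rewrite nmM nmN (nm_sign (se j)) mul1r; lra.
exists eta => // j x c; have [i hi [-> ->]] := b_reduce j; exact: heta.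
Qed.

End CriticalOrbit.

(** * Recurrence away from the postcritical set, and a target point off it *)

Section Density.
Variable R : realType.
Implicit Types (c x y z w : R[i]).
Variables (a : R[i]) (b e : nat -> R[i]) (m n : nat).
Hypothesis H : critical_orbit a b e m n.
Let se := co_signs H.
Let b0 := co_start H.
Let bS := co_step H.
Let bK := co_bdd H.
Let bn0 := co_neq0 H.
Let other := co_other H.
Let n0 := co_period_gt0 H.
Let per := co_periodic H.

Definition reaches w := exists2 f, signs f & exists N, orb f a w N = b m.

Lemma reaches_step s w : s ^+ 2 = 1 -> reaches (s * w ^+ 2 + a) -> reaches w.
Proof.
move=> s2 [f sf [N hN]]; exists (fun k => if k is l.+1 then f l else s); first by case.
by exists N.+1; rewrite orb_cons.
Qed.

Lemma reaches_orb f w j : signs f -> reaches (orb f a w j) -> reaches w.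
Proof. by move=> sf; elim: j => [//|j IH] /= h; apply: IH; exact: reaches_step h. Qed.

Lemma reaches_b j : reaches (b j).
Proof.
exists (fun l => e (j + l)%N) => [k|]; first exact: se.
exists (m + j * n - j)%N; rewrite (orb_b H) subnKC; last first.
  by apply: leq_trans (leq_addl _ _); exact: leq_pmulr.
by have [h _] := b_periodic H 0 j; rewrite !addn0 in h.
Qed.

Variable P : seq R[i].
Hypothesis aP : a \in P.
Hypothesis Pinv : forall s z, s ^+ 2 = 1 -> z \in P ->
  nm (s * z ^+ 2 + a) <= nm a + 2 -> s * z ^+ 2 + a \in P.
Hypothesis PK : forall z, z \in P -> bdd_start a z -> exists j, z = b j.

(* The orbits near the critical orbit that stay bounded must follow the same signs,
   and the cycle is repelling, so they are eventually driven away from [P]. *)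
Lemma good_times f w : signs f -> (forall j, nm (orb f a w j) <= nm a + 2) ->
  ~ reaches w -> exists2 eta : R, 0 < eta &
    forall J, exists2 j, (J <= j)%N & forall q, q \in P -> eta <= nm (orb f a w j - q).
Proof.
move=> sf hw nr_w; set y := orb f a w.
have yK j : bdd_start a (y j).
  by exists (fun k => f (j + k)%N) => [k|k]; [exact: sf|rewrite -orbD].
have yb j i : y j <> b i.
  by move=> h; apply: nr_w; apply: (@reaches_orb f w j sf); rewrite -/y h; exact: reaches_b.
have [eta1 eta10 heta1] := other_open H.
have [eta2 eta20 heta2] : exists2 eta2 : R, 0 < eta2 & forall q x, q \in P ->
    ~ bdd_start a q -> nm (x - q) < eta2 -> ~ bdd_start a x.
  elim: (P) => [|q Q [d d0 hd]]; first by exists 1.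
  have [hq|hq] := EM (bdd_start a q).
    by exists d => // q' x; rewrite inE => /orP[/eqP -> //|]; exact: hd.
  have [d' d'0 hd'] := bdd_open_start hq; exists (Num.min d d'); first by rewrite lt_min d0.
  move=> q' x; rewrite inE lt_min => /orP[/eqP ->|q'Q] hq' /andP[h1 h2]; first exact: hd'.
  exact: hd h1.
have [sep sep0 hsep] : exists2 sep : R, 0 < sep & forall i j, nm (b i - b j) < sep -> b i = b j.
  have [||sep sep0 hsep] := @common_radius R (m + n) (fun j sep =>
     forall i, nm (b i - b j) < sep -> b i = b j).
  - by move=> j d d' dd' h i hi; apply: h; exact: lt_le_trans dd'.
  - move=> j _; have [s s0 hs] := isolated_seq [seq b k | k <- iota 0 (m + n)] (b j).
    exists s => // i hi; apply: hs; first exact: ltW.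
    have [k hk [-> _]] := b_reduce H i.
    by apply/mapP; exists k => //; rewrite mem_iota.
  exists sep => // i j; have [k hk [-> _]] := b_reduce H j; exact: hsep.
have lam1 := multiplier_gt1 H; set Lam := nm (multiplier b e m n) in lam1.
(* An admissible loss per step: by Bernoulli [th^n >= (1 + 1 / Lam) / 2], so a full return still
   expands by at least [(Lam + 1) / 2]. *)
pose th : R := 1 - (1 - Lam^-1) / (2 * n%:R).
have n1 : 1 <= n%:R :> R by rewrite ler1n.
have li : 0 < Lam^-1 < 1 by rewrite invr_gt0 invf_lt1 //; lra.
case/andP: li => li0 li1.
have th01 : 0 < th < 1.
  have : 0 < (1 - Lam^-1) / (2 * n%:R) by rewrite divr_gt0 //; lra.
  have : (1 - Lam^-1) / (2 * n%:R) < 1 by rewrite ltr_pdivrMr; lra.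
  by rewrite /th => *; apply/andP; split; lra.
case/andP: th01 => th0 th1.
have thn : 1 < th ^+ n * Lam.
  have bern k : 1 - k%:R * (1 - th) <= th ^+ k.
    elim: k => [|k IH]; first by rewrite mul0r subr0 expr0.
    rewrite exprS -natr1; have k0 : 0 <= k%:R :> R by exact: ler0n.
    have := ler_wpM2l (ltW th0) IH; have := mulr_ge0 k0 (sqr_ge0 (1 - th)); nra.
  have := bern n; have -> : n%:R * (1 - th) = (1 - Lam^-1) / 2.
    by rewrite /th; field; rewrite !gt_eqF //; lra.
  move=> h; have L0 : 0 < Lam by lra.
  have := ler_wpM2r (ltW L0) h; have : Lam^-1 * Lam = 1 by rewrite mulVf // gt_eqF.
  nra.
have [eta3 eta30 heta3] : exists2 eta3 : R, 0 < eta3 & forall j d, nm d < eta3 ->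
    2 * nm (b j) * th <= nm (2 * b j + d).
  have [||d d0 hd] := @common_radius R (m + n) (fun j (r : R) => forall d, nm d < r ->
      2 * nm (b j) * th <= nm (2 * b j + d)).
  - by move=> j d d' dd' h x hx; apply: h; exact: lt_le_trans dd'.
  - move=> j _; exists (2 * nm (b j) * (1 - th)).
      by rewrite !mulr_gt0 ?nm_gt0 //; lra.
    move=> d hd; have := nm_subl (2 * b j) (- d); rewrite opprK nmN nmM nm_nat; lra.
  by exists d => // j x; have [k hk [-> _]] := b_reduce H j; exact: hd.
pose C : R := 2 * (nm a + 2).
have C0 : 0 < C by rewrite /C; have := nm_ge0 a; lra.
(* Within [eta] the wrong branch escapes ([eta1]), points near an escaping point of [P] escape
   ([eta2]), a step expands by at least [2 |b j| th] ([eta3]), and the shadowing point of the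
   critical orbit advances to its successor (last term). *)
pose eta := Num.min (Num.min eta1 eta2) (Num.min eta3 (sep / (C + 2))).
have eta0 : 0 < eta by rewrite !lt_min eta10 eta20 eta30 divr_gt0 //; lra.
have [e1 e2 e3 e4] : [/\ eta <= eta1, eta <= eta2, eta <= eta3 & eta * (C + 2) <= sep].
  rewrite -ler_pdivlMr; last lra.
  by split; rewrite /eta !ge_min lexx ?orbT.
exists eta => // J; apply: contrapT => nJ.
have near j : (J <= j)%N -> exists i, nm (y j - b i) < eta.
  move=> hj; apply: contrapT => hi; apply: nJ; exists j => // q qP.
  rewrite leNgt; apply/negP => hq; apply: hi.
  have [qK|qK] := EM (bdd_start a q).
    by have [i qi] := PK qP qK; exists i; rewrite -qi.
  by case: (heta2 q (y j) qP qK (lt_le_trans hq e2)).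
have follow j i : nm (y j - b i) < eta -> f j = e i /\
    y j.+1 - b i.+1 = e i * ((y j - b i) * (2 * b i + (y j - b i))).
  move=> hj; have fe : f j = e i.
    apply: contrapT => /(sign_eq (sf j) (se i)) h.
    apply: (heta1 i (y j) a); first exact: lt_le_trans e1.
      by rewrite subrr nm0.
    by rewrite -h; exact: yK j.+1.
  split => //; have -> : y j.+1 = f j * y j ^+ 2 + a by [].
  by rewrite bS fe; ring.
have [i hi] := near J (leqnn J).
have track k : nm (y (J + k)%N - b (i + k)%N) < eta.
  elim: k => [|k IH]; first by rewrite !addn0.
  have [_ h] := follow _ _ IH; rewrite !addnS.
  have [i' hi'] := near (J + k).+1 (leq_trans (leq_addr k J) (leqnSn _)).
  suff <- : b i' = b (i + k).+1 by [].
  apply: hsep; apply: le_lt_trans (nm_tri (y (J + k).+1) _ _) _.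
  rewrite nm_sym h; have hb x : bdd_start a x -> nm x <= nm a + 2 by move=> /bdd_nm; lra.
  have h2 : nm (2 * b (i + k)%N + (y (J + k)%N - b (i + k)%N)) <= C.
    have -> : 2 * b (i + k)%N + (y (J + k)%N - b (i + k)%N) = b (i + k)%N + y (J + k)%N by ring.
    apply: le_trans (nmD _ _) _; rewrite /C.
    by have := hb _ (bK (i + k)%N); have := hb _ (yK (J + k)%N); lra.
  rewrite !nmM (nm_sign (se _)) mul1r.
  have := ler_pM (nm_ge0 _) (nm_ge0 _) (ltW IH) h2; nra.
(* After [k0] further steps the shadow has index [m + i n], that is, it is at [b m], from where
   whole periods are counted. *)
pose k0 := (m + i * n - i)%N.
have ik0 : (i + k0 = m + i * n)%N.
  rewrite /k0 subnKC //; apply: leq_trans (leq_addl _ _); exact: leq_pmulr.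
pose d k := nm (y (J + k0 + k)%N - b (m + i * n + k)%N).
have dk k : d k < eta by rewrite /d -ik0 -!addnA; exact: track.
have d00 : 0 < d 0%N.
  by rewrite /d nm_gt0 subr_eq0; apply/eqP; exact: yb.
pose G k := \prod_(0 <= l < k) (2 * nm (b (m + l)%N) * th).
have G0 k : 0 <= G k.
  by apply: prodr_ge0 => l _; rewrite !mulr_ge0 ?nm_ge0 // ltW.
have bper k : b (m + i * n + k)%N = b (m + k)%N.
  by have [h _] := b_periodic H k i; rewrite addnAC.
have grow k : d 0%N * G k <= d k.
  elim: k => [|k IH]; first by rewrite /G big_geq // mulr1.
  rewrite /G big_nat_recr //= -/(G k) mulrA {2}/d !addnS.
  have hd := dk k; rewrite {1}/d in hd.
  have [_ ->] := follow _ _ hd.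
  rewrite !nmM (nm_sign (se _)) mul1r -/(d k).
  apply: ler_pM => //; first by rewrite mulr_ge0 ?G0 // ltW.
    by rewrite !mulr_ge0 ?nm_ge0 // ltW.
  by rewrite -bper; apply: heta3; exact: lt_le_trans e3.
have Gk k : G (k * n)%N = (th ^+ n * Lam) ^+ k.
  elim: k => [|k IH]; first by rewrite mul0n /G big_geq.
  rewrite /G mulSnr (big_cat_nat (n := (k * n)%N)) ?leq_addr //= -/(G _) IH exprSr.
  congr (_ * _); rewrite -{1}[(k * n)%N]add0n big_addn addKn /Lam /multiplier nm_prod.
  rewrite (_ : th ^+ n = \prod_(0 <= l < n) th); last by rewrite prodr_const_nat subn0.
  rewrite -big_split /=; apply: eq_bigr => l _.
  have [h _] := b_periodic H l k.
  by rewrite addnA h !nmM nm_nat (nm_sign (se _)) mulr1 mulrC.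
have [k hk] := pow_unbounded (eta / d 0%N) thn.
have := grow (k * n)%N; rewrite Gk => h1.
move: hk; rewrite ltr_pdivrMr // => h2.
by have := dk (k * n)%N; lra.
Qed.

(** With [p = b m], both [- p] and [i p] have [b m.+1] as an image. If both were in [P], they would
    lie on the critical orbit before time [m]; after the earlier one the orbit is on the cycle, so
    the later one would be [p]. The point [u] serves as the target of the moved backward orbits. *)
Lemma preimage_off_postcritical : exists2 u, u \notin P & reaches u /\ nm u <= nm a + 3 / 2.
Proof.
pose p := b m.
have pn0 : p != 0 := bn0 m.
have bdet i j : b i = b j -> b i.+1 = b j.+1 by move=> /(b_next H)[].
have cyc i : (m <= i)%N -> b i.+1 = b m.+1 -> b i = p.
  move=> hi h; have [h1 _] := b_shift H n.-1 h.
  rewrite !addSn -!addnS (prednK n0) in h1.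
  have p1 := per 0; have p2 := per (i - m)%N.
  by rewrite !addn0 in p1; rewrite subnKC // in p2; rewrite -p2 h1 p1.
have suc u i : u ^+ 2 = p ^+ 2 \/ u ^+ 2 = - p ^+ 2 -> b i = u -> b i.+1 = b m.+1.
  move=> hu hi; have hi' := bK i.+1.
  suff : e i * u ^+ 2 = e m * p ^+ 2 by rewrite !bS hi => ->.
  have [h|h] := EM (e i * u ^+ 2 = e m * p ^+ 2) => //; exfalso.
  apply: (@other m); rewrite -/p; suff <- : e i * u ^+ 2 = - e m * p ^+ 2 by rewrite -hi -bS.
  by case: hu h => ->; case: (signE (se i)) => ->; case: (signE (se m)) => ->;
    rewrite ?mulN1r ?mul1r ?opprK ?mulrN ?mul1r // => h; case: h.
pose u1 := - p; pose u2 := Complex 0 1 * p.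
have i2 : (Complex 0 1 : R[i]) ^+ 2 = -1 by rewrite sqr_i.
have u1E : u1 ^+ 2 = p ^+ 2 by rewrite sqrrN.
have u2E : u2 ^+ 2 = - p ^+ 2 by rewrite exprMn i2 mulN1r.
have u1p : u1 != p.
  apply/eqP => h; move/eqP: pn0; apply.
  have : 2 * p = 0 by rewrite mulr_natl mulr2n -{1}h /u1 addNr.
  by move/eqP; rewrite mulf_eq0 pnatr_eq0 => /eqP.
have p2 : p ^+ 2 != - p ^+ 2.
  by rewrite -subr_eq0 opprK -mulr2n mulrn_eq0 expf_eq0.
have u2p : u2 != p by apply: contraNneq p2 => h; rewrite -u2E h.
have u12 : u1 != u2 by apply: contraNneq p2 => h; rewrite -u2E -h u1E.
have ok u : u ^+ 2 = p ^+ 2 \/ u ^+ 2 = - p ^+ 2 -> reaches u /\ bdd_start a u.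
  move=> hu; have [s s2 hs] : exists2 s : R[i], s ^+ 2 = 1 & s * u ^+ 2 + a = b m.+1.
    rewrite bS -/p; case: hu => ->; first by exists (e m).
    by exists (- e m); rewrite ?sqrrN // mulrNN.
  split; first by apply: (reaches_step s2); rewrite hs; exact: reaches_b.
  by apply/bdd_step; exists s; rewrite ?hs.
have [r1 k1] := ok _ (or_introl u1E); have [r2 k2] := ok _ (or_intror u2E).
have [h1|h1] := boolP (u1 \in P); last by exists u1; rewrite ?bdd_nm.
have [h2|h2] := boolP (u2 \in P); last by exists u2; rewrite ?bdd_nm.
exfalso; have [i1 hi1] := PK h1 k1; have [j2 hj2] := PK h2 k2.
have s1 := suc u1 i1 (or_introl u1E) (esym hi1).
have s2 := suc u2 j2 (or_intror u2E) (esym hj2).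
have lt1 : (i1 < m)%N.
  by rewrite ltnNge; apply/negP => hi; case/eqP: u1p; rewrite hi1; exact: cyc.
have lt2 : (j2 < m)%N.
  by rewrite ltnNge; apply/negP => hi; case/eqP: u2p; rewrite hj2; exact: cyc.
have key i j : (i < j)%N -> (j < m)%N -> b i.+1 = b m.+1 -> b j.+1 = b m.+1 -> b j = p.
  move=> ij jm hi hj.
  have hp : b (i.+1 + (j - i.+1))%N = b (m.+1 + (j - i.+1))%N.
    by have [h _] := b_shift H (j - i.+1) (etrans hi (erefl _)).
  rewrite subnKC // in hp; rewrite hp; apply: cyc; first by rewrite addSn leqW // leq_addr.
  by rewrite -hj; apply/esym; exact: bdet.
case: (ltngtP i1 j2) => hij.
- by case/eqP: u2p; rewrite hj2; exact: key hij lt2 s1 s2.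
- by case/eqP: u1p; rewrite hi1; exact: key hij lt1 s2 s1.
- by case/eqP: u12; rewrite hi1 hj2 hij.
Qed.

End Density.

(** * Lifting discs off the postcritical set and moving end points of backward orbits *)

Section Contraction.
Variable R : realType.
Implicit Types (c x y z w : R[i]).
Variables (a : R[i]) (P : seq R[i]).
Hypothesis aP : a \in P.
Hypothesis Pinv : forall s z, s ^+ 2 = 1 -> z \in P ->
  nm (s * z ^+ 2 + a) <= nm a + 2 -> s * z ^+ 2 + a \in P.

(** The lifted discs avoid [P], hence the critical value, so square roots exist. The modulus of the
    derivative times the product of the [2 |h k z|] is exactly [s], and [expansion] along the orbit
    of [h i z] turns this into the bound. The radius [2 s] lets a disc of radius [s] fit about every
    [h N z]. *)
Lemma disc_lift (N : nat) (f Y : nat -> R[i]) (s : R) : signs f -> 0 < s ->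
  (forall i, (i < N)%N -> Y i.+1 = f i * Y i ^+ 2 + a) ->
  (forall w, nm (w - Y N) <= 2 * s -> nm w <= nm a + 2 /\ w \notin P) ->
  exists h : nat -> R[i] -> R[i],
  [/\ forall i, (i <= N)%N -> h i 0 = Y i,
      forall z, h N z = Y N + s%:C%C * z,
      forall i z, (i < N)%N -> nm z <= 1 -> h i.+1 z = f i * h i z ^+ 2 + a &
      forall i z, (i <= N)%N -> nm z <= 1 -> exists2 d, hasder (h i) z d &
        nm d * \prod_(i <= k < N) growth a P (h k z) <= 2 * (nm a + 2)].
Proof.
move=> sf s0 hY tube.
have [h [h1 h2 h3]] : exists h : nat -> R[i] -> R[i], [/\
    forall i, (i <= N)%N -> [/\ h i 0 = Y i, forall z, nm z <= 1 -> taylor 2 (h i) z,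
      forall z, nm z <= 1 -> nm (h i z) <= nm a + 2 /\ h i z \notin P &
      forall z, nm z <= 1 -> exists2 d, hasder (h i) z d &
        nm d * \prod_(i <= k < N) (2 * nm (h k z)) = s],
    forall z, h N z = Y N + s%:C%C * z &
    forall i z, (i < N)%N -> nm z <= 1 -> h i.+1 z = f i * h i z ^+ 2 + a].
  suff key j : (j <= N)%N -> exists h : nat -> R[i] -> R[i], [/\
    forall i, (N - j <= i <= N)%N ->
      [/\ h i 0 = Y i, forall z, nm z <= 1 -> taylor 2 (h i) z,
      forall z, nm z <= 1 -> nm (h i z) <= nm a + 2 /\ h i z \notin P &
      forall z, nm z <= 1 -> exists2 d, hasder (h i) z d &
        nm d * \prod_(i <= k < N) (2 * nm (h k z)) = s],
    forall z, h N z = Y N + s%:C%C * z &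
    forall i z, (N - j <= i < N)%N -> nm z <= 1 -> h i.+1 z = f i * h i z ^+ 2 + a].
    have [h [h1 h2 h3]] := key N (leqnn _); exists h; split => //.
      by move=> i hi; apply: h1; rewrite subnn.
    by move=> i z hi; apply: h3; rewrite subnn.
  elim: j => [|j IH] hj.
    exists (fun _ z => Y N + s%:C%C * z); split => //; last first.
      by move=> i z; rewrite subn0 => /andP[h1 h2]; move: (leq_ltn_trans h1 h2); rewrite ltnn.
    move=> i; rewrite subn0 -eqn_leq => /eqP <-; split.
    - by rewrite mulr0 addr0.
    - move=> z _; apply: taylorD; first exact: taylor_cst.
      by apply: taylorM; [exact: taylor_cst|exact: taylor_id].
    - move=> z z1; apply: tube; rewrite addrC addKr nmM nm_real gtr0_norm //.
      by have := ler_wpM2l (ltW s0) z1; lra.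
    - move=> z z1; exists s%:C%C; first exact: hasder_affine.
      by rewrite big_geq // mulr1 nm_real gtr0_norm.
  have [h [h1 h2 h3]] := IH (ltnW hj); set i0 := (N - j.+1)%N.
  have i0N : (i0 < N)%N by rewrite /i0 ltn_subLR // addSn ltnS leq_addl.
  have Ei : (N - j)%N = i0.+1 by rewrite /i0 subnSK.
  have hr : (N - j <= i0.+1 <= N)%N by rewrite Ei leqnn.
  have [hY0 ht hb hd] := h1 _ hr.
  have ff : f i0 * f i0 = 1 by rewrite -expr2.
  have fn0 : f i0 != 0.
    by apply/eqP => f0; have := sf i0; rewrite f0 expr0n => /esym/eqP; rewrite oner_eq0.
  have fi0 z : nm z <= 1 -> f i0 * (h i0.+1 z - a) != 0.
    move=> z1; rewrite mulf_neq0 // subr_eq0; apply/eqP => ha.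
    by have [_] := hb z z1; rewrite ha aP.
  have [|||g [tg g0 sq]] := @sqrt_lift R 2 (fun z => f i0 * (h i0.+1 z - a)) (Y i0).
  - move=> z z1; apply: taylorM; first exact: taylor_cst.
    by apply: taylorD; [exact: ht|exact: taylor_cst].
  - by [].
  - by rewrite hY0 hY // addrK mulrA ff mul1r.
  have hg z : nm z <= 1 -> h i0.+1 z = f i0 * g z ^+ 2 + a.
    by move=> z1; rewrite (nr_self (sq z z1)) mulrA ff; ring.
  have gb z : nm z <= 1 -> nm (g z) <= nm a + 2 /\ g z \notin P.
    move=> z1; have [hb1 hb2] := hb z z1; rewrite hg // in hb1 hb2; split.
      rewrite leNgt; apply/negP => hz.
      by have := escape (sf i0) hz; have := nm_ge0 a; lra.
    by apply: contra hb2 => gP; exact: Pinv.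
  pose h' i := if i == i0 then g else h i.
  have h'E i : i != i0 -> h' i = h i by rewrite /h' => /negbTE ->.
  have h'0 : h' i0 = g by rewrite /h' eqxx.
  have prodE i z : (i0 < i)%N ->
      \prod_(i <= k < N) (2 * nm (h' k z)) = \prod_(i <= k < N) (2 * nm (h k z)).
    move=> hi; apply: eq_big_nat => k /andP[hk _].
    by rewrite h'E // gtn_eqF // (leq_trans hi).
  exists h'; split.
  - move=> i; rewrite leq_eqVlt => /andP[/orP[/eqP <-|hi] iN].
      rewrite h'0; split => // z z1.
      have [d hd1 hd2] := hd z z1.
      exists (f i0 * d / (2 * g z)).
        apply: (@hasder_sqrt _ (fun z => f i0 * (h i0.+1 z - a))).
        + exact: taylor_cont (tg z z1).
        + exact: sq.
        + exact: fi0.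
        + apply: hasder_near (hasder_comp hd1 (hasder_affine (f i0) (- (f i0 * a)) _)).
          by apply: nr_all => w; ring.
      rewrite big_ltn // h'0 prodE // nm_div !nmM nm_nat (nm_sign (sf i0)) mul1r.
      have g0' : g z != 0.
        by have := fi0 z z1; rewrite -(nr_self (sq z z1)) expf_eq0.
      by rewrite mulrA mulfVK ?mulf_neq0 ?nm_eq0 ?pnatr_eq0.
    have hi' : (N - j <= i <= N)%N by rewrite Ei hi iN.
    rewrite h'E ?gtn_eqF //; have [a1 a2 a3 a4] := h1 i hi'; split => // z z1.
    by have [d d1 d2] := a4 z z1; exists d => //; rewrite prodE.
  - by move=> z; rewrite h'E // gtn_eqF.
  - move=> i z; rewrite leq_eqVlt => /andP[/orP[/eqP <-|hi] iN] z1.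
      by rewrite h'0 h'E ?gtn_eqF // hg.
    rewrite !h'E ?gtn_eqF //; last by rewrite ltnW.
    by apply: h3 => //; rewrite Ei hi.
exists h; split => //; first by move=> i /h1[].
move=> i z iN z1; have [_ _ _ hd] := h1 i iN.
have [d d1 d2] := hd z z1; exists d => //.
have := @expansion R a P aP Pinv (N - i) (fun k => h (i + k)%N z) (fun k => f (i + k)%N) s s0.
rewrite subnKC // => /(_ _ _).
have E F : \prod_(0 <= k < N - i) F (i + k)%N = \prod_(i <= k < N) F k :> R.
  by rewrite -[in RHS](add0n i) big_addn; apply: eq_bigr => k _; rewrite addnC.
rewrite (E (fun k => growth a P (h k z) / (2 * nm (h k z)))) big_split /= prodfV -d2 => hx.
have p0 : \prod_(i <= k < N) (2 * nm (h k z)) != 0.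
  by apply/eqP => p0; move: d2; rewrite p0 mulr0 => s00; rewrite -s00 ltxx in s0.
apply: le_trans (hx _ _); last 2 first.
- move=> k hk; have hik : (i + k < N)%N by rewrite -ltn_subRL.
  rewrite addnS; split; [exact: sf|exact: h3|].
  have [_ _ hb _] := h1 _ hik; have [_] := hb z z1.
  by apply: contraNneq => ->.
- move=> w hw; have [] := tube w.
    apply: le_trans (nm_tri (h N z) _ _) _; rewrite h2 [X in _ + nm X]addrC addKr nmM nm_real gtr0_norm //.
    by rewrite h2 in hw; have := ler_wpM2l (ltW s0) z1; lra.
  by move=> ? /negbTE hP; split => //; rewrite hP.
rewrite le_eqVlt; apply/orP; left; apply/eqP.
by rewrite [RHS]mulrA [RHS]mulrAC mulfK.
Qed.

(* Moving the end point of a backward orbit [Y] from [Y N] to [y']: the displacement of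
   the earlier points is damped by each passage of the reference orbit [w] away from [P]. *)
Lemma move_endpoint (N I : nat) (f w Y : nat -> R[i]) (eta s : R) y' : signs f ->
  0 < s -> 0 < eta ->
  (forall i, (i < N)%N -> Y i.+1 = f i * Y i ^+ 2 + a) ->
  (forall x, nm (x - Y N) <= 2 * s -> nm x <= nm a + 2 /\ x \notin P) ->
  let good k := `[< forall q, q \in P -> eta <= nm (w k - q) >] in
  let cnt i := (\sum_(i <= k < N) good k)%N in
  (forall i, (i <= N)%N -> (I <= cnt i)%N -> nm (Y i - w i) <= eta / 4) ->
  nm (y' - Y N) <= s * Num.min 1 (eta / (8 * (nm a + 2))) ->
  exists Y' : nat -> R[i], [/\ forall i, (i < N)%N -> Y' i.+1 = f i * Y' i ^+ 2 + a,
    Y' N = y' &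
    forall i, (i <= N)%N -> nm (Y' i - Y i) <=
      2 * (nm a + 2) / (1 + (4 * (nm a + 2 + 1) * \prod_(q <- P) (nm a + 2 + nm q + 1))^-1
        * Num.min 1 (eta / 2) ^+ size P) ^+ (cnt i - I)].
Proof.
move=> sf s0 eta0 hY tube good cnt hI hy'.
set r := nm a + 2; set tau := (_ * \prod_(q <- P) _)^-1; set g0 := 1 + _.
(* [2 r z0 <= eta / 4] limits the displacement of all lifts even without damping. Where [hI] applies
   they are then within [eta / 2] of [w], so at good times at distance at least [eta / 2] from
   [P]. *)
set z0 := Num.min 1 _ in hy'.
have r0 : 2 <= r by rewrite /r; have := nm_ge0 a; lra.
have [h [h0 hN hS hd]] := disc_lift sf s0 hY tube.
pose z1 := (y' - Y N) / s%:C%C.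
have sn0 : s%:C%C != 0 :> R[i] by rewrite -nm_gt0 nm_real normr_gt0 gt_eqF.
have nz1 : nm z1 <= z0.
  by rewrite nm_div nm_real gtr0_norm // ler_pdivrMr // mulrC.
have z01 : z0 <= 1 by rewrite ge_min lexx.
have z0e : z0 * (8 * r) <= eta.
  rewrite -ler_pdivlMr; last lra.
  by rewrite ge_min lexx orbT.
have prod1 i z : 1 <= \prod_(i <= k < N) growth a P (h k z).
  elim/big_ind: _ => // [u v hu hv|k _]; first by rewrite mulr_ege1.
  exact: growth_ge1.
have weak i z : (i <= N)%N -> nm z <= z0 -> nm (h i z - Y i) <= eta / 4.
  move=> iN zz; rewrite -h0 //.
  apply: le_trans (_ : 2 * r * nm z <= _); last by nra.
  apply: mean_value => [|t /andP[t0 t1]]; first lra.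
  have tz : nm (t%:C%C * z) <= 1.
    by rewrite nmM nm_real ger0_norm //; have := nm_ge0 z; nra.
  have [d d1 d2] := hd i _ iN tz; exists d => //.
  by apply: le_trans d2; apply: ler_peMr; [exact: nm_ge0|exact: prod1].
(* Every factor of [apart y] is at least [mu = min 1 (eta / 2)]; as [mu <= 1], the exponent [size P]
   allows for omitted factors. *)
have g0E y : (forall q, q \in P -> eta / 2 <= nm (y - q)) -> g0 <= growth a P y.
  move=> hy; rewrite /g0 /growth lerD2l; apply: ler_wpM2l.
    by rewrite ltW // (tau_gt0 a P).
  rewrite /apart; set mu := Num.min 1 (eta / 2).
  have mu0 : 0 <= mu by rewrite le_min ler01; lra.
  have mu1 : mu <= 1 by rewrite ge_min lexx.
  elim: (P) hy => [|q Q IH] hy; first by rewrite big_nil.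
  have hQ : mu ^+ size Q <= \prod_(j <- Q | j != y) nm (y - j).
    by apply: IH => q' hq'; apply: hy; rewrite inE hq' orbT.
  rewrite big_cons /= exprS; case: ifP => _.
    apply: ler_pM => //; first exact: exprn_ge0.
    by apply: le_trans (hy q (mem_head _ _)); rewrite ge_min lexx orbT.
  by apply: le_trans hQ; apply: ler_piMl => //; exact: exprn_ge0.
have g01 : 1 <= g0.
  rewrite /g0 lerDl mulr_ge0 //; first by rewrite ltW // (tau_gt0 a P).
  by apply: exprn_ge0; rewrite le_min ler01; lra.
have prodg i z : (i <= N)%N -> nm z <= z0 ->
    g0 ^+ (cnt i - I) <= \prod_(i <= k < N) growth a P (h k z).
  move=> iN0 zz; suff key j : (j <= N)%N ->
      g0 ^+ (cnt (N - j)%N - I) <= \prod_((N - j)%N <= k < N) growth a P (h k z).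
    by have := key _ (leq_subr i N); rewrite subKn.
  move=> {i iN0}; elim: j => [|j IH] jN.
    by rewrite subn0 /cnt !big_geq.
  set i := (N - j.+1)%N.
  have iN : (i < N)%N by rewrite /i ltn_subLR // addSn ltnS leq_addl.
  have Ei : (N - j)%N = i.+1 by rewrite /i subnSK.
  have := IH (ltnW jN); rewrite Ei => {}IH.
  rewrite (big_ltn iN); have cE : cnt i = (good i + cnt i.+1)%N by rewrite /cnt big_ltn.
  have [hI'|hI'] := leqP (cnt i) I.
    rewrite (eqP hI') expr0.
    by apply: mulr_ege1; [exact: growth_ge1|exact: prod1].
  have [gi|gi] := boolP (good i); last first.
    rewrite cE (negbTE gi) add0n; apply: le_trans IH _; apply: ler_peMl.
      by have := prod1 i.+1 z; lra.
    exact: growth_ge1.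
  rewrite cE gi add1n subSn; last by move: hI'; rewrite cE gi add1n ltnS.
  rewrite exprS; apply: ler_pM => //; first lra.
    by apply: exprn_ge0; lra.
  apply: g0E => q qP; move/asboolP: (gi) => /(_ q qP) hq.
  have c1 := hI i (ltnW iN) (ltnW hI'); have c2 := weak i z (ltnW iN) zz.
  have := nm_tri (Y i) (w i) (h i z); have := nm_tri (h i z) (w i) q.
  by rewrite (nm_sym (w i) (Y i)) (nm_sym (Y i) (h i z)); lra.
exists (fun i => h i z1); split.
- by move=> i iN; apply: hS => //; lra.
- by rewrite hN /z1 mulrC divfK // addrC subrK.
- move=> i iN; rewrite -h0 //.
  set M := 2 * r / _.
  have gp : 0 < g0 ^+ (cnt i - I) by apply: exprn_gt0; lra.
  have M0 : 0 <= M by rewrite /M divr_ge0 ?ltW //; lra.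
  apply: le_trans (_ : M * nm z1 <= _); last by apply: ler_piMr => //; lra.
  apply: mean_value => // t /andP[t0 t1].
  have tz : nm (t%:C%C * z1) <= z0.
    by rewrite nmM nm_real ger0_norm //; have := nm_ge0 z1; nra.
  have [d d1 d2] := hd i _ iN (le_trans tz z01); exists d => //.
  rewrite /M ler_pdivlMr //; apply: le_trans d2.
  by apply: ler_wpM2l; [exact: nm_ge0|exact: prodg].
Qed.

End Contraction.

(** * Density of the preimages of the cycle in the filled Julia set *)

Section Dense.
Variable R : realType.
Implicit Types (c x y z w : R[i]).
Variables (a : R[i]) (b e : nat -> R[i]) (m n : nat).
Hypothesis H : critical_orbit a b e m n.

Lemma cluster_point (y : nat -> R[i]) (M : R) (G : nat -> Prop) :
  (forall j, nm (y j) <= M) -> (forall J, exists2 j, (J <= j)%N & G j) ->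
  exists x, forall d : R, 0 < d -> forall J, exists2 j, (J <= j)%N & G j /\ nm (y j - x) < d.
Proof.
move=> hM hG; apply: contrapT => /forallNP nx.
have [N hN] : exists N, forall k x, (N <= k)%N -> nm x <= M ->
    (forall j, (k <= j)%N -> G j -> y j <> x).
  apply: (@disc_cover R M (fun k x => forall j, (k <= j)%N -> G j -> y j <> x)) => x _.
  have := nx x => /existsNP[d /not_implyP[d0 /existsNP[J hJ]]].
  exists d => //; exists J => k x' hk hx' j kj Gj yx; apply: hJ; exists j.
    exact: leq_trans kj.
  by rewrite yx.
have [j Nj Gj] := hG N.
exact: (hN N (y j) (leqnn _) (hM j) j Nj Gj).
Qed.

(** At good times the orbit of [w] accumulates at some [x] off [P]. The end point of a long piece of
    the orbit is moved to [x], then along an arc off [P] to a point [u] that reaches the cycle;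
    pulled back with the same signs, this displaces the starting point only a little. *)
Lemma reaches_dense w (eps : R) : bdd_start a w -> 0 < eps ->
  exists2 w', reaches a b m w' & nm (w' - w) < eps.
Proof.
move=> wK eps0; have [hr|hr] := EM (reaches a b m w).
  by exists w => //; rewrite subrr nm0.
have [P [aP Pinv PK]] := postcritical_set H.
have [f sf hf] := wK; set y := orb f a w in hf.
have [eta eta0 hgood] := good_times H PK sf hf hr; rewrite -/y in hgood.
pose G j := forall q, q \in P -> eta <= nm (y j - q).
have yb j : nm (y j) <= nm a + 3 / 2.
  apply: bdd_nm; exists (fun k => f (j + k)%N) => [k|k]; first exact: sf.
  by rewrite -orbD.
have [x hx] := @cluster_point y _ G yb hgood.
have xb : nm x <= nm a + 3 / 2.
  rewrite leNgt; apply/negP => lt.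
  have [|j _ [_ hj]] := hx (nm x - (nm a + 3 / 2)) _ 0%N; first lra.
  by have := nm_subl x (y j); rewrite nm_sym; have := yb j; lra.
have xP : x \notin P.
  by apply/negP => xP; have [j _ [/(_ x xP) h1 h2]] := hx eta eta0 0%N; lra.
have [u uP [ru ub]] := preimage_off_postcritical H PK.
have rr : nm a + 3 / 2 < nm a + 2 by lra.
have [g [s0 [L [s00 g0 g1 tube [L0 gL]]]]] := avoiding_arc xP uP xb ub rr.
pose s := s0 / 2; have s_gt0 : 0 < s by rewrite /s; lra.
pose step := s * Num.min 1 (eta / (8 * (nm a + 2))).
have step0 : 0 < step.
  rewrite mulr_gt0 // lt_min ltr01 divr_gt0 // mulr_gt0 //.
  by have := nm_ge0 a; lra.
have step1 : step <= s.
  by apply: ler_piMr; [exact: ltW|rewrite ge_min lexx].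
pose good k := `[< G k >].
pose cnt N i := (\sum_(i <= k < N) good k)%N.
(* The end point [y N] can be moved to [z] at a cost of at most [d] at every time followed by at
   least [I] good times before [N]. As [I] is independent of [N], the finitely many steps along the
   arc can be made before [N] is chosen. *)
pose Q z := forall d : R, 0 < d -> exists I, forall N, G N -> nm (y N - x) < step ->
  exists Y : nat -> R[i], [/\ forall i, (i < N)%N -> Y i.+1 = f i * Y i ^+ 2 + a,
    Y N = z & forall i, (i <= N)%N -> (I <= cnt N i)%N -> nm (Y i - y i) <= d].
set gam := 1 + (4 * (nm a + 2 + 1) * \prod_(q <- P) (nm a + 2 + nm q + 1))^-1
        * Num.min 1 (eta / 2) ^+ size P.
have gam1 : 1 < gam.
  rewrite /gam ltrDl mulr_gt0 //; first exact: (tau_gt0 a P).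
  by rewrite exprn_gt0 // lt_min ltr01; lra.
have damp d : 0 < d -> exists J, forall I k, (I + J <= k)%N ->
    2 * (nm a + 2) / gam ^+ (k - I) <= d.
  move=> d0; have [J hJ] := pow_unbounded (2 * (nm a + 2) / d) gam1; exists J => I k hk.
  have gk : gam ^+ J <= gam ^+ (k - I).
    by apply: ler_weXn2l; [exact: ltW|rewrite leq_subRL // (leq_trans (leq_addr _ _) hk)].
  rewrite ler_pdivrMr ?exprn_gt0 //; last lra.
  rewrite [d * _]mulrC -ler_pdivrMr //; exact: le_trans (ltW hJ) gk.
have Qx : Q x.
  move=> d d0; have [J hJ] := damp d d0; exists J => N GN hN.
  have [||||Y [Y1 Y2 Y3]] := @move_endpoint R a P aP Pinv N 0 f y y eta s x sf s_gt0 eta0.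
  - by [].
  - move=> v hv; rewrite -g0 in hN; apply: (tube 0) => //; first by rewrite lexx ler01.
    apply: le_trans (nm_tri (y N) _ _) _; move: hv; rewrite /s in step1 *; lra.
  - by move=> i _ _; rewrite subrr nm0; lra.
  - by rewrite nm_sym; exact: ltW.
  exists Y; split => // i iN hi; apply: le_trans (Y3 i iN) _.
  exact: hJ.
have Qstep t t' : 0 <= t <= 1 -> 0 <= t' <= 1 -> nm (g t' - g t) <= step -> Q (g t) -> Q (g t').
  move=> ht ht' htt Qt d d0.
  have d1 : 0 < Num.min (d / 2) (eta / 4) by rewrite lt_min !divr_gt0.
  have [I hI] := Qt _ d1.
  have d2 : 0 < d / 2 by lra.
  have [J hJ] := damp _ d2; exists (I + J)%N => N GN hN.
  have [Y [Y1 Y2 Y3]] := hI N GN hN.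
  have [|||Y' [Z1 Z2 Z3]] := @move_endpoint R a P aP Pinv N I f y Y eta s (g t') sf s_gt0 eta0 Y1.
  - move=> v; rewrite Y2 => hv; apply: (tube t) => //; move: hv; rewrite /s; lra.
  - move=> i iN hi; apply: le_trans (Y3 i iN hi) _; by rewrite ge_min lexx orbT.
  - by rewrite Y2.
  exists Y'; split => // i iN hi.
  have hi' : (I <= cnt N i)%N by apply: leq_trans hi; exact: leq_addr.
  apply: le_trans (nm_tri (Y i) _ _) _.
  have h1 := Z3 i iN; have h2 := hJ I (cnt N i) hi; have h3 := Y3 i iN hi'.
  have h4 : Num.min (d / 2) (eta / 4) <= d / 2 by rewrite ge_min lexx.
  have := le_trans h1 h2; lra.
have Qu : Q u.
  have := archi_boundP (_ : 0 <= L / step); rewrite divr_ge0 ?ltW // => /(_ isT).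
  set K := Num.bound _ => hK.
  have K0 : 0 < K%:R :> R.
    by apply: le_lt_trans hK; rewrite divr_ge0 ?ltW.
  have hL : L / K%:R <= step.
    rewrite ler_pdivrMr // mulrC -ler_pdivrMr //; exact: ltW.
  have Qi i : (i <= K)%N -> Q (g (i%:R / K%:R)).
    elim: i => [|i IH] hi; first by rewrite mul0r g0.
    have i01 k : (k <= K)%N -> 0 <= (k%:R / K%:R : R) <= 1.
      by move=> hk; rewrite divr_ge0 //= ler_pdivrMr // mul1r ler_nat.
    apply: (Qstep (i%:R / K%:R)); rewrite ?i01 ?(ltnW hi) //; last exact: IH (ltnW hi).
    apply: le_trans (gL _ _ (i01 _ hi) (i01 _ (ltnW hi))) _.
    rewrite -mulrBl -natr1 [i%:R + 1]addrC addrK mul1r ger0_norm ?invr_ge0 //.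
  have Kn0 : K%:R != 0 :> R by rewrite lt0r_neq0.
  have := Qi K (leqnn K); rewrite (mulfV Kn0) g1; exact.
have e2 : 0 < eps / 2 by lra.
have [I hI] := Qu _ e2.
have [J hJ] : exists J, forall N, (J <= N)%N -> (I <= cnt N 0)%N.
  elim: I {hI} => [|I [J hJ]]; first by exists 0%N.
  have [j Jj Gj] := hgood J; exists j.+1 => N hN.
  rewrite /cnt (big_cat_nat (n := j)) //=; last by rewrite ltnW.
  rewrite (big_ltn hN) (_ : good j = true); last exact/asboolP.
  apply: (@leq_trans (cnt j 0%N + 1)%N); first by rewrite addn1 ltnS hJ.
  by rewrite leq_add2l; exact: leq_addr.
have [N JN [GN hN]] := hx step step0 J.
have [Y [Y1 Y2 Y3]] := hI N GN hN.
exists (Y 0%N).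
  have YO i : (i <= N)%N -> orb f a (Y 0%N) i = Y i.
    by elim: i => [//|i IH] hi /=; rewrite IH ?(ltnW hi) // Y1.
  by apply: (@reaches_orb R a b m f _ N sf); rewrite YO // Y2.
by apply: le_lt_trans (Y3 0%N (leq0n _) (hJ N JN)) _; rewrite ltr_pdivrMr //; lra.
Qed.

End Dense.

(** * Linearization of a repelling fixed point in the presence of a parameter *)

Section Linearization.
Variable R : realType.
Implicit Types (t x y z w : R[i]).
Variables (lam : R[i]) (Phi : R[i] -> R[i] -> R[i]) (C r0 : R).
Hypothesis lam1 : 1 < nm lam.
Hypothesis r00 : 0 < r0.
Hypothesis C0 : 0 <= C.
Hypothesis Phi0 : Phi 0 0 = 0.
Hypothesis HPhi : forall y y' t t', nm y <= r0 -> nm y' <= r0 -> nm t <= r0 -> nm t' <= r0 ->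
  nm (Phi y t - Phi y' t' - lam * (y - y')) <=
    C * (nm y + nm y' + nm t + nm t') * (nm (y - y') + nm (t - t')).

Let L : R := nm lam.

Fixpoint run k y t := if k is j.+1 then Phi (run j y t) t else y.

Lemma runD i j y t : run (i + j) y t = run j (run i y t) t.
Proof. by elim: j => [|j IH]; rewrite ?addn0 // addnS /= IH. Qed.

Lemma run0 k : run k 0 0 = 0.
Proof. by elim: k => [//|k IH] /=; rewrite IH. Qed.

(** Solution of [L C1 + 18 C = L^2 C1], which closes the induction in [run_diff_aux]; 18 is [6 * 3],
    from the bounds [6 L^k s] on the sizes and [3 L^k d] on the differences. *)
Definition lin_const : R := 18 * C / (L ^+ 2 - L).
Definition lin_radius : R := Num.min (r0 / 2) (1 / (lin_const + 1)).
Local Notation C1 := lin_const.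
Local Notation r1 := lin_radius.

Lemma L_gt0 : 0 < L. Proof. by move: lam1; rewrite -/L; lra. Qed.
Lemma LL_gt0 : 0 < L ^+ 2 - L. Proof. by move: lam1; rewrite -/L => h; nra. Qed.
Lemma lin_const_ge0 : 0 <= C1.
Proof. by rewrite /lin_const divr_ge0 ?mulr_ge0 // ltW // LL_gt0. Qed.
Lemma Lk_gt0 k : 0 < L ^+ k. Proof. by apply: exprn_gt0; exact: L_gt0. Qed.
Lemma Lk_ge1 k : 1 <= L ^+ k. Proof. by apply: exprn_ege1; move: lam1; rewrite -/L; lra. Qed.
Lemma Lk_le i k : (i <= k)%N -> L ^+ i <= L ^+ k.
Proof. by apply: ler_weXn2l; move: lam1; rewrite -/L; lra. Qed.

Lemma lin_radius_gt0 : 0 < r1.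
Proof.
by have h := lin_const_ge0; rewrite /lin_radius lt_min !divr_gt0 //; lra.
Qed.
Lemma lin_radius_r0 : 2 * r1 <= r0.
Proof.
have : r1 <= r0 / 2 by rewrite /lin_radius ge_min lexx.
lra.
Qed.
Lemma lin_radius_const : C1 * r1 <= 1.
Proof.
have h : r1 <= 1 / (C1 + 1) by rewrite /lin_radius ge_min lexx orbT.
have h0 := lin_const_ge0; apply: le_trans (ler_wpM2l h0 h) _.
by rewrite mulrA mulr1 ler_pdivrMr; lra.
Qed.

(** Each step contributes an error of order [L^(2k) s d], which outgrows the previous error
    multiplied by [L]. The bounds on the earlier iterates are a hypothesis here because [run_bound]
    obtains them from this very estimate by strong induction. *)
Lemma run_diff_aux k y y' t t' (s : R) : nm y + nm y' + nm t + nm t' <= s ->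
  L ^+ k * s <= r1 ->
  (forall i, (i < k)%N -> nm (run i y t) <= 2 * L ^+ i * s /\
     nm (run i y' t') <= 2 * L ^+ i * s) ->
  nm (run k y t - run k y' t' - lam ^+ k * (y - y')) <=
    C1 * L ^+ (2 * k) * s * (nm (y - y') + nm (t - t')).
Proof.
set d := nm (y - y') + nm (t - t').
have d0 : 0 <= d by rewrite addr_ge0 ?nm_ge0.
move=> hs; have s0 : 0 <= s by apply: le_trans hs; rewrite !addr_ge0 ?nm_ge0.
elim: k => [|k IH] hk hi.
  rewrite /= expr0 mul1r subrr nm0; apply: mulr_ge0 => //; apply: mulr_ge0 => //.
  by apply: mulr_ge0; [exact: lin_const_ge0|exact: ltW (Lk_gt0 _)].
have L0 := L_gt0; have C10 := lin_const_ge0.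
have Lk := Lk_gt0 k; have Lk1 := Lk_ge1 k.
have hk' : L ^+ k * s <= r1.
  apply: le_trans hk; rewrite exprS -mulrA; apply: ler_peMl.
    by rewrite mulr_ge0 // ltW.
  by move: lam1; rewrite -/L; lra.
have {}IH : nm (run k y t - run k y' t' - lam ^+ k * (y - y')) <=
    C1 * L ^+ (2 * k) * s * d.
  by apply: IH => // i ik; apply: hi; rewrite ltnW.
have [b1 b2] := hi k (ltnSn k).
set A := run k y t in IH b1 *; set B := run k y' t' in IH b2 *.
have Lks : 0 <= L ^+ k * s by rewrite mulr_ge0 // ltW.
have sr : s <= r1 by apply: le_trans hk'; apply: ler_peMl.
have nt : nm t <= s by have := nm_ge0 y; have := nm_ge0 y'; have := nm_ge0 t'; lra.
have nt' : nm t' <= s by have := nm_ge0 y; have := nm_ge0 y'; have := nm_ge0 t; lra.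
have r1r0 := lin_radius_r0; have r1C1 := lin_radius_const.
have Ar : nm A <= r0 by move: b1; rewrite -mulrA; lra.
have Br : nm B <= r0 by move: b2; rewrite -mulrA; lra.
have h1 := HPhi Ar Br (_ : nm t <= r0) (_ : nm t' <= r0).
have {}h1 := h1 (ltac:(lra)) (ltac:(lra)).
have E : L ^+ (2 * k) = L ^+ k * L ^+ k by rewrite mul2n -addnn exprD.
have dAB : nm (A - B) <= 2 * L ^+ k * d.
  have := nm_tri (lam ^+ k * (y - y')) (A - B) 0; rewrite !subr0 nmM nmX -/L => h.
  have : nm (y - y') <= d by rewrite /d lerDl nm_ge0.
  move/(ler_wpM2l (ltW Lk)) => h2.
  have : C1 * L ^+ (2 * k) * s * d <= L ^+ k * d.
    rewrite E; have -> : C1 * (L ^+ k * L ^+ k) * s * d = (C1 * (L ^+ k * s)) * (L ^+ k * d) by ring.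
    apply: ler_piMl; first by rewrite mulr_ge0 // ltW.
    by apply: le_trans (ler_wpM2l C10 hk') _.
  lra.
have h2 : C * (nm A + nm B + nm t + nm t') * (nm (A - B) + nm (t - t')) <=
    C * (6 * (L ^+ k * s)) * (3 * L ^+ k * d).
  apply: ler_pM.
  - by rewrite mulr_ge0 // !addr_ge0 ?nm_ge0.
  - by rewrite addr_ge0 ?nm_ge0.
  - apply: ler_wpM2l => //.
    have : s <= L ^+ k * s by apply: ler_peMl.
    by move: b1 b2; rewrite -!mulrA; lra.
  - have : nm (t - t') <= d by rewrite /d lerDr nm_ge0.
    have : d <= L ^+ k * d by apply: ler_peMl.
    by move: dAB; rewrite -!mulrA; lra.
have split1 : nm (Phi A t - Phi B t' - lam ^+ k.+1 * (y - y')) <=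
   nm (Phi A t - Phi B t' - lam * (A - B)) + L * nm (A - B - lam ^+ k * (y - y')).
  rewrite -nmM; have -> : Phi A t - Phi B t' - lam ^+ k.+1 * (y - y') =
    (Phi A t - Phi B t' - lam * (A - B)) + lam * (A - B - lam ^+ k * (y - y')).
    by rewrite exprS; ring.
  exact: nmD.
apply: le_trans split1 _.
have := ler_wpM2l (ltW L0) IH.
have -> : L ^+ (2 * k.+1) = L ^+ 2 * (L ^+ k * L ^+ k) by rewrite mulnS exprD E.
rewrite E.
have CE : C1 * (L ^+ 2 - L) = 18 * C by rewrite /lin_const mulfVK // gt_eqF // LL_gt0.
move: (L ^+ k) h2 => M h2 h3.
rewrite [leRHS](_ : _ = 18 * C * (M * M * s * d) + L * (C1 * (M * M) * s * d)).
  apply: lerD => //; apply: le_trans h1 _; apply: le_trans h2 _.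
  by rewrite le_eqVlt; apply/orP; left; apply/eqP; ring.
by rewrite -CE; ring.
Qed.

(** Comparison with the fixed orbit of [(0, 0)]: up to the size [r1] the error does not exceed
    [L^k (|y| + |t|)], whence the factor 2. *)
Lemma run_bound k y t : L ^+ k * (nm y + nm t) <= r1 ->
  nm (run k y t) <= 2 * L ^+ k * (nm y + nm t).
Proof.
set s := nm y + nm t => hk.
have s0 : 0 <= s by rewrite addr_ge0 ?nm_ge0.
elim/ltn_ind: k hk => k IH hk.
have Lk := Lk_gt0 k.
have := @run_diff_aux k y 0 t 0 s; rewrite nm0 run0 !subr0 -/s => h.
have {}h : nm (run k y t - lam ^+ k * y) <= C1 * L ^+ (2 * k) * s * s.
  apply: h => //; first by rewrite /s; lra.
  move=> i ik; have Lik := Lk_le (ltnW ik).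
  rewrite run0 nm0; split; last by rewrite !mulr_ge0 // ltW // Lk_gt0.
  by apply: IH => //; apply: le_trans hk; apply: ler_wpM2r.
have := nm_subl (run k y t) (lam ^+ k * y); rewrite nmM nmX -/L => h2.
have h3 : L ^+ k * nm y <= L ^+ k * s.
  by apply: ler_wpM2l; [exact: ltW|rewrite /s lerDl nm_ge0].
have : C1 * L ^+ (2 * k) * s * s <= L ^+ k * s.
  rewrite mul2n -addnn exprD.
  have -> : C1 * (L ^+ k * L ^+ k) * s * s = (C1 * (L ^+ k * s)) * (L ^+ k * s) by ring.
  apply: ler_piMl; first by rewrite mulr_ge0 // ltW.
  exact: le_trans (ler_wpM2l lin_const_ge0 hk) lin_radius_const.
lra.
Qed.

Lemma run_diff k y y' t t' (s : R) : nm y + nm y' + nm t + nm t' <= s ->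
  L ^+ k * s <= r1 ->
  nm (run k y t - run k y' t' - lam ^+ k * (y - y')) <=
    C1 * L ^+ (2 * k) * s * (nm (y - y') + nm (t - t')).
Proof.
move=> hs hk; apply: run_diff_aux => // i ik.
have Lik := Lk_le (ltnW ik); have Li := Lk_gt0 i.
have y0 := nm_ge0 y; have y'0 := nm_ge0 y'; have t0 := nm_ge0 t; have t'0 := nm_ge0 t'.
have s0 : 0 <= s by lra.
have his : L ^+ i * s <= r1 by apply: le_trans hk; apply: ler_wpM2r.
split.
  have h : nm y + nm t <= s by lra.
  have := ler_wpM2l (ltW Li) h => h2; apply: le_trans (run_bound (le_trans h2 his)) _.
  by rewrite -!mulrA; apply: ler_wpM2l.
have h : nm y' + nm t' <= s by lra.
have := ler_wpM2l (ltW Li) h => h2; apply: le_trans (run_bound (le_trans h2 his)) _.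
by rewrite -!mulrA; apply: ler_wpM2l.
Qed.

Lemma small_pow (A B : R) : 0 <= A -> 0 < B ->
  exists k0, forall k, (k0 <= k)%N -> A / L ^+ k <= B.
Proof.
move=> A0 B0; have [k0 hk0] := pow_unbounded (A / B) lam1; exists k0 => k hk.
rewrite ler_pdivrMr ?Lk_gt0 // mulrC -ler_pdivrMr //.
by apply: le_trans (ltW hk0) _; exact: Lk_le.
Qed.

(** 14 is [6 + 6 + 1 + 1]: the bounds on two points and two parameters at the start of the last [J]
    steps in [run_compare]. *)
Definition psi_radius : R := r1 / 14.
Local Notation r2 := psi_radius.

Lemma psi_radius_gt0 : 0 < r2.
Proof. by rewrite divr_gt0 // lin_radius_gt0. Qed.

(* [y] and [t] are, up to higher order, the rescaled points [eta / lam^k] and [0]. *)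
Definition admissible (D : R) k eta y t :=
  nm (y - eta / lam ^+ k) <= D / L ^+ k / L ^+ k /\ nm t <= r2 / L ^+ k.

Lemma admissible_small (D : R) : exists k0, forall k eta y t, (k0 <= k)%N ->
  nm eta <= r2 -> admissible D k eta y t -> nm y + nm t <= 3 * r2 / L ^+ k.
Proof.
have [k0 hk0] := small_pow (normr_ge0 D) psi_radius_gt0; exists k0 => k eta y t hk heta [h1 h2].
have Lk := Lk_gt0 k; have u0 : 0 <= (L ^+ k)^-1 by rewrite invr_ge0 ltW.
have := nm_tri (eta / lam ^+ k) y 0; rewrite !subr0 nm_div nmX -/L.
have := ler_wpM2r u0 heta.
have h3 : D / L ^+ k <= r2 by apply: le_trans (hk0 k hk); apply: ler_wpM2r => //; exact: ler_norm.
have := ler_wpM2r u0 h3.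
have -> : 3 * r2 / L ^+ k = r2 / L ^+ k + r2 / L ^+ k + r2 / L ^+ k by ring.
move: (r2 / L ^+ k) h1 h2 => A; move: (D / L ^+ k / L ^+ k) => B; lra.
Qed.

(** Both runs are stopped [J] steps early. There they differ from [eta / lam^J] by a quantity of
    order [L^(-2J)], up to terms that vanish as [k] and [k'] grow, and the last [J] steps expand by
    at most [2 L^J]. So [J] is fixed first, then [k0]. *)
Lemma run_compare (D eps : R) : 0 <= D -> 0 < eps -> exists k0, forall k k',
  (k0 <= k)%N -> (k0 <= k')%N ->
  forall eta y t y' t', nm eta <= r2 -> admissible D k eta y t -> admissible D k' eta y' t' ->
  nm (run k y t - run k' y' t') <= eps.
Proof.
move=> D0 eps0; have r10 := lin_radius_gt0; have C10 := lin_const_ge0.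
have L0 := L_gt0; have r20 := psi_radius_gt0.
have r2E : 14 * r2 = r1 by rewrite /psi_radius; lra.
have ln0 : lam != 0 by rewrite -nm_gt0.
have e2 : 0 < eps / 2 by lra.
have [J hJ] : exists J, 36 * C1 * r2 ^+ 2 / L ^+ J <= eps / 2.
  have h : 0 <= 36 * C1 * r2 ^+ 2 by apply: mulr_ge0; [apply: mulr_ge0|exact: sqr_ge0].
  by have [J hJ] := small_pow h e2; exists J; exact: hJ.
have LJ := Lk_gt0 J; have LJ1 := Lk_ge1 J.
have [k1 hk1] : exists k1, forall k, (k1 <= k)%N -> (4 * D + 4 * r2) * L ^+ J / L ^+ k <= eps / 2.
  apply: small_pow => //; apply: mulr_ge0; last exact: ltW.
  by apply: addr_ge0; apply: mulr_ge0 => //; exact: ltW.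
have [k2 hk2] := admissible_small D.
exists (J + k1 + k2)%N.
have first k eta y t : (J + k1 + k2 <= k)%N -> nm eta <= r2 -> admissible D k eta y t ->
  [/\ nm t <= r2 / L ^+ k, nm (run (k - J) y t) <= 6 * r2 / L ^+ J &
   nm (run (k - J) y t - eta / lam ^+ J) <=
     9 * C1 * r2 ^+ 2 / L ^+ J / L ^+ J + D / L ^+ k / L ^+ J].
  move=> hk heta adm; have hk2' : (k2 <= k)%N by apply: leq_trans hk; exact: leq_addl.
  have hs := hk2 k eta y t hk2' heta adm; case: adm => h1 h2.
  have hkJ : (J <= k)%N by apply: leq_trans hk; rewrite -addnA leq_addr.
  have Ek : L ^+ k = L ^+ (k - J) * L ^+ J by rewrite -exprD subnK.
  have Lk := Lk_gt0 k; have Li := Lk_gt0 (k - J).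
  have n1 : L ^+ (k - J) != 0 by rewrite gt_eqF.
  have n2 : L ^+ J != 0 by rewrite gt_eqF.
  have his : L ^+ (k - J) * (3 * r2 / L ^+ k) = 3 * r2 / L ^+ J.
    by rewrite Ek; field; rewrite ?n1 ?n2.
  have small : L ^+ (k - J) * (3 * r2 / L ^+ k) <= r1.
    by rewrite his ler_pdivrMr //; nra.
  split => //.
    apply: le_trans (run_bound (le_trans (ler_wpM2l (ltW Li) hs) small)) _.
    have := ler_wpM2l (ltW Li) hs; rewrite his => hh.
    have -> : 6 * r2 / L ^+ J = 2 * (3 * r2 / L ^+ J) by ring.
    by rewrite -[leLHS]mulrA; apply: ler_wpM2l.
  have := @run_diff (k - J)%N y 0 t 0 (3 * r2 / L ^+ k).
  rewrite nm0 run0 !subr0 => /(_ _ small) h.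
  have {}h := h (ltac:(lra)).
  have h3 : C1 * L ^+ (2 * (k - J)) * (3 * r2 / L ^+ k) * (nm y + nm t) <=
      9 * C1 * r2 ^+ 2 / L ^+ J / L ^+ J.
    have c0 : 0 <= C1 * L ^+ (2 * (k - J)) * (3 * r2 / L ^+ k).
      apply: mulr_ge0; first by apply: mulr_ge0 => //; exact: ltW (Lk_gt0 _).
      by apply: divr_ge0; [apply: mulr_ge0 => //|]; exact: ltW.
    apply: le_trans (ler_wpM2l c0 hs) _.
    rewrite le_eqVlt; apply/orP; left; apply/eqP; rewrite mul2n -addnn exprD Ek.
    by field; rewrite ?n1 ?n2.
  have h4 : nm (lam ^+ (k - J) * y - eta / lam ^+ J) <= D / L ^+ k / L ^+ J.
    have -> : lam ^+ (k - J) * y - eta / lam ^+ J = lam ^+ (k - J) * (y - eta / lam ^+ k).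
      have El : lam ^+ k = lam ^+ (k - J) * lam ^+ J by rewrite -exprD subnK.
      by rewrite El; field; rewrite !expf_neq0.
    rewrite nmM nmX -/L; apply: le_trans (ler_wpM2l (ltW Li) h1) _.
    rewrite le_eqVlt; apply/orP; left; apply/eqP; rewrite Ek.
    by field; rewrite ?n1 ?n2.
  by apply: le_trans (nm_tri (lam ^+ (k - J) * y) _ _) _; lra.
move=> k k' hk hk' eta y t y' t' heta a1 a2.
have [t1 y1 d1] := first _ _ _ _ hk heta a1.
have [t2 y2 d2] := first _ _ _ _ hk' heta a2.
have kJ i : (J + k1 + k2 <= i)%N -> (J <= i)%N /\ (k1 <= i)%N.
  move=> hi; split; first by apply: leq_trans hi; rewrite -addnA leq_addr.
  by apply: leq_trans hi; rewrite addnAC leq_addl.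
have [kJ1 kk1] := kJ k hk; have [kJ2 kk2] := kJ k' hk'.
rewrite -(subnK kJ1) -(subnK kJ2) !runD.
set Y := run (k - J) y t in y1 d1 *; set Y' := run (k' - J) y' t' in y2 d2 *.
have LkJ i : (J <= i)%N -> r2 / L ^+ i <= r2 / L ^+ J.
  move=> hi; apply: ler_wpM2l; first exact: ltW.
  by rewrite lef_pV2 ?posrE ?Lk_gt0 //; exact: Lk_le.
have t1' := le_trans t1 (LkJ k kJ1); have t2' := le_trans t2 (LkJ k' kJ2).
have hs : nm Y + nm Y' + nm t + nm t' <= 14 * r2 / L ^+ J.
  have -> : 14 * r2 / L ^+ J = 6 * r2 / L ^+ J + 6 * r2 / L ^+ J + r2 / L ^+ J + r2 / L ^+ J by ring.
  by apply: lerD => //; apply: lerD => //; apply: lerD.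
have n2 : L ^+ J != 0 by rewrite gt_eqF.
have hJs : L ^+ J * (14 * r2 / L ^+ J) = r1 by rewrite -r2E; field.
have := run_diff hs (_ : L ^+ J * (14 * r2 / L ^+ J) <= r1).
rewrite hJs lexx => /(_ isT) h.
set d := nm (Y - Y') + nm (t - t') in h.
have d0 : 0 <= d by rewrite addr_ge0 ?nm_ge0.
have h1 : C1 * L ^+ (2 * J) * (14 * r2 / L ^+ J) * d <= L ^+ J * d.
  have -> : C1 * L ^+ (2 * J) * (14 * r2 / L ^+ J) * d = (C1 * r1) * (L ^+ J * d).
    by rewrite -r2E mul2n -addnn exprD; field.
  by apply: ler_piMl; [rewrite mulr_ge0 // ltW|exact: lin_radius_const].
have h2 : nm (run J Y t - run J Y' t') <= 2 * L ^+ J * d.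
  have := nm_tri (lam ^+ J * (Y - Y')) (run J Y t - run J Y' t') 0.
  rewrite !subr0 nmM nmX -/L.
  have : L ^+ J * nm (Y - Y') <= L ^+ J * d.
    by apply: ler_wpM2l; [exact: ltW|rewrite /d lerDl nm_ge0].
  lra.
apply: le_trans h2 _.
have dY : nm (Y - Y') <= 18 * C1 * r2 ^+ 2 / L ^+ J / L ^+ J
     + (D / L ^+ k + D / L ^+ k') / L ^+ J.
  apply: le_trans (nm_tri (eta / lam ^+ J) _ _) _; rewrite [nm (_ - Y')]nm_sym.
  have -> : 18 * C1 * r2 ^+ 2 / L ^+ J / L ^+ J + (D / L ^+ k + D / L ^+ k') / L ^+ J
    = (9 * C1 * r2 ^+ 2 / L ^+ J / L ^+ J + D / L ^+ k / L ^+ J) +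
      (9 * C1 * r2 ^+ 2 / L ^+ J / L ^+ J + D / L ^+ k' / L ^+ J) by ring.
  exact: lerD.
have dt : nm (t - t') <= r2 / L ^+ k + r2 / L ^+ k'.
  by apply: le_trans (nmB _ _) _; exact: lerD.
have LJ2 : 0 <= 2 * L ^+ J by rewrite mulr_ge0 // ltW.
apply: le_trans (ler_wpM2l LJ2 (lerD dY dt)) _.
have iu i : 0 <= (L ^+ i)^-1 by rewrite invr_ge0 ltW // Lk_gt0.
have -> : 2 * L ^+ J * (18 * C1 * r2 ^+ 2 / L ^+ J / L ^+ J + (D / L ^+ k + D / L ^+ k') / L ^+ J
    + (r2 / L ^+ k + r2 / L ^+ k')) = 36 * C1 * r2 ^+ 2 / L ^+ J +
    ((2 * D + 2 * r2 * L ^+ J) / L ^+ k + (2 * D + 2 * r2 * L ^+ J) / L ^+ k').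
  have nk i : L ^+ i != 0 by rewrite gt_eqF // Lk_gt0.
  by field; rewrite !nk.
have half i : (k1 <= i)%N -> (2 * D + 2 * r2 * L ^+ J) / L ^+ i <= eps / 4.
  move=> /hk1 hi.
  have : (2 * D + 2 * r2 * L ^+ J) / L ^+ i <= ((4 * D + 4 * r2) * L ^+ J / 2) / L ^+ i.
    apply: ler_wpM2r; first exact: iu.
    by have := ler_wpM2l D0 LJ1; lra.
  have -> : ((4 * D + 4 * r2) * L ^+ J / 2) / L ^+ i = ((4 * D + 4 * r2) * L ^+ J) / L ^+ i / 2 by ring.
  lra.
have := half k kk1; have := half k' kk2; lra.
Qed.

Lemma cauchy_limit (u : nat -> R[i]) :
  (forall eps : R, 0 < eps -> exists k0, forall k k', (k0 <= k)%N -> (k0 <= k')%N ->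
     nm (u k - u k') <= eps) ->
  exists l, forall eps : R, 0 < eps -> exists k0, forall k, (k0 <= k)%N -> nm (u k - l) <= eps.
Proof.
move=> cu; have [k0 hk0] := cu 1 ltr01.
have [||x hx] := @cluster_point R (fun k => u (k0 + k)%N) (nm (u k0) + 1) (fun=> True).
- move=> j; have := hk0 (k0 + j)%N k0 (leq_addr _ _) (leqnn _).
  have := nm_subl (u (k0 + j)%N) (u k0); lra.
- by move=> J; exists J.
exists x => eps eps0; have e2 : 0 < eps / 2 by lra.
have [k1 hk1] := cu _ e2; exists k1 => k hk.
have [j k1j [_ hj]] := hx _ e2 k1.
have := hk1 k (k0 + j)%N hk (leq_trans k1j (leq_addl _ _)).
have := nm_tri (u (k0 + j)%N) (u k) x; lra.
Qed.

(* [psi] is the inverse of the Koenigs linearization at the repelling fixed point. *)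
Lemma koenigs : exists psi : R[i] -> R[i], [/\
  forall D eps : R, 0 <= D -> 0 < eps -> exists k0, forall k, (k0 <= k)%N ->
    forall eta y t, nm eta <= r2 -> admissible D k eta y t ->
      nm (run k y t - psi eta) <= eps,
  psi 0 = 0 &
  forall eta eta', nm eta <= r2 -> nm eta' <= r2 ->
    nm (psi eta - psi eta' - (eta - eta')) <= C1 * (nm eta + nm eta') * nm (eta - eta')].
Proof.
have r20 := psi_radius_gt0; have L0 := L_gt0.
have ln0 : lam != 0 by rewrite -nm_gt0.
have adm D k eta : 0 <= D -> admissible D k eta (eta / lam ^+ k) 0.
  move=> D0; rewrite /admissible subrr !nm0; have Lk := ltW (Lk_gt0 k).
  by split; [apply: divr_ge0 => //; exact: divr_ge0|apply: divr_ge0 => //; exact: ltW].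
have [psi hpsi] : {psi : R[i] -> R[i] & forall eta, nm eta <= r2 ->
    forall eps : R, 0 < eps -> exists k0, forall k, (k0 <= k)%N ->
      nm (run k (eta / lam ^+ k) 0 - psi eta) <= eps}.
  apply: (@choice _ _ (fun eta l => nm eta <= r2 ->
    forall eps : R, 0 < eps -> exists k0, forall k, (k0 <= k)%N ->
      nm (run k (eta / lam ^+ k) 0 - l) <= eps)) => eta.
  have [heta|heta] := EM (nm eta <= r2); last by exists 0.
  have [|l hl] := @cauchy_limit (fun k => run k (eta / lam ^+ k) 0); last by exists l.
  move=> eps eps0; have [k0 hk0] := run_compare (lexx 0) eps0; exists k0 => k k' h h'.
  by apply: (hk0 k k' h h' eta) => //; exact: adm.
exists psi; split.
- move=> D eps D0 eps0; have e2 : 0 < eps / 2 by lra.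
  have [k0 hk0] := run_compare D0 e2; exists k0 => k hk eta y t heta hadm.
  have [k1 hk1] := hpsi eta heta _ e2; have kk := leq_maxl k0 k1.
  have h1 := hk0 k _ hk kk eta y t _ _ heta hadm (adm D _ eta D0).
  have h2 := hk1 _ (leq_maxr k0 k1).
  have := nm_tri (run (maxn k0 k1) (eta / lam ^+ maxn k0 k1) 0) (run k y t) (psi eta); lra.
- have h0 : nm (0 : R[i]) <= r2 by rewrite nm0 ltW.
  apply/eqP; rewrite -nm_eq0 eq_le nm_ge0 andbT leNgt; apply/negP => lt.
  have [|k0 hk0] := hpsi 0 h0 (nm (psi 0) / 2); first lra.
  have := hk0 k0 (leqnn _); rewrite mul0r run0 sub0r nmN; lra.
move=> eta eta' h h'; rewrite leNgt; apply/negP => lt.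
set A := C1 * _ * _ in lt; set B := nm _ in lt.
have e0 : 0 < (B - A) / 4 by lra.
have [k1 hk1] := hpsi eta h _ e0; have [k2 hk2] := hpsi eta' h' _ e0.
set k := maxn k1 k2.
have {}hk1 := hk1 k (leq_maxl _ _); have {}hk2 := hk2 k (leq_maxr _ _).
have Lk := Lk_gt0 k.
have := @run_diff k (eta / lam ^+ k) (eta' / lam ^+ k) 0 0 ((nm eta + nm eta') / L ^+ k).
rewrite subrr nm0 !addr0 !nm_div !nmX -/L -mulrDl lexx => /(_ isT).
have lk0 : lam ^+ k != 0 by rewrite expf_neq0.
have Lkn : L ^+ k != 0 by rewrite gt_eqF.
have -> : L ^+ k * ((nm eta + nm eta') / L ^+ k) = nm eta + nm eta' by field.
have -> : nm eta + nm eta' <= r1.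
  have : 14 * r2 = r1 by rewrite /psi_radius; lra.
  lra.
rewrite -mulrBl nm_div nmX -/L => /(_ isT).
have -> : C1 * L ^+ (2 * k) * ((nm eta + nm eta') / L ^+ k) * (nm (eta - eta') / L ^+ k) = A.
  by rewrite mul2n -addnn exprD /A; field.
have -> : lam ^+ k * ((eta - eta') / lam ^+ k) = eta - eta' by field.
set u := run k _ _ in hk1 *; set v := run k _ _ in hk2 *.
have -> : u - v - (eta - eta') = (psi eta - psi eta' - (eta - eta')) - ((psi eta - u) - (psi eta' - v)) by ring.
have := nm_subl (psi eta - psi eta' - (eta - eta')) ((psi eta - u) - (psi eta' - v)).
have := nmB (psi eta - u) (psi eta' - v).
rewrite -/B [nm (psi eta - u)]nm_sym [nm (psi eta' - v)]nm_sym; lra.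
Qed.

End Linearization.

Lemma small_multiples (R : realType) (B : R) (l : seq R) : 0 < B ->
  (forall u, u \in l -> 0 <= u) ->
  exists2 rho : R, 0 < rho & forall u, u \in l -> u * rho <= B.
Proof.
move=> B0; elim: l => [|v l IH] h; first by exists 1.
have [|rho rho0 hrho] := IH; first by move=> u ul; apply: h; rewrite inE ul orbT.
have v0 : 0 <= v by apply: h; exact: mem_head.
have m0 : 0 < Num.min rho (B / (v + 1)) by rewrite lt_min rho0 divr_gt0 //; lra.
exists (Num.min rho (B / (v + 1))) => // u; rewrite inE => /orP[/eqP ->|ul].
  apply: (@le_trans _ _ (v * (B / (v + 1)))).
    by apply: ler_wpM2l => //; rewrite ge_min lexx orbT.
  rewrite mulrCA; apply: ler_piMr; first exact: ltW.
  by rewrite ler_pdivrMr; lra.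
apply: le_trans (hrho u ul); apply: ler_wpM2l; last by rewrite ge_min lexx.
by apply: h; rewrite inE ul orbT.
Qed.

(** * The critical orbit under perturbation of the point and the parameter *)

Section Local.
Variable R : realType.
Implicit Types (c t x y z w : R[i]).
Variables (a : R[i]) (b e : nat -> R[i]) (m n : nat).
Hypothesis H : critical_orbit a b e m n.
Let se := co_signs H.
Let bS := co_step H.
Let lam := multiplier b e m n.
Let L : R := nm lam.

(* Displacement, after [j] steps from [b i], caused by perturbing the starting point
   by [x] and the parameter by [t]; [lin_x] and [lin_t] are its partial derivatives. *)
Definition disp i j x t := orb (fun l => e (i + l)%N) (a + t) (b i + x) j - b (i + j)%N.

Definition lin_x i j : R[i] := \prod_(0 <= l < j) (2 * e (i + l)%N * b (i + l)%N).

Fixpoint lin_t i j : R[i] :=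
  if j is k.+1 then 2 * e (i + k)%N * b (i + k)%N * lin_t i k + 1 else 0.

Lemma disp0 i x t : disp i 0 x t = x.
Proof. by rewrite /disp /= addn0 addrC addKr. Qed.

Lemma dispS i j x t : disp i j.+1 x t =
  e (i + j)%N * (2 * b (i + j)%N * disp i j x t + disp i j x t ^+ 2) + t.
Proof. by rewrite /disp addnS bS /=; ring. Qed.

Lemma disp00 i j : disp i j 0 0 = 0.
Proof. by elim: j => [|j IH]; rewrite ?disp0 // dispS IH; ring. Qed.

Lemma lin_xS i j : lin_x i j.+1 = 2 * e (i + j)%N * b (i + j)%N * lin_x i j.
Proof. by rewrite /lin_x big_nat_recr //= mulrC. Qed.

(** Differentiability for pairs of arguments, with an error proportional to their size and to their
    difference. This shape survives one step of the recursion and is what the linearization takes as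
    hypothesis. *)
Lemma disp_est i j : exists2 C : R, 0 <= C & forall x x' t t',
  nm x <= 1 -> nm x' <= 1 -> nm t <= 1 -> nm t' <= 1 ->
  nm (disp i j x t - disp i j x' t' - (lin_x i j * (x - x') + lin_t i j * (t - t'))) <=
    C * (nm x + nm x' + nm t + nm t') * (nm (x - x') + nm (t - t')).
Proof.
elim: j => [|j [C C0 IH]].
  exists 0 => // x x' t t' _ _ _ _; rewrite !disp0 /lin_x big_geq //= !mul0r.
  by rewrite mul1r addr0 subrr nm0.
set M := nm (lin_x i j) + nm (lin_t i j) + 4 * C.
have M0 : 0 <= M by rewrite !addr_ge0 ?nm_ge0 ?mulr_ge0.
exists (2 * nm (b (i + j)%N) * C + 2 * M * M).
  by rewrite addr_ge0 ?mulr_ge0 ?nm_ge0.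
move=> x x' t t' hx hx' ht ht'.
have h := IH x x' t t' hx hx' ht ht'.
set s := nm x + nm x' + nm t + nm t' in h *.
set d := nm (x - x') + nm (t - t') in h *.
have d0 : 0 <= d by rewrite addr_ge0 ?nm_ge0.
have s4 : s <= 4 by rewrite /s; lra.
have lip u u' v v' : nm u <= 1 -> nm u' <= 1 -> nm v <= 1 -> nm v' <= 1 ->
    nm (disp i j u v - disp i j u' v') <= M * (nm (u - u') + nm (v - v')).
  move=> hu hu' hv hv'; have h1 := IH u u' v v' hu hu' hv hv'.
  set l := lin_x i j * (u - u') + lin_t i j * (v - v') in h1.
  have h2 : nm l <= (nm (lin_x i j) + nm (lin_t i j)) * (nm (u - u') + nm (v - v')).
    apply: le_trans (nmD _ _) _; rewrite !nmM.
    have := nm_ge0 (lin_x i j); have := nm_ge0 (lin_t i j).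
    have := nm_ge0 (u - u'); have := nm_ge0 (v - v'); nra.
  have h3 : C * (nm u + nm u' + nm v + nm v') * (nm (u - u') + nm (v - v')) <=
      C * 4 * (nm (u - u') + nm (v - v')).
    apply: ler_wpM2r; first by rewrite addr_ge0 ?nm_ge0.
    by apply: ler_wpM2l => //; lra.
  have := nm_tri l (disp i j u v - disp i j u' v') 0; rewrite !subr0 /M; lra.
have n0 : nm (0 : R[i]) <= 1 by rewrite nm0.
have b1 : nm (disp i j x t) <= M * s.
  have := lip x 0 t 0 hx n0 ht n0; rewrite disp00 !subr0 => h1; apply: le_trans h1 _.
  by apply: ler_wpM2l => //; rewrite /s; have := nm_ge0 x'; have := nm_ge0 t'; lra.
have b2 : nm (disp i j x' t') <= M * s.
  have := lip x' 0 t' 0 hx' n0 ht' n0; rewrite disp00 !subr0 => h1; apply: le_trans h1 _.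
  by apply: ler_wpM2l => //; rewrite /s; have := nm_ge0 x; have := nm_ge0 t; lra.
have b3 := lip x x' t t' hx hx' ht ht'; rewrite -/d in b3.
rewrite !dispS lin_xS /=.
move: (disp i j x t) (disp i j x' t') b1 b2 b3 h => D D' b1 b2 b3 h.
have -> : e (i + j)%N * (2 * b (i + j)%N * D + D ^+ 2) + t -
   (e (i + j)%N * (2 * b (i + j)%N * D' + D' ^+ 2) + t') -
   (2 * e (i + j)%N * b (i + j)%N * lin_x i j * (x - x') +
    (2 * e (i + j)%N * b (i + j)%N * lin_t i j + 1) * (t - t')) =
   e (i + j)%N * (2 * b (i + j)%N * (D - D' - (lin_x i j * (x - x') + lin_t i j * (t - t')))
     + (D - D') * (D + D')) by ring.
rewrite nmM (nm_sign (se _)) mul1r; apply: le_trans (nmD _ _) _; rewrite !nmM nm_nat.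
have h1 : nm (D + D') <= 2 * M * s by apply: le_trans (nmD _ _) _; lra.
have := ler_pM (nm_ge0 _) (nm_ge0 _) b3 h1.
have c0 : 0 <= 2 * nm (b (i + j)%N) by rewrite mulr_ge0 // nm_ge0.
have := ler_wpM2l c0 h; lra.
Qed.

Lemma disp_bound i N : exists2 A : R, 0 <= A & forall j x t, (j <= N)%N ->
  nm x <= 1 -> nm t <= 1 -> nm (disp i j x t) <= A * (nm x + nm t).
Proof.
have one j : exists2 A : R, 0 <= A & forall x t,
    nm x <= 1 -> nm t <= 1 -> nm (disp i j x t) <= A * (nm x + nm t).
  have [C C0 hC] := disp_est i j; exists (nm (lin_x i j) + nm (lin_t i j) + 2 * C).
    by rewrite !addr_ge0 ?nm_ge0 ?mulr_ge0.
  move=> x t hx ht; have n0 : nm (0 : R[i]) <= 1 by rewrite nm0.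
  have := hC x 0 t 0 hx n0 ht n0; rewrite disp00 !subr0 nm0 !addr0 => h.
  have h2 : nm (lin_x i j * x + lin_t i j * t) <= (nm (lin_x i j) + nm (lin_t i j)) * (nm x + nm t).
    apply: le_trans (nmD _ _) _; rewrite !nmM.
    have := nm_ge0 (lin_x i j); have := nm_ge0 (lin_t i j).
    have := nm_ge0 x; have := nm_ge0 t; nra.
  have s0 : 0 <= nm x + nm t by rewrite addr_ge0 ?nm_ge0.
  have h3 : C * (nm x + nm t) * (nm x + nm t) <= C * 2 * (nm x + nm t).
    by apply: ler_wpM2r => //; apply: ler_wpM2l => //; lra.
  have := nm_tri (lin_x i j * x + lin_t i j * t) (disp i j x t) 0; rewrite !subr0; lra.
elim: N => [|N [A A0 hA]].
  by have [A A0 hA] := one 0%N; exists A => // j x t; rewrite leqn0 => /eqP ->; exact: hA.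
have [A' A'0 hA'] := one N.+1; exists (A + A'); first by rewrite addr_ge0.
move=> j x t; have s0 : 0 <= nm x + nm t by rewrite addr_ge0 ?nm_ge0.
rewrite leq_eqVlt => /orP[/eqP -> hx ht|hj hx ht].
  by apply: le_trans (hA' x t hx ht) _; apply: ler_wpM2r => //; lra.
by apply: le_trans (hA j x t hj hx ht) _; apply: ler_wpM2r => //; lra.
Qed.

(* Derivative of the periodic point with respect to the parameter. *)
Definition slope : R[i] := lin_t m n / (1 - lam).

Let lam1 : 1 < L. Proof. exact: multiplier_gt1 H. Qed.

Lemma multiplier_neq1 : 1 - lam != 0.
Proof.
apply/eqP => h; have : lam = 1 by apply/eqP; rewrite eq_sym -subr_eq0 h.
by move=> h1; have := lam1; rewrite /L h1 nm1 ltxx.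
Qed.

(** The return map in the coordinate centred, to first order in [t], at the periodic point of the
    parameter [a + t]. The centring removes the term linear in [t], as the linearization
    requires. *)
Definition block y t := disp m n (y + slope * t) t - slope * t.

Lemma block_est : exists C r0 : R, [/\ 0 <= C, 0 < r0 & forall y y' t t',
  nm y <= r0 -> nm y' <= r0 -> nm t <= r0 -> nm t' <= r0 ->
  nm (block y t - block y' t' - lam * (y - y')) <=
    C * (nm y + nm y' + nm t + nm t') * (nm (y - y') + nm (t - t'))].
Proof.
have [C C0 hC] := disp_est m n; set p := nm slope.
have p0 : 0 <= p := nm_ge0 _.
exists (C * (1 + p) ^+ 2), (1 + p)^-1; split.
- by rewrite mulr_ge0 // sqr_ge0.
- by rewrite invr_gt0; lra.
have i1 : (1 + p)^-1 <= 1 by rewrite invf_le1; lra.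
have i2 : (1 + p) * (1 + p)^-1 = 1 by rewrite mulfV // gt_eqF //; lra.
have sh y t : nm y <= (1 + p)^-1 -> nm t <= (1 + p)^-1 -> nm (y + slope * t) <= 1.
  move=> hy ht; apply: le_trans (nmD _ _) _; rewrite nmM -/p.
  have := ler_wpM2l p0 ht; lra.
move=> y y' t t' hy hy' ht ht'.
have := hC (y + slope * t) (y' + slope * t') t t' (sh _ _ hy ht) (sh _ _ hy' ht')
  (le_trans ht i1) (le_trans ht' i1).
set A := nm (_ - _ - _); set B := nm (block _ _ - _ - _).
have -> : B = A.
  rewrite /A /B /block; congr nm.
  have -> : lin_x m n = lam by [].
  have -> : lin_t m n = slope * (1 - lam) by rewrite /slope mulfVK // multiplier_neq1.
  ring.
move=> h; apply: le_trans h _.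
have -> : C * (1 + p) ^+ 2 * (nm y + nm y' + nm t + nm t') * (nm (y - y') + nm (t - t')) =
  C * ((1 + p) * (nm y + nm y' + nm t + nm t')) * ((1 + p) * (nm (y - y') + nm (t - t'))).
  by ring.
have le1 (u v : R[i]) : nm (u + slope * v) + nm v <= (1 + p) * (nm u + nm v).
  have := nmD u (slope * v); rewrite nmM -/p => h.
  by have := mulr_ge0 p0 (nm_ge0 u); lra.
apply: ler_pM.
- by rewrite mulr_ge0 // !addr_ge0 ?nm_ge0.
- by rewrite addr_ge0 ?nm_ge0.
- by apply: ler_wpM2l => //; have := le1 y t; have := le1 y' t'; lra.
- have -> : y + slope * t - (y' + slope * t') = (y - y') + slope * (t - t') by ring.
  exact: le1.
Qed.

Lemma block00 : block 0 0 = 0.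
Proof. by rewrite /block mulr0 addr0 disp00 subr0. Qed.

Lemma orb_block k y t :
  orb (fun l => e (m + l)%N) (a + t) (b m + (y + slope * t)) (k * n) =
  b m + (run block k y t + slope * t).
Proof.
elim: k => [|k IH] //.
rewrite mulSnr orbD IH /=.
rewrite (@orb_ext _ _ (fun l => e (m + l)%N)); last first.
  by move=> l _; have [_ h] := b_periodic H l k; rewrite addnA addnAC.
rewrite /block /disp; have := co_periodic H 0; rewrite !addn0 => ->; ring.
Qed.

Lemma orb_disp j h t : orb e (a + t) (a + h) j = b j + disp 0 j h t.
Proof. by rewrite /disp add0n (co_start H) [RHS]addrC subrK. Qed.

Lemma orb_run k h t : orb e (a + t) (a + h) (m + k * n) =
  b m + (run block k (disp 0 m h t - slope * t) t + slope * t).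
Proof. by rewrite orbD orb_disp -orb_block subrK. Qed.

Lemma orb_run_disp k l h t : orb e (a + t) (a + h) (m + k * n + l) =
  b (m + k * n + l)%N +
    disp m l (run block k (disp 0 m h t - slope * t) t + slope * t) t.
Proof.
rewrite orbD orb_run (@orb_ext _ _ (fun l => e (m + l)%N)); last first.
  by move=> i _; have [_ h'] := b_periodic H i k; rewrite addnAC.
rewrite /disp; have [h' _] := b_periodic H l k; rewrite addnAC h'; ring.
Qed.

(** Derivative in [h] of the position at time [m], relative to the perturbed periodic point, for the
    start [a + h] and the parameter [a + th h]. *)
Definition kappa th : R[i] := lin_x 0 m + th * (lin_t 0 m - slope).

Definition rescaled th k z := orb e (a + th * (z / lam ^+ k)) (a + z / lam ^+ k) (m + k * n).

(** A bounded orbit may choose its signs, but within [eta] of the critical orbit any sign other than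
    [e j] leads to an escaping point; so boundedness passes to the point reached with the signs
    [e]. *)
Lemma bdd_follow eta c z J : (forall j x c, nm (x - b j) < eta -> nm (c - a) < eta ->
    ~ bdd_start c (- e j * x ^+ 2 + c)) ->
  nm (c - a) < eta -> (forall j, (j < J)%N -> nm (orb e c z j - b j) < eta) ->
  bdd_start c z -> bdd_start c (orb e c z J).
Proof.
move=> other ca; elim: J => [//|J IH] hJ hz.
have /bdd_step[s s2 hs] : bdd_start c (orb e c z J).
  by apply: IH => // j hj; apply: hJ; rewrite ltnW.
rewrite /=; have [<- //|se'] := EM (s = e J).
case: (other J (orb e c z J) c _ ca); first exact: hJ.
by rewrite -(sign_eq s2 (se J) se').
Qed.

(** Here [psi] is the inverse linearization translated to [b m]. It and [r] serve all [th]; [rho]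
    depends on [th] and keeps the orbit within reach of [other_open] up to time [m + k n]. *)
Lemma local_limit : exists psi (r : R), [/\ 0 < r, psi 0 = b m,
  forall x y, nm x <= r -> nm y <= r ->
    nm (psi x - psi y - (x - y)) <= 1 / 2 * nm (x - y) &
  forall th, exists2 rho : R, 0 < rho & [/\ nm (kappa th) * rho <= r,
    forall z0 (eps : R), nm z0 <= rho -> 0 < eps -> exists2 d : R, 0 < d & exists k0,
      forall k z, (k0 <= k)%N -> nm z <= rho -> nm (z - z0) < d ->
        nm (rescaled th k z - psi (kappa th * z0)) < eps &
    forall k z, nm z <= rho ->
      bdd_start (a + th * (z / lam ^+ k)) (a + z / lam ^+ k) ->
      bdd_start (a + th * (z / lam ^+ k)) (rescaled th k z)]].
Proof.
have [C [r0 [C0 r00 hb]]] := block_est.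
have [psi [psi1 psi2 psi3]] := koenigs lam1 r00 C0 block00 hb.
set C1 := lin_const lam C in psi3; set r2 := psi_radius lam C r0 in psi1 psi3.
set r1 := lin_radius lam C r0.
have C10 : 0 <= C1 := lin_const_ge0 lam1 C0.
have r20 : 0 < r2 := psi_radius_gt0 lam1 r00 C0.
have r10 : 0 < r1 := lin_radius_gt0 lam1 r00 C0.
pose r := Num.min r2 (1 / (4 * (C1 + 1))).
have r_gt0 : 0 < r by rewrite lt_min r20 divr_gt0 // mulr_gt0 //; lra.
have rr2 : r <= r2 by rewrite ge_min lexx.
have rC : C1 * r <= 1 / 4.
  have h : r <= 1 / (4 * (C1 + 1)) by rewrite ge_min lexx orbT.
  apply: le_trans (ler_wpM2l C10 h) _.
  by rewrite mulrA mulr1 ler_pdivrMr ?mulr_gt0 //; lra.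
have bl x y : nm x <= r -> nm y <= r -> nm (psi x - psi y - (x - y)) <= 1 / 2 * nm (x - y).
  move=> hx hy; apply: le_trans (psi3 x y (le_trans hx rr2) (le_trans hy rr2)) _.
  apply: ler_wpM2r; first exact: nm_ge0.
  by have := ler_wpM2l C10 hx; have := ler_wpM2l C10 hy; lra.
exists (fun x => b m + psi x), r; split => //.
- by rewrite psi2 addr0.
- move=> x y hx hy; have -> : b m + psi x - (b m + psi y) = psi x - psi y by ring.
  exact: bl.
move=> th.
have [eta eta0 heta] := other_open H.
have [A0 A00 hA0] := disp_bound 0 m; have [A1 A10 hA1] := disp_bound m n.
have [C2 C20 hC2] := disp_est 0 m.
set p := nm slope; set q := nm th; set K := nm (kappa th).
have p0 : 0 <= p := nm_ge0 _; have q0 : 0 <= q := nm_ge0 _; have K0 : 0 <= K := nm_ge0 _.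
pose Q := A0 * (1 + q) + p * q + q.
have Q0 : 0 <= Q by rewrite !addr_ge0 ?mulr_ge0 ?addr_ge0.
pose Q2 := 2 * Q + p * q; have Q20 : 0 <= Q2 by rewrite !addr_ge0 ?mulr_ge0.
pose Bd := Num.min (Num.min 1 (eta / 2)) (Num.min r1 r).
have A1Q : 0 <= A1 * (Q2 + q) by apply: mulr_ge0 => //; exact: addr_ge0.
have A0q : 0 <= A0 * (1 + q) by apply: mulr_ge0 => //; exact: addr_ge0.
have a1 : 0 < Num.min 1 (eta / 2) by rewrite lt_min ltr01 divr_gt0.
have a2 : 0 < Num.min r1 r by rewrite lt_min r10.
have Bd0 : 0 < Bd by rewrite lt_min a1.
have [B1 B2 B3 B4] : [/\ Bd <= 1, Bd <= eta / 2, Bd <= r1 & Bd <= r].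
  have h1 : Bd <= Num.min 1 (eta / 2) by rewrite /Bd ge_min lexx.
  have h2 : Bd <= Num.min r1 r by rewrite /Bd ge_min lexx orbT.
  split; first by apply: le_trans h1 _; rewrite ge_min lexx.
  - by apply: le_trans h1 _; rewrite ge_min lexx orbT.
  - by apply: le_trans h2 _; rewrite ge_min lexx.
  - by apply: le_trans h2 _; rewrite ge_min lexx orbT.
clear a1 a2.
(* The multiples bound in turn the initial displacement, the parameter, the position at time [m],
   the positions at the returns, those inside a period, those before time [m], and the argument of
   [psi]. *)
have [|rho rho0 rhoE] := @small_multiples R Bd
  [:: 1; q; Q; Q2; A1 * (Q2 + q); A0 * (1 + q); K] Bd0.
  by move=> u; rewrite !inE => /or4P[|||/or4P[]] /eqP ->.
have r_1 : rho <= Bd by rewrite -[rho]mul1r; apply: rhoE; rewrite !inE eqxx.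
have r_q : q * rho <= Bd by apply: rhoE; rewrite !inE eqxx ?orbT.
have r_Q : Q * rho <= Bd by apply: rhoE; rewrite !inE eqxx ?orbT.
have r_Q2 : Q2 * rho <= Bd by apply: rhoE; rewrite !inE eqxx ?orbT.
have r_A1 : A1 * (Q2 + q) * rho <= Bd by apply: rhoE; rewrite !inE eqxx ?orbT.
have r_A0 : A0 * (1 + q) * rho <= Bd by apply: rhoE; rewrite !inE eqxx ?orbT.
have r_K : K * rho <= Bd by apply: rhoE; rewrite !inE eqxx ?orbT.
have unit_h u : u <= rho -> u <= 1 by move=> h; exact: le_trans h (le_trans r_1 B1).
have unit_t u : u <= q * rho -> u <= 1 by move=> h; exact: le_trans h (le_trans r_q B1).
have LL k : 1 <= L ^+ k := Lk_ge1 lam1 k.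
have L0 k : 0 < L ^+ k := Lk_gt0 lam1 k.
have ib k : 0 < (L ^+ k)^-1 <= 1 by rewrite invr_gt0 L0 invf_le1 // LL.
have common k z : nm z <= rho -> let h := z / lam ^+ k in let t := th * h in
   [/\ nm h <= rho / L ^+ k, nm t <= q * rho / L ^+ k, nm h <= rho, nm t <= q * rho &
     nm (disp 0 m h t - slope * t) + nm t <= Q * rho / L ^+ k].
  move=> hz h t; have /andP[i0 i1] := ib k.
  have h1 : nm h <= rho / L ^+ k.
    by rewrite /h nm_div nmX; apply: ler_wpM2r => //; exact: ltW.
  have t1 : nm t <= q * rho / L ^+ k by rewrite /t nmM -mulrA; apply: ler_wpM2l.
  have le (u : R) : 0 <= u -> u / L ^+ k <= u by move=> u0; apply: ler_piMr.
  have h2 : nm h <= rho by apply: le_trans h1 (le _ (ltW rho0)).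
  have t2 : nm t <= q * rho by apply: le_trans t1 (le _ _); rewrite mulr_ge0 // ltW.
  split => //.
  have hd := hA0 m h t (leqnn m) (unit_h _ h2) (unit_t _ t2).
  have := nmB (disp 0 m h t) (slope * t); rewrite nmM -/p => hn.
  have := ler_wpM2l p0 t1; have := ler_wpM2l A00 (lerD h1 t1).
  have -> : Q * rho / L ^+ k = A0 * (rho / L ^+ k + q * rho / L ^+ k) + p * (q * rho / L ^+ k)
     + q * rho / L ^+ k by rewrite /Q; ring.
  lra.
have small k z : nm z <= rho -> let h := z / lam ^+ k in let t := th * h in
    forall k', (k' <= k)%N ->
    nm (run block k' (disp 0 m h t - slope * t) t + slope * t) <= Q2 * rho.
  move=> hz h t k' kk'; have [h1 t1 h2 t2 s1] := common k z hz.
  rewrite -/h -/t in h1 t1 h2 t2 s1.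
  have Lk' := L0 k'.
  have hLk : L ^+ k' * (Q * rho / L ^+ k) <= Q * rho.
    rewrite mulrCA; apply: ler_piMr; first by rewrite mulr_ge0 // ltW.
    by rewrite ler_pdivrMr // mul1r; exact: Lk_le.
  have hs := ler_wpM2l (ltW Lk') s1.
  have := run_bound lam1 C0 block00 hb (k := k') (y := disp 0 m h t - slope * t) (t := t).
  move=> /(_ (le_trans hs (le_trans hLk (le_trans r_Q B3)))) hr.
  apply: le_trans (nmD _ _) _; rewrite nmM -/p.
  have := ler_wpM2l p0 t2; rewrite /Q2; move: hr; rewrite -mulrA; lra.
exists rho => //; split.
- exact: le_trans r_K B4.
- move=> z0 eps hz0 eps0.
  pose D := C2 * ((1 + q) * rho) * ((1 + q) * rho).
  have q1r : 0 <= (1 + q) * rho by apply: mulr_ge0; [exact: addr_ge0|exact: ltW].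
  have D0 : 0 <= D by apply: mulr_ge0 => //; exact: mulr_ge0.
  have e4 : 0 < eps / 4 by lra.
  have [k1 hk1] := psi1 D _ D0 e4.
  have [|k2 hk2] := small_pow lam1 (_ : 0 <= p * (q * rho)) e4.
    by apply: mulr_ge0 => //; apply: mulr_ge0 => //; exact: ltW.
  exists (eps / (8 * (K + 1))); first by rewrite divr_gt0 // mulr_gt0 //; lra.
  exists (maxn k1 k2) => k z; rewrite geq_max => /andP[kk1 kk2] hz hzz.
  have [h1 t1 h2 t2 s1] := common k z hz.
  set h := z / lam ^+ k in h1 t1 h2 t2 s1 *; set t := th * h in t1 t2 s1 *.
  have hKz w : nm w <= rho -> nm (kappa th * w) <= r.
    move=> hw; rewrite nmM -/K; apply: le_trans B4.
    exact: le_trans (ler_wpM2l K0 hw) r_K.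
  have adm : admissible lam C r0 D k (kappa th * z) (disp 0 m h t - slope * t) t.
    split; last first.
      apply: le_trans t1 _; apply: ler_wpM2r; first by rewrite invr_ge0 ltW.
      exact: le_trans r_q (le_trans B4 rr2).
    have -> : disp 0 m h t - slope * t - kappa th * z / lam ^+ k =
       disp 0 m h t - disp 0 m 0 0 - (lin_x 0 m * (h - 0) + lin_t 0 m * (t - 0)).
      by rewrite disp00 /t /h /kappa; ring.
    have n0 : nm (0 : R[i]) <= 1 by rewrite nm0.
    apply: le_trans (hC2 h 0 t 0 (unit_h _ h2) n0 (unit_t _ t2) n0) _.
    rewrite !subr0 nm0 !addr0.
    have hs : nm h + nm t <= (1 + q) * rho / L ^+ k.
      have -> : (1 + q) * rho / L ^+ k = rho / L ^+ k + q * rho / L ^+ k by ring.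
      exact: lerD.
    have s0 : 0 <= nm h + nm t by rewrite addr_ge0 ?nm_ge0.
    have -> : D / L ^+ k / L ^+ k = C2 * ((1 + q) * rho / L ^+ k) * ((1 + q) * rho / L ^+ k).
      by rewrite /D; ring.
    apply: ler_pM => //; first by rewrite mulr_ge0.
    exact: ler_wpM2l.
  have e1 := hk1 k kk1 (kappa th * z) _ _ (le_trans (hKz z hz) rr2) adm.
  have e2 : nm (slope * t) <= eps / 4.
    apply: le_trans (hk2 k kk2); rewrite nmM -/p -mulrA.
    by apply: ler_wpM2l.
  have e3 : nm (psi (kappa th * z) - psi (kappa th * z0)) <= eps / 4.
    have := bl _ _ (hKz z hz) (hKz z0 hz0); rewrite -mulrBr nmM -/K => hbl.
    have := nm_subl (psi (kappa th * z) - psi (kappa th * z0)) (kappa th * (z - z0)).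
    rewrite nmM -/K; have : nm (z - z0) * (8 * (K + 1)) <= eps.
      by rewrite -ler_pdivlMr; [exact: ltW|rewrite mulr_gt0 //; lra].
    by have := nm_ge0 (z - z0); have := mulr_ge0 K0 (nm_ge0 (z - z0)); lra.
  rewrite /rescaled -/h -/t orb_run.
  set rn := run block k _ _ in e1 *.
  have -> : b m + (rn + slope * t) - (b m + psi (kappa th * z0)) =
    (rn - psi (kappa th * z)) + (slope * t + (psi (kappa th * z) - psi (kappa th * z0))) by ring.
  apply: le_lt_trans (nmD _ _) _.
  have := nmD (slope * t) (psi (kappa th * z) - psi (kappa th * z0)); lra.
- move=> k z hz; have [h1 t1 h2 t2 s1] := common k z hz.
  have sm := small k z hz.
  set h := z / lam ^+ k in h1 t1 h2 t2 s1 sm *; set t := th * h in t1 t2 s1 sm *.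
  rewrite /rescaled -/h -/t; apply: (bdd_follow heta).
    by rewrite addrC addKr; lra.
  move=> j hj; have [jm|jm] := ltnP j m.
    rewrite orb_disp addrC addKr.
    apply: le_lt_trans (hA0 j h t (ltnW jm) (unit_h _ h2) (unit_t _ t2)) _.
    have := ler_wpM2l A00 (lerD h2 t2).
    lra.
  have n0 := co_period_gt0 H.
  pose k' := ((j - m) %/ n)%N; pose l := ((j - m) %% n)%N.
  have jE : j = (m + k' * n + l)%N by rewrite -addnA -divn_eq subnKC.
  have k'k : (k' <= k)%N.
    rewrite /k' -(@leq_pmul2r n) //; apply: leq_trans (leq_trunc_div _ _) _.
    by rewrite leq_subLR ltnW.
  have ln : (l <= n)%N by rewrite ltnW // ltn_mod.
  rewrite jE orb_run_disp addrC addKr.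
  have sk := sm k' k'k.
  have Q2r := le_trans sk (le_trans r_Q2 B1).
  apply: le_lt_trans (hA1 l _ t ln Q2r (unit_t _ t2)) _.
  have := ler_wpM2l A10 (lerD sk t2).
  lra.
Qed.

End Local.

(** * Continuity, isolation and openness for deformed orbits *)

Section OrbitDeformations.
Variable R : realType.
Implicit Types (c t x y z w : R[i]).

Lemma orb_continuous f c x N (eps : R) : signs f -> 0 < eps ->
  exists2 d : R, 0 < d & forall c' x', nm (c' - c) < d -> nm (x' - x) < d ->
    nm (orb f c' x' N - orb f c x N) < eps.
Proof.
move=> sf; elim: N eps => [|N IH] eps eps0; first by exists eps.
have e2 : 0 < eps / 2 by lra.
have [r r0 hr] := contM (cont_id (orb f c x N)) (cont_id (orb f c x N)) e2.
have [d d0 hd] := IH r r0.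
exists (Num.min d (eps / 2)); first by rewrite lt_min d0.
move=> c' x'; rewrite !lt_min => /andP[h1 h2] /andP[h3 _].
have := hr _ (hd c' x' h1 h3); rewrite /= -!expr2 => h.
have -> : f N * orb f c' x' N ^+ 2 + c' - (f N * orb f c x N ^+ 2 + c) =
  f N * (orb f c' x' N ^+ 2 - orb f c x N ^+ 2) + (c' - c) by ring.
apply: le_lt_trans (nmD _ _) _; rewrite nmM (nm_sign (sf N)) mul1r; lra.
Qed.

Lemma taylor_orb k f (g h : R[i] -> R[i]) z N : taylor k g z -> taylor k h z ->
  taylor k (fun w => orb f (g w) (h w) N) z.
Proof.
move=> tg th; elim: N => [//|N IH] /=.
apply: taylorD => //; apply: taylorM; first exact: taylor_cst.
by apply: taylor_near (taylorM IH IH); apply: nr_all => w; rewrite expr2.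
Qed.

(** One squaring at a time: near a value [v] only [v] has the square [v^2], as [- v] is either far
    away or equal to [v = 0]. *)
Lemma orb_isolated f c x N : signs f ->
  nr x (fun y => y != x -> orb f c y N != orb f c x N).
Proof.
move=> sf; elim: N => [|N IH]; first exact: nr_all.
have to : cont (fun y => orb f c y N) x.
  by apply: (@taylor_cont _ 0); apply: taylor_orb; [exact: taylor_cst|exact: taylor_id].
have step : nr x (fun y => orb f c y N != orb f c x N ->
    orb f c y N ^+ 2 != orb f c x N ^+ 2).
  set v := orb f c x N; have [v0|v0] := eqVneq v 0.
    by apply: nr_all => y; rewrite v0 expr0n expf_eq0.
  have v2 : v + v != 0 by rewrite -mulr2n mulrn_eq0.
  have c2 : cont (fun y => orb f c y N + v) x by apply: contD => //; exact: cont_cst.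
  apply: nr_imp (cont_neq0 c2 v2) => y hy hne.
  by rewrite eqf_sqr negb_or hne -addr_eq0.
apply: nr_imp (nr_and IH step) => y [h1 h2] yx /=.
rewrite (inj_eq (addIr c)) (inj_eq (mulfI _)); first exact: h2 (h1 yx).
by apply/eqP => f0; have := sf N; rewrite f0 expr0n => /esym/eqP; rewrite oner_eq0.
Qed.

(** Repeating the first [n] signs makes the orbit periodic; the sum of the moduli over one period
    bounds it. *)
Lemma periodic_bdd f c y n : signs f -> (0 < n)%N -> orb f c y n = y -> bdd_start c y.
Proof.
move=> sf n0 hy; pose g k := f (k %% n)%N.
have gn k : orb g c y (k * n) = y.
  elim: k => [//|k IH]; rewrite mulSnr orbD IH -[RHS]hy; apply: orb_ext => i hi.
  by rewrite /g modnMDl modn_small.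
have gl l : orb g c y l = orb g c y (l %% n)%N.
  rewrite {1}(divn_eq l n) orbD gn; apply: orb_ext => i hi.
  by rewrite /g modnMDl.
have sg : signs g by move=> k; exact: sf.
exists g => //; apply: (@orb_bound _ g c y (\sum_(0 <= i < n) nm (orb g c y i))) => // l.
rewrite gl; have hl : (l %% n < n)%N by rewrite ltn_mod.
rewrite (bigD1_seq (l %% n)%N) ?iota_uniq ?mem_index_iota //=.
by rewrite lerDl; apply: sumr_ge0 => i _; exact: nm_ge0.
Qed.

(* A map within distance [1/2] (in Lipschitz norm) of the identity is open: a minimum
   of [|psi - w|] that is not a zero could be improved by moving towards [w]. *)
Lemma open_near_id (psi : R[i] -> R[i]) (r d : R) x0 w :
  (forall x y, nm x <= r -> nm y <= r -> nm (psi x - psi y - (x - y)) <= 1 / 2 * nm (x - y)) ->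
  0 < d -> nm x0 + d < r -> nm (w - psi x0) < d / 4 ->
  exists2 x, nm (x - x0) <= d & psi x = w.
Proof.
move=> bl d0 hd hw.
have rx x : nm (x - x0) <= d -> nm x < r by move=> h; have := nm_subl x x0; lra.
have lip x y : nm x <= r -> nm y <= r -> nm (psi x - psi y) <= 2 * nm (x - y).
  move=> hx hy; have := bl x y hx hy; have := nm_subl (psi x - psi y) (x - y).
  by have := nm_ge0 (x - y); lra.
have [||||x xd xmin] := @compact_max R (fun x => nm (x - x0) <= d)
    (fun x => - nm (psi x - w)) r x0.
- by rewrite subrr nm0 ltW.
- by move=> x /rx /ltW.
- move=> x /negP; rewrite -ltNge => hx; exists (nm (x - x0) - d); first lra.
  move=> y hy; apply/negP; rewrite -ltNge.
  by have := nm_tri y x x0; rewrite (nm_sym x y); lra.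
- move=> x hx eps eps0; have xr := rx x hx.
  have m0 : 0 < Num.min (r - nm x) (eps / 2) by rewrite lt_min subr_gt0 xr; lra.
  exists (Num.min (r - nm x) (eps / 2)) => // y; rewrite lt_min => /andP[h1 h2].
  have yr : nm y <= r by have := nm_subl y x; lra.
  have := lip y x yr (ltW xr).
  have := nm_tri (psi x) (psi y) w; have := nm_tri (psi y) (psi x) w.
  rewrite (nm_sym (psi x) (psi y)) => h3 h4 h5.
  by rewrite ltr_norml; apply/andP; split; lra.
exists x => //; apply/eqP; rewrite -subr_eq0 -oppr_eq0 opprB; set v := w - psi x.
apply/negPn/negP => v0; have nv : 0 < nm v by rewrite nm_gt0.
have x0d : nm (x0 - x0) <= d by rewrite subrr nm0 ltW.
have vd : nm v < d / 4.
  have := xmin x0 x0d; rewrite lerN2 (nm_sym (psi x)) (nm_sym (psi x0)) -/v; lra.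
have xlt : nm (x - x0) < d.
  have h := bl x x0 (ltW (rx x xd)) (ltW (rx x0 x0d)).
  have := nm_subl (x - x0) (psi x - psi x0).
  rewrite (nm_sym (x - x0)).
  have := nm_tri w (psi x) (psi x0); rewrite (nm_sym (psi x) w) -/v; lra.
pose s : R := Num.min (1 / 2) ((d - nm (x - x0)) / (2 * nm v)).
have s0 : 0 < s by rewrite lt_min !divr_gt0 ?mulr_gt0 // subr_gt0.
have s1 : s <= 1 / 2 by rewrite ge_min lexx.
have sv : s * nm v <= (d - nm (x - x0)) / 2.
  have : s <= (d - nm (x - x0)) / (2 * nm v) by rewrite ge_min lexx orbT.
  move/(ler_wpM2r (ltW nv)); set q := _ / _ * _.
  by have -> : q = (d - nm (x - x0)) / 2 by rewrite /q; field; rewrite gt_eqF.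
have E : x + s%:C%C * v - x = s%:C%C * v by rewrite addrC addKr.
have ns : nm (s%:C%C * v) = s * nm v by rewrite nmM nm_real gtr0_norm.
have yd : nm (x + s%:C%C * v - x0) <= d.
  by apply: le_trans (nm_tri x _ _) _; rewrite E ns; lra.
have := xmin _ yd; rewrite lerN2 => h.
have := bl _ _ (ltW (rx _ yd)) (ltW (rx x xd)); rewrite E ns => h2.
have : nm (psi (x + s%:C%C * v) - w) <= 1 / 2 * (s * nm v) + (1 - s) * nm v.
  have -> : psi (x + s%:C%C * v) - w = (psi (x + s%:C%C * v) - psi x - s%:C%C * v)
     + (- (1 - s)%:C%C) * v by rewrite rmorphB rmorph1 /v; ring.
  apply: le_trans (nmD _ _) _; rewrite [X in _ + X]nmM nmN nm_real ger0_norm; lra.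
rewrite (nm_sym (psi x)) -/v in h.
by have := mulr_gt0 s0 nv; lra.
Qed.

End OrbitDeformations.

(** * Stability of strict inequalities between distances *)

Section Distances.
Variable R : realType.
Implicit Types (v z : R[i]) (s : R).

Lemma nm_dist_gt v v' z s : nm (v' - v) < nm (v - z) - s -> s < nm (v' - z).
Proof. by move=> h; have := nm_tri v' v z; rewrite (nm_sym v v'); lra. Qed.

Lemma nm_dist_lt v v' z s : nm (v' - v) < s - nm (v - z) -> nm (v' - z) < s.
Proof. by move=> h; have := nm_tri v v' z; lra. Qed.

Lemma nm_close v v' s : nm (v' - v) < s -> `|nm v' - nm v| < s.
Proof.
move=> h; have h1 := nm_subl v' v; have h2 := nm_subl v v'.
by rewrite nm_sym in h2; rewrite ltr_norml; apply/andP; split; lra.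
Qed.

End Distances.

(** * Convergence of the blown-up sets *)

Section Similarity.
Variable R : realType.
Implicit Types (c t x y z w : R[i]).
Variables (a : R[i]) (b e : nat -> R[i]) (m n : nat).
Hypothesis H : critical_orbit a b e m n.
Let se := co_signs H.
Let lam := multiplier b e m n.
Let L : R := nm lam.
Let lam1 : 1 < L. Proof. exact: multiplier_gt1 H. Qed.

(** The return map minus the identity has derivative [lam - 1] at [b m], which is nonzero, and
    [disp_est] controls the remainder. *)
Lemma return_isolated :
  nr (b m) (fun y => y != b m -> orb (fun l => e (m + l)%N) a y n != y).
Proof.
have [C C0 hC] := disp_est H m n.
have l1 : 0 < nm (1 - lam) by rewrite nm_gt0 (multiplier_neq1 H).
exists (Num.min 1 (nm (1 - lam) / (C + 1))).
  by rewrite lt_min ltr01 divr_gt0 //; lra.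
move=> y; rewrite lt_min => /andP[h1 h2] yb; apply/eqP => hy.
set x := y - b m in h1 h2; have x0 : 0 < nm x by rewrite nm_gt0 subr_eq0.
have dx : disp a b e m n x 0 = x.
  rewrite /disp addr0 (_ : b m + x = y); last by rewrite /x addrC subrK.
  by rewrite hy; have := co_periodic H 0; rewrite !addn0 => ->.
have n0 : nm (0 : R[i]) <= 1 by rewrite nm0.
have := hC x 0 0 0 (ltW h1) n0 n0 n0.
rewrite dx (disp00 H) !subr0 nm0 !addr0 mulr0 addr0.
have -> : x - lin_x b e m n * x = (1 - lam) * x by rewrite /lam /multiplier; rewrite /lin_x; ring.
rewrite nmM ler_pM2r // => h3.
move: h2; rewrite ltr_pdivlMr; last lra.
lra.
Qed.

(* The set [K_a] (for [th = 0]) or the set [M] (for [th = 1]), seen from [a] at scale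
   [lam^k]. *)
Definition blown_up th k z :=
  bdd_start (a + th * (z / lam ^+ k)) (a + z / lam ^+ k).

Lemma limit_model : exists psi (r : R), [/\ 0 < r, bdd_start a (psi 0),
  (forall z, nm z < r -> cont psi z) &
  forall th, kappa b e m n th != 0 -> exists2 rho : R, 0 < rho &
    [/\ nm (kappa b e m n th) * rho <= r / 2,
     forall z, nm z < rho -> ~ bdd_start a (psi (kappa b e m n th * z)) ->
       exists2 d : R, 0 < d & exists k0, forall k z', (k0 <= k)%N -> nm (z' - z) < d ->
         ~ blown_up th k z' &
     forall z (d : R), nm z < rho -> bdd_start a (psi (kappa b e m n th * z)) -> 0 < d ->
       exists k0, forall k, (k0 <= k)%N -> exists2 z', nm (z' - z) < d & blown_up th k z']].
Proof.
have [psi [r [r0 psi0 bl hth]]] := local_limit H.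
have lip x y : nm x <= r -> nm y <= r -> nm (psi x - psi y) <= 2 * nm (x - y).
  move=> hx hy; have := bl x y hx hy; have := nm_subl (psi x - psi y) (x - y).
  by have := nm_ge0 (x - y); lra.
have cpsi z : nm z < r -> cont psi z.
  move=> hz eps eps0; exists (Num.min (r - nm z) (eps / 2)).
    by rewrite lt_min subr_gt0 hz; lra.
  move=> w; rewrite lt_min => /andP[h1 h2].
  have := lip w z (_ : nm w <= r) (ltW hz).
  have -> : nm w <= r by have := nm_subl w z; lra.
  move=> /(_ isT); lra.
exists psi, r; split => //; first by rewrite psi0; exact: co_bdd H m.
move=> th kn; set ka := kappa b e m n th in kn *.
have [rho' rho'0 [hk hlim hfol]] := hth th; rewrite -/ka in hk hlim.
pose rho := rho' / 2; have rho0 : 0 < rho by rewrite /rho; lra.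
have K0 : 0 < nm ka by rewrite nm_gt0.
have hkr : nm ka * rho <= r / 2 by rewrite /rho; lra.
have small_t (d : R) : 0 < d -> exists k0, forall k z, (k0 <= k)%N -> nm z <= rho' ->
    nm (a + th * (z / lam ^+ k) - a) < d.
  move=> d0; have d2 : 0 < d / 2 by lra.
  have [|k0 hk0] := small_pow lam1 (_ : 0 <= nm th * rho') d2.
    by rewrite mulr_ge0 ?nm_ge0 // ltW.
  exists k0 => k z /hk0 hk' hz; rewrite addrC addKr nmM nm_div nmX -/L.
  apply: le_lt_trans (_ : nm th * rho' / L ^+ k < _); last lra.
  rewrite -mulrA; apply: ler_wpM2l; first exact: nm_ge0.
  by apply: ler_wpM2r => //; rewrite invr_ge0 ltW // Lk_gt0.
exists rho => //; split => //.
- move=> z hz hb; have [d d0 hd] := bdd_open hb.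
  have zr : nm z <= rho' by rewrite /rho in hz; lra.
  have [d1 d10 [k1 hk1]] := hlim z d zr d0.
  have [k2 hk2] := small_t d d0.
  exists (Num.min d1 rho); first by rewrite lt_min d10.
  exists (maxn k1 k2) => k z'; rewrite geq_max lt_min => /andP[kk1 kk2] /andP[h1 h2].
  have z'r : nm z' <= rho' by have := nm_subl z' z; rewrite /rho in hz h2 *; lra.
  move=> /(hfol k z' z'r); apply: hd; first exact: hk2.
  exact: hk1.
move=> z d hz hb d0; set w := psi (ka * z) in hb.
pose d1 := Num.min d (rho - nm z) / 2.
have d10 : 0 < d1 by rewrite divr_gt0 // lt_min d0 subr_gt0.
have [d1d d1r] : d1 < d /\ d1 < rho - nm z.
  have h1 : Num.min d (rho - nm z) <= d by rewrite ge_min lexx.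
  have h2 : Num.min d (rho - nm z) <= rho - nm z by rewrite ge_min lexx orbT.
  by move: d10; rewrite /d1; split; lra.
pose D := nm ka * (d1 / 2); have D0 : 0 < D by rewrite mulr_gt0 //; lra.
have zD : nm (ka * z) + D < r.
  rewrite nmM /D -mulrDr; apply: le_lt_trans (_ : nm ka * rho < _); last by lra.
  by rewrite ler_pM2l //; lra.
have D4 : 0 < D / 4 by lra.
(* [w'] is a preimage of the cycle so close to [w] that, [psi] being open, it is the image of some
   [ka z1] with [z1] close to [z]. *)
have [w' [f sf [N hN]] hw'] := reaches_dense H hb D4.
have [x xD xw'] := open_near_id bl D0 zD hw'.
pose z1 := x / ka; have z1E : ka * z1 = x by rewrite /z1 mulrC divfK.
have z1d : nm (z1 - z) <= d1 / 2.
  by rewrite -(ler_pM2l K0) -nmM mulrBr z1E.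
have z1rho : nm z1 + d1 / 2 < rho by have := nm_subl z1 z; lra.
(* The cycle moves with the parameter, so the equation to be perturbed is not that of reaching [b m]
   but that of reaching a point fixed by [n] steps with the signs of the cycle. *)
pose F (c y : R[i]) := orb (fun l => e (m + l)%N) c (orb f c y N) n - orb f c y N.
have Fcont y (eps : R) : 0 < eps -> exists2 dd : R, 0 < dd & forall c' y',
    nm (c' - a) < dd -> nm (y' - y) < dd -> nm (F c' y' - F a y) < eps.
  move=> eps0; have e2 : 0 < eps / 2 by lra.
  have sm : signs (fun l => e (m + l)%N) by move=> l; exact: se.
  have [u u0 hu] := orb_continuous a (orb f a y N) n sm e2.
  have uu : 0 < Num.min u (eps / 2) by rewrite lt_min u0.
  have [v v0 hv] := orb_continuous a y N sf uu.
  exists (Num.min u v); first by rewrite lt_min u0.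
  move=> c' y'; rewrite !lt_min => /andP[h1 h2] /andP[h3 h4].
  have := hv c' y' h2 h4; rewrite lt_min => /andP[h5 h6].
  have h7 := hu c' _ h1 h5.
  have -> : F c' y' - F a y = (orb (fun l => e (m + l)%N) c' (orb f c' y' N) n -
      orb (fun l => e (m + l)%N) a (orb f a y N) n) - (orb f c' y' N - orb f a y N).
    by rewrite /F; ring.
  by apply: le_lt_trans (nmB _ _) _; lra.
have F0 : F a (psi (ka * z1)) = 0.
  rewrite z1E xw' /F hN; have := orb_b H m n; rewrite addrC => ->.
  by have := co_periodic H 0; rewrite !addn0 addrC => ->; rewrite subrr.
have kz1 v : nm v <= rho -> nm (ka * v) < r.
  by move=> hv; rewrite nmM; have := ler_wpM2l (ltW K0) hv; lra.
(* Three facts combine: [psi] is injective on its disc, the orbit map takes the value [b m] at an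
   isolated point, and [b m] is an isolated fixed point of the return map. *)
have Fiso : nr z1 (fun v => v != z1 -> F a (psi (ka * v)) != 0).
  have cp : cont (fun v => psi (ka * v)) z1.
    apply: cont_comp; last by apply: cpsi; apply: kz1; lra.
    by apply: contM; [exact: cont_cst|exact: cont_id].
  have inj : nr z1 (fun v => v != z1 -> psi (ka * v) != psi (ka * z1)).
    exists (d1 / 2); first lra.
    move=> v hv vz; apply/eqP => hp.
    have vr : nm v <= rho by have := nm_subl v z1; lra.
    have := bl _ _ (ltW (kz1 _ vr)) (ltW (kz1 z1 (ltac:(lra)))).
    rewrite hp subrr sub0r nmN -mulrBr nmM.
    have : 0 < nm ka * nm (v - z1) by rewrite mulr_gt0 // nm_gt0 subr_eq0.
    lra.
  have [d2 d20 hd2] := orb_isolated a (psi (ka * z1)) N sf.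
  have co : cont (fun v => orb f a (psi (ka * v)) N) z1.
    apply: (@cont_comp _ (fun y => orb f a y N) (fun v => psi (ka * v))) => //.
    by apply: (@taylor_cont _ 0); apply: taylor_orb; [exact: taylor_cst|exact: taylor_id].
  have [d3 d30 hd3] := return_isolated.
  have oz : orb f a (psi (ka * z1)) N = b m by rewrite z1E xw'.
  apply: nr_imp (nr_and inj (nr_and (cp d2 d20) (co d3 d30))) => v [i1 [i2 i3]] vz.
  rewrite /F subr_eq0; apply: hd3; first by rewrite -oz.
  by rewrite -oz; apply: hd2 => //; exact: i1.
have [d2 d20 hd2] := Fiso.
pose s := Num.min (d1 / 2) (d2 / 2).
have s0 : 0 < s by rewrite lt_min; apply/andP; split; lra.
have [sd1 sd2] : s <= d1 / 2 /\ s < d2.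
  have h1 : s <= d1 / 2 by rewrite ge_min lexx.
  have h2 : s <= d2 / 2 by rewrite ge_min lexx orbT.
  by split => //; lra.
have zs v : nm (v - z1) <= s -> nm v < rho by have := nm_subl v z1; lra.
(* A zero of [Q k] is a parameter for which the orbit returns to itself, hence is bounded. *)
pose Q k v := F (a + th * (v / lam ^+ k)) (rescaled a b e m n th k v).
have Qlim v (eps : R) : nm v <= rho -> 0 < eps -> exists2 dd : R, 0 < dd & exists k0,
    forall k v', (k0 <= k)%N -> nm v' <= rho' -> nm (v' - v) < dd ->
      nm (Q k v' - F a (psi (ka * v))) < eps.
  move=> hv eps0; have [u u0 hu] := Fcont (psi (ka * v)) eps eps0.
  have hv' : nm v <= rho' by rewrite /rho in hv; lra.
  have [dd dd0 [k1 hk1]] := hlim v u hv' u0.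
  have [k2 hk2] := small_t u u0.
  exists dd => //; exists (maxn k1 k2) => k v'; rewrite geq_max => /andP[kk1 kk2] h1 h2.
  by apply: hu; [exact: hk2|exact: hk1].
have rho_rho' : rho <= rho' by rewrite /rho; lra.
have [mu mu0 hmu] : exists2 mu : R, 0 < mu & forall v, nm (v - z1) = s ->
    mu <= nm (F a (psi (ka * v))).
  have sp : nm (z1 + s%:C%C - z1) = s by rewrite addrC addKr nm_real gtr0_norm.
  have [|||v vs vmin] := @compact_max R (fun v => nm (v - z1) = s)
     (fun v => - nm (F a (psi (ka * v)))) rho (z1 + s%:C%C) sp.
  - by move=> v hv; apply: ltW; apply: zs; rewrite hv.
  - move=> v hv; have hv' : 0 < `|nm (v - z1) - s| by rewrite normr_gt0 subr_eq0; apply/eqP.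
    have cv : cont (fun v => v - z1) v by apply: contD; [exact: cont_id|exact: cont_cst].
    apply: nr_imp (nm_cont cv hv') => w0 h hw0; move: h; rewrite hw0 distrC; lra.
  - move=> v hv eps eps0.
    have vr : nm v <= rho by apply: ltW; apply: zs; rewrite hv.
    have [dd dd0 hdd] := Fcont (psi (ka * v)) eps eps0.
    have cp : cont (fun v => psi (ka * v)) v.
      apply: cont_comp; last by apply: cpsi; exact: kz1.
      by apply: contM; [exact: cont_cst|exact: cont_id].
    apply: nr_imp (cp dd dd0) => v' hv'.
    have h := hdd a _ (_ : nm (a - a) < dd) hv'.
    rewrite subrr nm0 in h; have {}h := h dd0.
    by rewrite opprK addrC distrC; exact: nm_close.
  exists (nm (F a (psi (ka * v)))).
    rewrite nm_gt0; apply: hd2; first by rewrite vs.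
    by rewrite -subr_eq0 -nm_eq0 vs gt_eqF.
  by move=> v' hv'; have := vmin v' hv'; lra.
have mu2 : 0 < mu / 2 by lra.
have [k1 hk1] : exists k1, forall k v, (k1 <= k)%N -> nm v <= rho ->
    (nm (v - z1) = s -> mu / 2 <= nm (Q k v)).
  apply: (@disc_cover R rho (fun k v => nm (v - z1) = s -> mu / 2 <= nm (Q k v))) => v hv.
  have m4 : 0 < mu / 4 by lra.
  have [u' u'0 [k2 hk2]] := Qlim v (mu / 4) hv m4.
  have [hs|hs] := EM (nm (v - z1) <= s); last first.
    exists (nm (v - z1) - s); first by move/negP: hs; rewrite -ltNge subr_gt0.
    by exists 0%N => k v' _ /nm_dist_gt h1 h2; rewrite h2 ltxx in h1.
  (* Either the lower bound at [v] survives a perturbation of size [mu / 4], or [v] is off the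
     circle together with its neighbours. *)
  have [mv|mv] := EM (mu * (3 / 4) < nm (F a (psi (ka * v)))).
    exists u' => //; exists k2 => k v' kk h1 h2.
    have v'r : nm v' <= rho' by apply: le_trans rho_rho'; apply: ltW; apply: zs; rewrite h2.
    have := hk2 k v' kk v'r h1; have := nm_subl (F a (psi (ka * v))) (Q k v').
    by rewrite (nm_sym (F a _)); lra.
  have vs : nm (v - z1) < s.
    rewrite lt_neqAle hs andbT; apply/eqP => vs; apply: mv.
    by have := hmu v vs; lra.
  exists (s - nm (v - z1)); first by rewrite subr_gt0.
  by exists 0%N => k v' _ /nm_dist_lt h1 h2; rewrite h2 ltxx in h1.
have z1r : nm z1 <= rho by lra.
have [u u0 [k2 hk2]] := Qlim z1 (mu / 2) z1r mu2.
exists (maxn k1 k2) => k; rewrite geq_max => /andP[kk1 kk2].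
have tQ v : taylor 2 (Q k) v.
  have tl : taylor 2 (fun v => v / lam ^+ k) v.
    by apply: taylorM; [exact: taylor_id|exact: taylor_cst].
  have tc : taylor 2 (fun v => a + th * (v / lam ^+ k)) v.
    apply: taylorD; first exact: taylor_cst.
    by apply: taylorM => //; exact: taylor_cst.
  have tr : taylor 2 (rescaled a b e m n th k) v.
    apply: taylor_orb => //; apply: taylorD => //; exact: taylor_cst.
  have tf : taylor 2 (fun v => orb f (a + th * (v / lam ^+ k)) (rescaled a b e m n th k v) N) v.
    exact: taylor_orb.
  apply: taylorD; first exact: taylor_orb.
  apply: taylor_near (taylorM (taylor_cst 2 (-1) v) tf).
  by apply: nr_all => w0; rewrite mulN1r.
have [|||v vs Qv] := @min_modulus R (Q k) z1 s (mu / 2) s0.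
- by move=> v _; exact: tQ.
- move=> v hv; apply: (hk1 k) => //.
  by apply: ltW; apply: zs; rewrite hv.
- have z1r' : nm z1 <= rho' by lra.
  have := hk2 k z1 kk2 z1r'; rewrite subrr nm0 F0 subr0; exact.
exists v.
  by apply: nm_dist_lt; apply: le_lt_trans vs _; lra.
rewrite /blown_up; set c := a + th * _.
apply: (@bdd_orb _ e c _ (m + k * n) se).
apply: (@bdd_orb _ f c _ N sf).
apply: (@periodic_bdd _ (fun l => e (m + l)%N) c _ n) => //.
- exact: co_period_gt0 H.
- by move/eqP: Qv; rewrite /Q /F subr_eq0 => /eqP.
Qed.

End Similarity.

(** * From Kuratowski to Hausdorff convergence *)

Section Hausdorff.
Variable R : realType.
Implicit Types (x y z w : R[i]).

(** Both truncations contain the circle of radius [r], so pointwise conditions in the open disc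
    suffice: points of the circle approximate themselves, and [disc_cover] makes the estimates
    uniform. *)
Lemma kuratowski_hausdorff (A : nat -> set (Cx R)) (B : set (Cx R)) (r : R) : 0 < r ->
  closed B ->
  (forall z, nm z < r -> ~ B z -> exists2 d : R, 0 < d & exists k0, forall k z',
     (k0 <= k)%N -> nm (z' - z) < d -> ~ A k z') ->
  (forall z (d : R), nm z < r -> B z -> 0 < d -> exists k0, forall k, (k0 <= k)%N ->
     exists2 z', nm (z' - z) < d & A k z') ->
  hausdorff_dist (truncation r (A k)) (truncation r B) @[k --> \oo] --> 0%E.
Proof.
move=> r0 cB hU hL.
pose near_set (X Y : set (Cx R)) (eps : R) :=
  forall x, X x -> exists2 y : R[i], Y y & nm ((x : R[i]) - y) <= eps.
have circ (Y : set (Cx R)) x : nm x = r -> truncation r Y x by move=> hx; right.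
have tr (Y : set (Cx R)) x : truncation r Y x -> nm x <= r.
  by case=> [[_ h]|h]; [exact: h|have -> : nm x = r := h].
have N1 (eps : R) : 0 < eps -> exists k0, forall k, (k0 <= k)%N ->
    near_set (truncation r (A k)) (truncation r B) eps.
  move=> eps0; have [|k0 hk0] := @disc_cover R r (fun k x => truncation r (A k) x ->
     exists2 y : R[i], truncation r B y & nm (x - y) <= eps); last first.
    by exists k0 => k hk x hx; apply: (hk0 k x hk) => //; exact: (tr _ _ hx).
  move=> x xr; have [xe|xne] := eqVneq (nm x) r.
    exists eps => //; exists 0%N => k x' _ hx _; exists x; [exact: circ|exact: ltW].
  have {xne} xr : nm x < r by rewrite lt_neqAle xne.
  have [Bx|Bx] := EM (B x).
    exists eps => //; exists 0%N => k x' _ hx _; exists x; last exact: ltW.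
    by left; split => //; exact: ltW.
  have [d d0 [k0 hk0]] := hU x xr Bx.
  exists (Num.min d (r - nm x)); first by rewrite lt_min d0 subr_gt0.
  exists k0 => k x' hk; rewrite lt_min => /andP[h1 h2] [[/(hk0 k x' hk h1)//]|].
  move=> h3; have h4 : nm x' = r := h3.
  by exfalso; have := nm_subl x' x; lra.
have N2 (eps : R) : 0 < eps -> exists k0, forall k, (k0 <= k)%N ->
    near_set (truncation r B) (truncation r (A k)) eps.
  move=> eps0; have [|k0 hk0] := @disc_cover R r (fun k x => truncation r B x ->
     exists2 y : R[i], truncation r (A k) y & nm (x - y) <= eps); last first.
    by exists k0 => k hk x hx; apply: (hk0 k x hk) => //; exact: (tr _ _ hx).
  move=> x xr; have [xe|xne] := eqVneq (nm x) r.
    exists eps => //; exists 0%N => k x' _ hx _; exists x; [exact: circ|exact: ltW].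
  have {xne} xr : nm x < r by rewrite lt_neqAle xne.
  have [Bx|Bx] := EM (B x).
    have d0 : 0 < Num.min (eps / 2) (r - nm x) by rewrite lt_min subr_gt0 xr divr_gt0.
    have [k0 hk0] := hL x _ xr Bx d0.
    exists (eps / 2); first lra.
    exists k0 => k x' hk hx _; have [y hy Ay] := hk0 k hk; exists y.
      left; split => //; have : Num.min (eps / 2) (r - nm x) <= r - nm x.
        by rewrite ge_min lexx orbT.
      by move=> h; have := nm_subl y x => h'; have hh : nm y <= r by lra.
    have : Num.min (eps / 2) (r - nm x) <= eps / 2 by rewrite ge_min lexx.
    by have := nm_tri x x' y; rewrite (nm_sym x y); lra.
  have [d d0 hd] := nr_closed cB Bx.
  exists (Num.min d (r - nm x)); first by rewrite lt_min d0 subr_gt0.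
  exists 0%N => k x' _; rewrite lt_min => /andP[h1 h2] [[/(hd x' h1)//]|].
  move=> h3; have h4 : nm x' = r := h3.
  by exfalso; have := nm_subl x' x; lra.
pose excess (X Y : set (Cx R)) : \bar R :=
    ereal_sup [set ereal_inf [set (cmod (x - y))%:E | y in Y] | x in X].
have exc_le X Y (eps : R) : near_set X Y eps -> (excess X Y <= eps%:E)%E.
  move=> h; apply: ge_ereal_sup => _ [x Xx <-].
  have [y Yy hy] := h x Xx.
  apply: (@le_trans _ _ (cmod ((x : Cx R) - (y : Cx R)))%:E).
    by apply: ereal_inf_lbound; exists y.
  by rewrite lee_fin; exact: hy.
have exc_ge X Y x : X x -> (0 <= excess X Y)%E.
  move=> Xx; apply: (@le_trans _ _ (ereal_inf [set (cmod ((x : Cx R) - y))%:E | y in Y])).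
    by apply: le_ereal_inf_tmp => _ [y _ <-]; rewrite lee_fin; exact: (nm_ge0 ((x : R[i]) - y)).
  by apply: ereal_sup_ubound; exists x.
(* A point of the truncation makes the distance nonnegative; a supremum over the empty set would be
   [-oo]. *)
have pt : truncation r B (r%:C%C : R[i]).
  by apply: circ; rewrite nm_real gtr0_norm.
have ge0 k : (0 <= hausdorff_dist (truncation r (A k)) (truncation r B))%E.
  by rewrite /hausdorff_dist le_max (exc_ge _ _ _ pt) orbT.
have small (eps : R) : 0 < eps -> exists k0, forall k, (k0 <= k)%N ->
    (hausdorff_dist (truncation r (A k)) (truncation r B) <= eps%:E)%E.
  move=> eps0; have [k1 h1] := N1 eps eps0; have [k2 h2] := N2 eps eps0.
  exists (maxn k1 k2) => k; rewrite geq_max => /andP[hk1 hk2].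
  by rewrite /hausdorff_dist ge_max (exc_le _ _ _ (h1 k hk1)) (exc_le _ _ _ (h2 k hk2)).
have fin k (eps : R) : (hausdorff_dist (truncation r (A k)) (truncation r B) <= eps%:E)%E ->
    hausdorff_dist (truncation r (A k)) (truncation r B) \is a fin_num.
  by move=> h; rewrite ge0_fin_numE //; apply: le_lt_trans h (ltry _).
apply/fine_cvgP; split.
  by have [k0 hk0] := small 1 ltr01; exists k0 => // k /= hk; apply: fin (hk0 k hk).
apply/cvgrPdist_lt => eps eps0; have e2 : 0 < eps / 2 by lra.
have [k0 hk0] := small _ e2; exists k0 => // k /= hk.
rewrite sub0r normrN ger0_norm; last exact: fine_ge0.
apply: le_lt_trans (_ : eps / 2 < _); last lra.
by rewrite -lee_fin fineK ?(fin _ _ (hk0 k hk)) // hk0.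
Qed.

End Hausdorff.

(** * Algebraic integers *)

Section Integers.
Variable R : realType.
Implicit Types (x y z w : R[i]).

Definition alg_int x := integralOver (intr : int -> R[i]) x.

(** A monic integral equation of degree [d] for [1 / 2], multiplied by [2^d], says that an even
    integer plus 1 is 0. *)
Lemma two_not_unit t : alg_int t -> 2 * t != 1.
Proof.
move=> [p mp rp]; apply/eqP => ht.
have inj : injective (intr : int -> R[i]) := @intr_inj _.
set d := (size p).-1; have sp : size p = d.+1.
  by rewrite prednK // lt0n size_poly_eq0 monic_neq0.
have pd : p`_d = 1 by have := monicP mp; rewrite lead_coefE.
have pow k : (k <= d)%N -> 2 ^+ (d - k) = 2 ^+ d * t ^+ k :> R[i].
  by move=> hk; rewrite -[in RHS](subnK hk) exprD -mulrA -exprMn ht expr1n mulr1.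
have E : (\sum_(i < d) p`_i * 2 ^+ (d - i) + 1)%:~R = 0 :> R[i].
  have := rp; rewrite /root horner_coef size_map_inj_poly // sp big_ord_recr /=.
  move=> /eqP h; have := congr1 (fun u => 2 ^+ d * u) h; rewrite mulr0 => <-.
  rewrite mulrDr rmorphD rmorph1 rmorph_sum mulr_sumr /=; congr (_ + _).
    apply: eq_bigr => i _; rewrite coef_map /= rmorphM rmorphXn /=.
    by rewrite (pow i (ltnW (ltn_ord i))) mulrCA.
  by rewrite coef_map /= pd mul1r -exprMn ht expr1n.
have {}E : \sum_(i < d) p`_i * 2 ^+ (d - i) + 1 = 0.
  by apply: inj; rewrite E.
have : (2 %| \sum_(i < d) p`_i * 2 ^+ (d - i))%Z.
  apply: rpred_sum => i _; apply: dvdz_mull.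
  by rewrite -(subnSK (ltn_ord i)) exprS dvdz_mulr.
have -> : \sum_(i < d) p`_i * 2 ^+ (d - i) = -1.
  by apply/eqP; rewrite -subr_eq0 opprK E.
by [].
Qed.

(** If [p] vanishes at [x^2], then [p(X^2)] vanishes at [x] and is still monic. *)
Lemma alg_int_sq x : alg_int (x ^+ 2) -> alg_int x.
Proof.
move=> [p mp rp]; exists (p \Po 'X^2).
  apply/monicP; rewrite lead_coef_comp ?size_polyXn // lead_coefXn expr1n mulr1.
  exact: monicP.
by move: rp; rewrite /root map_comp_poly map_polyXn horner_comp hornerXn.
Qed.

Lemma alg_intD x y : alg_int x -> alg_int y -> alg_int (x + y).
Proof. exact: integral_add. Qed.
Lemma alg_intB x y : alg_int x -> alg_int y -> alg_int (x - y).
Proof. exact: integral_sub. Qed.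
Lemma alg_intM x y : alg_int x -> alg_int y -> alg_int (x * y).
Proof. exact: integral_mul. Qed.
Lemma alg_int_nat k : alg_int k%:R. Proof. exact: integral_nat. Qed.
Lemma alg_int1 : alg_int 1. Proof. exact: (alg_int_nat 1). Qed.
Lemma alg_int0 : alg_int 0. Proof. exact: (alg_int_nat 0). Qed.
Lemma alg_intX x k : alg_int x -> alg_int (x ^+ k).
Proof.
by move=> hx; elim: k => [|k IH]; rewrite ?expr0 ?exprS; [exact: alg_int1|exact: alg_intM].
Qed.
Lemma alg_int_sign x : x ^+ 2 = 1 -> alg_int x.
Proof. by move=> h; apply: alg_int_sq; rewrite h; exact: alg_int1. Qed.

Definition int_poly (p : {poly R[i]}) := forall i, alg_int p`_i.

Lemma int_polyD p q : int_poly p -> int_poly q -> int_poly (p + q).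
Proof. by move=> hp hq i; rewrite coefD; apply: alg_intD. Qed.
Lemma int_polyB p q : int_poly p -> int_poly q -> int_poly (p - q).
Proof. by move=> hp hq i; rewrite coefB; apply: alg_intB. Qed.
Lemma int_polyZ x p : alg_int x -> int_poly p -> int_poly (x *: p).
Proof. by move=> hx hp i; rewrite coefZ; apply: alg_intM. Qed.
Lemma int_polyM p q : int_poly p -> int_poly q -> int_poly (p * q).
Proof.
move=> hp hq i; rewrite coefM; elim/big_ind: _ => [|u v|j _].
- exact: alg_int0.
- exact: alg_intD.
- exact: alg_intM.
Qed.
Lemma int_polyX : int_poly 'X.
Proof. by move=> i; rewrite coefX; exact: alg_int_nat. Qed.

Lemma alg_int_root_monic p x : int_poly p -> p \is monic -> root p x -> alg_int x.
Proof.
move=> ip mp rp; apply: (integral_root_monic mp rp).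
by apply/integral_poly.
Qed.

End Integers.

(** * Transversality: the critical value against the moving cycle *)

Section Transversality.
Variable R : realType.
Implicit Types (x y z w : R[i]).
Variables (a : R[i]) (b e : nat -> R[i]) (m n : nat).
Hypothesis H : critical_orbit a b e m n.
Let se := co_signs H.
Let bS := co_step H.
Let bn0 := co_neq0 H.

(** The orbit of the critical value as polynomials in the parameter, with the signs frozen. The
    leading coefficients square to 1, so preperiodicity makes [a] an algebraic integer. *)
Fixpoint orbit_poly j : {poly R[i]} :=
  if j is k.+1 then e k *: orbit_poly k ^+ 2 + 'X else 'X.

Lemma sign_neq0 j : e j != 0.
Proof. by apply/eqP => h; have := se j; rewrite h expr0n => /esym/eqP; rewrite oner_eq0. Qed.

Lemma orbit_poly_root j : (orbit_poly j).[a] = b j.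
Proof.
elim: j => [|j IH] /=; first by rewrite hornerX (co_start H).
by rewrite hornerD hornerZ horner_exp IH hornerX bS.
Qed.

Lemma orbit_poly_lead j :
  size (orbit_poly j) = (2 ^ j).+1 /\ lead_coef (orbit_poly j) ^+ 2 = 1.
Proof.
elim: j => [|j [IH1 IH2]]; first by rewrite /= size_polyX lead_coefX expr1n.
have p0 : orbit_poly j != 0 by rewrite -size_poly_eq0 IH1.
have s2 : size (e j *: orbit_poly j ^+ 2) = (2 ^ j.+1).+1.
  rewrite size_scale ?sign_neq0 // expr2 size_mul // IH1 expnS mul2n -addnn.
  by rewrite addSn addnS.
have lt : (size ('X : {poly R[i]}) < size (e j *: orbit_poly j ^+ 2))%N.
  rewrite size_polyX s2 ltnS expnS mul2n -addnn.
  by have := expn_gt0 2 j; case: (2 ^ j)%N => // k _; rewrite addSn addnS.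
rewrite [orbit_poly _]/= size_polyDl // lead_coefDl // s2 lead_coefZ lead_coef_exp.
by rewrite IH2 mulr1 se.
Qed.

Lemma orbit_poly_int j : int_poly (orbit_poly j).
Proof.
elim: j => [|j IH] /=; first exact: int_polyX.
apply: int_polyD; last exact: int_polyX.
by apply: int_polyZ; [exact: alg_int_sign (se j)|rewrite expr2; exact: int_polyM].
Qed.

Lemma parameter_alg_int : alg_int a.
Proof.
pose p := orbit_poly (m + n) - orbit_poly m.
have [s1 l1] := orbit_poly_lead (m + n); have [s2 _] := orbit_poly_lead m.
have lt : (size (- orbit_poly m) < size (orbit_poly (m + n)))%N.
  rewrite size_polyN s1 s2 ltnS ltn_exp2l // -[X in (X < _)%N]addn0 ltn_add2l.
  exact: co_period_gt0 H.
have lp : lead_coef p = lead_coef (orbit_poly (m + n)) by rewrite /p lead_coefDl.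
apply: (@alg_int_root_monic _ (lead_coef p *: p)).
- apply: int_polyZ; first by apply: alg_int_sign; rewrite lp.
  by apply: int_polyB; exact: orbit_poly_int.
- by apply/monicP; rewrite lead_coefZ -expr2 lp.
- rewrite /root hornerZ /p hornerD hornerN !orbit_poly_root.
  by have := co_periodic H 0; rewrite !addn0 => ->; rewrite subrr mulr0.
Qed.

Lemma orbit_alg_int j : alg_int (b j).
Proof.
elim: j => [|j IH]; first by rewrite (co_start H); exact: parameter_alg_int.
rewrite bS; apply: alg_intD; last exact: parameter_alg_int.
by apply: alg_intM; [exact: alg_int_sign (se j)|exact: alg_intX].
Qed.

(* [dorb j] is the derivative at [c = a] of the [j]-th point of the orbit of [c]. *)
Definition dorb j := lin_x b e 0 j + lin_t b e 0 j.

Lemma dorb0 : dorb 0 = 1.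
Proof. by rewrite /dorb /lin_x big_geq // addr0. Qed.

Lemma dorbS j : dorb j.+1 = 2 * (e j * b j * dorb j) + 1.
Proof. by rewrite /dorb lin_xS /= add0n; ring. Qed.

Lemma dorbD j : dorb (m + j) = lin_x b e m j * dorb m + lin_t b e m j.
Proof.
elim: j => [|j IH]; first by rewrite addn0 /lin_x big_geq //= mul1r addr0.
by rewrite addnS dorbS IH lin_xS /=; ring.
Qed.

(** If [kappa] vanishes, the critical orbit moves at time [m] with the velocity [slope] of the
    periodic point, and that velocity is reproduced by the return map. *)
Lemma kappa1_dorb : kappa b e m n 1 = 0 -> dorb (m + n) = dorb m.
Proof.
have l0 := multiplier_neq1 H; rewrite /kappa mul1r addrA -/(dorb m) => h.
rewrite dorbD (_ : lin_x b e m n = multiplier b e m n) //.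
have <- : slope b e m n = dorb m by apply/eqP; rewrite eq_sym -subr_eq0 h.
have -> : lin_t b e m n = slope b e m n * (1 - multiplier b e m n).
  by rewrite /slope mulfVK.
by ring.
Qed.

(* Modulo [2] the derivative of an orbit point with respect to the parameter is [1];
   the case analysis is on the fourth root of unity by which the two preimages of the
   periodic point on the critical orbit differ. *)
Lemma dorb_neq : dorb (m + n) <> dorb m.
Proof.
have [m' mE] : exists m', m = m'.+1.
  by exists m.-1; rewrite prednK //; exact: co_preperiod_gt0 H.
have n0 := co_period_gt0 H.
have Da j : alg_int (dorb j).
  elim: j => [|j IH]; first by rewrite dorb0; exact: alg_int1.
  rewrite dorbS; apply: alg_intD; last exact: alg_int1.
  apply: alg_intM; first exact: alg_int_nat.
  apply: alg_intM => //; apply: alg_intM; [exact: alg_int_sign (se j)|exact: orbit_alg_int].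
(* the predecessor [p] of [b j], with the convention that [0] precedes [a] *)
have pre j : exists u p s t : R[i], [/\ alg_int u, alg_int p, alg_int t,
    [/\ s ^+ 2 = 1, dorb j = 1 + 2 * u & b j = s * p ^+ 2 + a] & u = p + 2 * t].
  case: j => [|j].
    exists 0, 0, 1, 0; split; try exact: alg_int0; last by ring.
    by rewrite dorb0 (co_start H) expr1n; split => //; ring.
  have half (s : R[i]) : s ^+ 2 = 1 -> exists2 q, alg_int q & s = 1 + 2 * q.
    case/signE => ->; first by exists 0; [exact: alg_int0|ring].
    by exists (-1); [apply: alg_int_sign; rewrite sqrrN expr1n|ring].
  have [q qa qE] := half _ (se j).
  have [v va vE] : exists2 v, alg_int v & dorb j * b j = b j + 2 * v.
    case: j {q qa qE} => [|j].
      by exists 0; [exact: alg_int0|rewrite dorb0; ring].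
    exists (e j * b j * dorb j * b j.+1); last by rewrite dorbS; ring.
    apply: alg_intM; last exact: orbit_alg_int.
    apply: alg_intM => //; apply: alg_intM; [exact: alg_int_sign (se j)|exact: orbit_alg_int].
  have ea := alg_int_sign (se j); have ba := orbit_alg_int j.
  exists (e j * b j * dorb j), (b j), (e j), (q * b j + e j * v); split.
  - by apply: alg_intM => //; exact: alg_intM.
  - exact: orbit_alg_int.
  - by apply: alg_intD; exact: alg_intM.
  - by split; [exact: se|rewrite dorbS; ring|exact: bS].
  - transitivity (e j * (dorb j * b j)); first by ring.
    by rewrite vE mulrDr {1}qE; ring.
move=> hD; set x := b (m' + n)%N; set y := b m'.
have xy : x != y by rewrite /x /y; have := co_preperiodic H; rewrite mE.
have hb : e (m' + n)%N * x ^+ 2 = e m' * y ^+ 2.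
  have := co_periodic H 0; rewrite !addn0 mE addSn !bS.
  by move/addIr.
have hd : e (m' + n)%N * x * dorb (m' + n) = e m' * y * dorb m'.
  move: hD; rewrite mE addSn !dorbS => /addIr /mulfI; apply.
  by rewrite pnatr_eq0.
have x0 : x != 0 := bn0 _; have y0 : y != 0 := bn0 _.
(* Multiply by [x y] and cancel the common value of the two sides of [hb]. *)
have {hd} hd : y * dorb (m' + n) = x * dorb m'.
  apply: (mulfI (mulf_neq0 (sign_neq0 (m' + n)) (expf_neq0 2 x0))).
  rewrite {2}hb; transitivity (e (m' + n)%N * x * dorb (m' + n) * (x * y)); first by ring.
  by rewrite hd; ring.
(* The derivatives are now known modulo 4: [1 + 2 p1] for [x] and, by the next line, [1 + 2 p2] for
   [y], with [p1] and [p2] the preceding points. *)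
have [u1 [p1 [s1 [t1 [u1a p1a t1a [s1E D1 b1] u1E]]]]] := pre (m' + n)%N.
have [u2 [p2 [s2 [t2 [u2a p2a t2a [s2E D2 b2] u2E]]]]] := pre m'.
rewrite -/x in b1; rewrite -/y in b2; rewrite D1 D2 in hd.
have two0 : 2 != 0 :> R[i] by rewrite pnatr_eq0.
have [hx|hx] : x ^+ 2 = y ^+ 2 \/ x ^+ 2 = - y ^+ 2.
  by move: hb; case: (signE (se (m' + n)%N)) => ->; case: (signE (se m')) => ->;
    rewrite ?mul1r ?mulN1r => /eqP; rewrite ?eqr_opp ?eqr_oppLR => /eqP ->; [left|right|right|left].
(* Case [x = - y]: the derivatives give [p1 + p2 = -1] modulo 2, whereas [x + y = 0] makes
   [(p1 + p2)^2] divisible by 2. *)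
- have xNy : x = - y.
    by move/eqP: hx; rewrite eqf_sqr (negbTE xy) => /eqP.
  have hu : 1 + u1 + u2 = 0.
    apply: (mulfI two0); apply: (mulfI y0); rewrite !mulr0.
    have -> : y * (2 * (1 + u1 + u2)) = y * (1 + 2 * u1) + y * (1 + 2 * u2) by ring.
    by rewrite hd xNy; ring.
  have [v va vE] : exists2 v, alg_int v & (p1 + p2) ^+ 2 = 2 * v.
    have half (s p : R[i]) : s ^+ 2 = 1 -> alg_int p -> exists2 q, alg_int q & p ^+ 2 = s * p ^+ 2 + 2 * q.
      move=> /signE[] -> pa; first by exists 0; [exact: alg_int0|ring].
      by exists (p ^+ 2); [exact: alg_intX|ring].
    have [q1 q1a q1E] := half _ _ s1E p1a; have [q2 q2a q2E] := half _ _ s2E p2a.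
    exists (q1 + q2 - a + p1 * p2).
      apply: alg_intD; last exact: alg_intM.
      by apply: alg_intB; [exact: alg_intD|exact: parameter_alg_int].
    have -> : (p1 + p2) ^+ 2 = p1 ^+ 2 + p2 ^+ 2 + 2 * (p1 * p2) by ring.
    have h : s1 * p1 ^+ 2 = - (s2 * p2 ^+ 2) - 2 * a.
      move: xNy; rewrite b1 b2 => h; apply: (addIr a); rewrite h; ring.
    by rewrite q1E q2E h; ring.
  have pa := alg_intD p1a p2a; have ta := alg_intD t1a t2a.
  have va' : alg_int (v + 2 * ((p1 + p2) * (t1 + t2)) + 2 * (t1 + t2) ^+ 2).
    have n2 : alg_int (2 : R[i]) by exact: alg_int_nat.
    apply: alg_intD; last by apply: alg_intM => //; exact: alg_intX.
    by apply: alg_intD => //; apply: alg_intM => //; exact: alg_intM.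
  have := two_not_unit va'; apply/negP; rewrite negbK; apply/eqP.
  have h1 : p1 + p2 + 2 * (t1 + t2) = - 1.
    by apply: (addrI 1); rewrite addrN -[RHS]hu u1E u2E; ring.
  transitivity ((p1 + p2 + 2 * (t1 + t2)) ^+ 2); last by rewrite h1 sqrrN expr1n.
  have -> : (p1 + p2 + 2 * (t1 + t2)) ^+ 2 =
    (p1 + p2) ^+ 2 + 4 * ((p1 + p2) * (t1 + t2)) + 4 * (t1 + t2) ^+ 2 by ring.
  by rewrite vE; ring.
(* Case [y = k x] with [k^2 = -1]: the derivatives give [k - 1 = 2 v], and [k (k - 1)^2 = 2] turns
   this into [2 k v^2 = 1]. *)
pose k := y / x; have k2 : k ^+ 2 = -1.
  rewrite /k expr_div_n -[y ^+ 2]opprK -hx mulNr mulfV // expf_neq0 //.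
have ka : alg_int k.
  by apply: alg_int_sq; rewrite k2; apply: alg_int_sign; rewrite sqrrN expr1n.
have hk : k * (1 + 2 * u1) = 1 + 2 * u2.
  by apply: (mulfI x0); rewrite -hd mulrA /k; field.
pose v := u2 - k * u1.
have va : alg_int v by apply: alg_intB => //; exact: alg_intM.
have v2 : alg_int (k * v ^+ 2) by apply: alg_intM => //; exact: alg_intX.
have := two_not_unit v2; apply/negP; rewrite negbK; apply/eqP.
have h1 : k - 1 = 2 * v.
  transitivity (k * (1 + 2 * u1) - 2 * (k * u1) - 1); first by ring.
  by rewrite hk /v; ring.
apply: (mulfI two0); transitivity (k * (2 * v) ^+ 2); first by ring.
rewrite -h1; transitivity (k * k ^+ 2 - 2 * k ^+ 2 + k); first by ring.
by rewrite k2; ring.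
Qed.

Lemma kappa1_neq0 : kappa b e m n 1 != 0.
Proof. by apply/eqP => /kappa1_dorb; exact: dorb_neq. Qed.

Lemma kappa0_neq0 : kappa b e m n 0 != 0.
Proof.
rewrite /kappa mul0r addr0 /lin_x; elim: m => [|k IH]; first by rewrite big_geq ?oner_neq0.
by rewrite big_nat_recr //= mulf_neq0 // !mulf_neq0 ?pnatr_eq0 ?sign_neq0.
Qed.

End Transversality.

(** * The limit model and the two self-similarities *)

Section Model.
Variable R : realType.
Implicit Types (x y z w : R[i]).
Variables (a : R[i]) (b e : nat -> R[i]) (m n : nat).
Hypothesis H : critical_orbit a b e m n.
Let lam := multiplier b e m n.

Variables (psi : R[i] -> R[i]) (r : R).
Hypothesis r0 : 0 < r.
Hypothesis psi0 : bdd_start a (psi 0).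
Hypothesis cpsi : forall z, nm z < r -> cont psi z.

(** The points with [psi (k z)] in [K_a], cut off at [|k z| <= r / 2], where [psi] is continuous, so
    that the set is closed. The cut-off does not affect the disc of radius [rho] in which the
    convergence is tested. *)
Definition model (k : R[i]) : set (Cx R) :=
  [set z | nm (k * (z : R[i])) <= r / 2 /\ bdd_start a (psi (k * (z : R[i])))].

Lemma closed_model k : closed (model k).
Proof.
apply: closed_nr => z hz.
have cm : cont (fun w => k * w) z by apply: contM; [exact: cont_cst|exact: cont_id].
have [hn|hn] := leP (nm (k * z)) (r / 2); last first.
  have hn' : 0 < nm (k * z) - r / 2 by lra.
  apply: nr_imp (nm_cont cm hn') => w; rewrite ltr_norml => /andP[h1 _] [h2 _].
  by move: h2 => /=; lra.
have hb : ~ bdd_start a (psi (k * z)) by move=> h; apply: hz.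
have [d d0 hd] := bdd_open_start hb.
have cp : cont (fun w => psi (k * w)) z.
  by apply: cont_comp => //; apply: cpsi; have := r0; lra.
by apply: nr_imp (cp d d0) => w /hd h [_].
Qed.

Lemma model0 k : model k (0 : R[i]).
Proof. by split; rewrite /= mulr0 // nm0; have := r0; lra. Qed.

Lemma scale_model k k' : k != 0 -> k' != 0 ->
  scale_set (k / k' : R[i]) (model k) = model k'.
Proof.
move=> k0 k'0; apply/seteqP; split=> [_ [w [w1 w2] <-]|z [z1 z2]].
  have E : k' * ((k / k' : Cx R) * w) = k * (w : R[i]).
    by rewrite mulrA [k' * _]mulrC divfK.
  by split; rewrite /= E.
have kk : k / k' != 0 by rewrite mulf_neq0 ?invr_neq0.
have E : k * ((z : R[i]) / (k / k')) = k' * (z : R[i]) by field; rewrite k0 k'0.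
exists ((z : R[i]) / (k / k') : R[i]); first by split; rewrite /= E.
have E' : k / k' * ((z : R[i]) / (k / k')) = z by rewrite mulrC divfK.
exact: E'.
Qed.

Lemma blown_upP th (S : set (Cx R)) j z :
  (forall w : R[i], S w <-> bdd_start (a + th * (w - a)) w) ->
  scale_set (lam ^+ j : R[i]) (translate_set (a : Cx R) S) z <-> blown_up a b e m n th j z.
Proof.
have lj : lam ^+ j != 0.
  by rewrite expf_neq0 // -nm_gt0; apply: lt_trans (multiplier_gt1 H).
have E (v : R[i]) : a + v - a = v by rewrite addrC addKr.
move=> hS; split=> [[_ [w /hS Sw <-] <-]|h].
  have h : (lam ^+ j : Cx R) * (w - a) / lam ^+ j = (w : R[i]) - a by rewrite mulrC mulKf.
  rewrite /blown_up -/lam [X in bdd_start (_ + _ * X)]h h.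
  by rewrite [X in bdd_start _ X](_ : _ = w) //; rewrite addrC subrK.
exists (z / lam ^+ j : R[i]); last first.
  by have h' : lam ^+ j * (z / lam ^+ j) = z; [rewrite mulrC divfK|exact: h'].
exists (a + z / lam ^+ j : R[i]); last exact: E.
by apply/hS; rewrite E.
Qed.

Lemma self_similar th (S : set (Cx R)) (rho : R) : 0 < rho ->
  (forall w : R[i], S w <-> bdd_start (a + th * (w - a)) w) -> closed S -> S a ->
  nm (kappa b e m n th) * rho <= r / 2 ->
  (forall z, nm z < rho -> ~ bdd_start a (psi (kappa b e m n th * z)) ->
     exists2 d : R, 0 < d & exists k0, forall k z', (k0 <= k)%N -> nm (z' - z) < d ->
       ~ blown_up a b e m n th k z') ->
  (forall z (d : R), nm z < rho -> bdd_start a (psi (kappa b e m n th * z)) -> 0 < d ->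
     exists k0, forall k, (k0 <= k)%N -> exists2 z', nm (z' - z) < d &
       blown_up a b e m n th k z') ->
  asymptotically_self_similar S (a : Cx R) (lam : Cx R) (model (kappa b e m n th)).
Proof.
move=> rho0 hS cS Sa hr hU hL; split.
  split => //; [exact: multiplier_gt1 H|exact: closed_model|].
  by exists (0 : R[i]); exact: model0.
have hk z : nm z < rho -> nm (kappa b e m n th * z) <= r / 2.
  move=> hz; rewrite nmM; apply: le_trans hr; apply: ler_wpM2l; [exact: nm_ge0|exact: ltW].
exists rho => //; apply: kuratowski_hausdorff => //; first exact: closed_model.
- move=> z hz hB; have [|d d0 [k0 hk0]] := hU z hz.
    by move=> h; apply: hB; split => //; exact: hk.
  by exists d => //; exists k0 => k z' kk hz' /(blown_upP _ _ hS); exact: hk0.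
- move=> z d hz [_ hB] d0; have [k0 hk0] := hL z d hz hB d0.
  exists k0 => k kk; have [z' h1 h2] := hk0 k kk; exists z' => //.
  exact/(blown_upP _ _ hS).
Qed.

End Model.

Theorem theorem1p3 (R : realType) (a : Cx R) (ha : misiurewicz 4 2 a) :
  exists (lambda : Cx R) (B : set (Cx R)) (mu : Cx R),
    [/\ mu != 0,
        asymptotically_self_similar (filled_julia 4 2 a) a lambda B &
        asymptotically_self_similar (multibrot 4 2) a lambda
          (scale_set mu B)].
Proof.
have [b [e [m [n [se b0 bS bK [bn0 other n0 per pre]]]]]] := misiurewicz_orbit ha.
(* Index [m] is the last one before the cycle, so the preperiod is [m.+1]. *)
have H : critical_orbit (a : R[i]) b e m.+1 n by split.
have aK : bdd_start a a by rewrite -{2}b0.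
have [psi [r [r0 psi0 cpsi hth]]] := limit_model H.
have k0 := kappa0_neq0 H; have k1 := kappa1_neq0 H.
have [rho0 rho00 [hr0 U0 L0]] := hth 0 k0.
have [rho1 rho10 [hr1 U1 L1]] := hth 1 k1.
(* Both models are preimages of one set under multiplication by the respective [kappa], hence
   proportional with the quotient of the two factors as ratio. *)
exists (multiplier b e m.+1 n : R[i]), (model a psi r (kappa b e m.+1 n 0)),
  (kappa b e m.+1 n 0 / kappa b e m.+1 n 1 : R[i]); split.
- by rewrite mulf_neq0 ?invr_neq0.
- apply: (self_similar H r0 psi0 cpsi rho00) => //.
  + move=> w; rewrite mul0r addr0; exact: filled_juliaP.
  + exact: closed_filled_julia.
  + exact/filled_juliaP.
- rewrite scale_model //; apply: (self_similar H r0 psi0 cpsi rho10) => //.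
  + move=> w; rewrite mul1r addrC subrK.
    by split=> [/filled_juliaP /bdd_critical//|h]; apply/filled_juliaP/bdd_critical.
  + exact: closed_multibrot.
  + by apply/filled_juliaP/bdd_critical.
Qed.
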